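(* Let $(X_t)_{t\ge 0}$ be the risk process of the Cramér–Lundberg model with investments, $$X_t=X_0+\int_0^t a X_s\,ds + \int_0^t \sigma X_s\,dW_s +ct-\sum_{j=1}^{N(t)} \xi_j ,$$ as set up in the context, where the claim sizes are bounded by a constant $M>0$. Assume $\sigma>0$ and $\rho=\frac{2a}{\sigma^2}<1$. Then there exists $u^*>M$ such that $$\psi_{u^*}(u)=1\qquad\text{for all } u\ge u^*.$$
   Context: Model: $W_t$ is a standard Brownian motion; $N(t)$ is a Poisson process with parameter $\lambda>0$; the claim sizes $\xi_1,\xi_2,\dots$ are i.i.d. positive random variables with density $p(x)$, mean $\mu>0$ and finite variance; $W$, $N$ and $(\xi_i)$ are independent. The constants $a>0$ and $\sigma>0$ are the drift and volatility of the risky asset in which the capital is continuously invested, $c>0$ is the fixed premium rate, and $X_0$ is the (deterministic) initial capital. Equivalently, $dX_t=(aX_t+c)\,dt+\sigma X_t\,dW_t-dP_t$ with $P_t=\sum_{j=1}^{N(t)}\xi_j$. Cap: the claim sizes satisfy $\xi_i\le M$ almost surely, where $M>0$ is a constant. For $0\le u^*\le u$: $\psi_{u^*}(u)=P(T_{u^*}<\infty\mid X_0=u)$, where $T_{u^*}=\inf\{t>0:\ X_t<u^*\}$. *)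

(* Defs.v *)
From HB Require Import structures.
From mathcomp Require Import all_boot all_order all_algebra.
From mathcomp Require Import all_classical all_reals all_analysis.

Set Implicit Arguments.
Unset Strict Implicit.
Unset Printing Implicit Defensive.
Import Order.TTheory GRing.Theory Num.Theory.
Import numFieldNormedType.Exports.
Local Open Scope classical_set_scope.
Local Open Scope ring_scope.

(* Continuous-time processes are indexed by all of R, but they are only
   constrained and used at times t >= 0. *)

Section independence.
Context d (T : measurableType d) (R : realType) (P : probability T R).

Definition independent (G1 G2 : set (set T)) : Prop :=
  forall A B, G1 A -> G2 B -> P (A `&` B) = (P A * P B)%E.

Definition mutually_independent (I : eqType) (G : I -> set (set T)) : Prop :=
  forall (J : seq I) (A : I -> set T), uniq J ->
    (forall i, i \in J -> G i (A i)) ->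
    P (\big[setI/setT]_(i <- J) A i) = (\prod_(i <- J) P (A i))%E.

Definition sigma_rv d' (T' : measurableType d') (Y : T -> T') : set (set T) :=
  preimage_set_system setT Y measurable.

Definition sigma_family (I : Type) (D : set I) d' (T' : measurableType d')
    (Y : I -> T -> T') : set (set T) :=
  <<s \bigcup_(i in D) sigma_rv (Y i) >>.

(* [incr s t] stands for the increment Y_t - Y_s. *)
Definition independent_increments d' (T' : measurableType d')
    (incr : R -> R -> T -> T') : Prop :=
  forall (n : nat) (t : nat -> R), 0 <= t 0%N ->
    (forall i, t i <= t i.+1) ->
    mutually_independent (fun i : 'I_n => sigma_rv (incr (t i) (t i.+1))).

End independence.

Section filtrations.
Context d (T : measurableType d) (R : realType).

Record filtration (F : R -> set (set T)) : Prop := Filtration {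
  filtration_sigma : forall t, 0 <= t -> sigma_algebra setT (F t) ;
  filtration_sub : forall t, 0 <= t -> F t `<=` measurable ;
  filtration_mono : forall s t, 0 <= s -> s <= t -> F s `<=` F t }.

Definition adapted (F : R -> set (set T)) (X : R -> T -> R) : Prop :=
  forall t, 0 <= t -> sigma_rv (X t) `<=` F t.

Definition cadlag (x : R -> R) : Prop :=
  (forall t, 0 <= t -> x s @[s --> t^'+] --> x t) /\
  (forall t, 0 < t -> cvg (x s @[s --> t^'-])).

End filtrations.

Section driving_processes.
Context d (T : measurableType d) (R : realType) (P : probability T R).

(* The second parameter of [normal_prob] is the standard deviation. *)
Record brownian_motion (W : R -> {RV P >-> R}) : Prop := BrownianMotion {
  brownian0 : forall w, W 0 w = 0 ;
  brownian_continuous :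
    forall w, {within `[0, +oo[, continuous (fun t => W t w)} ;
  brownian_increments :
    independent_increments P (fun s t w => W t w - W s w) ;
  brownian_normal : forall s t, 0 <= s -> s < t ->
    forall B : set R, measurable B ->
      P [set w | B (W t w - W s w)] = normal_prob 0 (Num.sqrt (t - s)) B }.

(* The natural-number subtraction N t w - N s w is not truncated for s <= t,
   the paths being nondecreasing. *)
Record poisson_process (lambda : R) (N : R -> {RV P >-> nat}) : Prop :=
  PoissonProcess {
  poisson0 : forall w, N 0 w = 0%N ;
  poisson_nondecreasing :
    forall w s t, 0 <= s -> s <= t -> (N s w <= N t w)%N ;
  poisson_cadlag : forall w, cadlag (fun t => (N t w)%:R : R) ;
  poisson_increments :
    independent_increments P (fun s t w => (N t w - N s w)%N) ;
  poisson_law : forall s t, 0 <= s -> s < t -> forall k : nat,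
    P [set w | (N t w - N s w)%N = k] =
      (poisson_pmf (lambda * (t - s)) k)%:E }.

(* The claim xi_j of the model (j >= 1) is [xi j.-1]. *)
Record claim_sizes (p : R -> R) (mu : R) (xi : nat -> {RV P >-> R}) : Prop :=
  ClaimSizes {
  density_measurable : measurable_fun setT p ;
  density_ge0 : forall x, 0 <= p x ;
  claims_independent : mutually_independent P (fun j => sigma_rv (xi j)) ;
  claims_density : forall j (B : set R), measurable B ->
    distribution P (xi j) B = (\int[lebesgue_measure]_(x in B) (p x)%:E)%E ;
  claims_positive : forall j, {ae P, forall w, 0 < xi j w} ;
  claims_mean : forall j, ('E_P[xi j] = mu%:E)%E ;
  claims_variance : forall j, (variance P (xi j) < +oo)%E }.

Definition total_claims (N : R -> {RV P >-> nat}) (xi : nat -> {RV P >-> R})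
    (t : R) (w : T) : R :=
  \sum_(j < N t w) xi j w.

(* F is any filtration carrying the model, for instance the augmented natural
   filtration of W and of the total claims, for which W stays a Brownian
   motion. *)
Record cramer_lundberg_model (lambda mu : R) (p : R -> R)
    (F : R -> set (set T)) (W : R -> {RV P >-> R}) (N : R -> {RV P >-> nat})
    (xi : nat -> {RV P >-> R}) : Prop := CramerLundbergModel {
  model_brownian : brownian_motion W ;
  model_poisson : poisson_process lambda N ;
  model_claims : claim_sizes p mu xi ;
  model_independent : mutually_independent P
    (tnth [tuple sigma_family [set t : R | 0 <= t] (fun t => W t : T -> R) ;
                 sigma_family [set t : R | 0 <= t] (fun t => N t : T -> nat) ;
                 sigma_family [set: nat] (fun j => xi j : T -> R)]) ;
  model_filtration : filtration F ;
  model_brownian_adapted : adapted F (fun t => W t : T -> R) ;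
  model_claims_adapted : adapted F (total_claims N xi) ;
  model_brownian_increments : forall s t, 0 <= s -> s <= t ->
    independent P (sigma_rv (fun w => W t w - W s w)) (F s) }.

End driving_processes.

Section ito_integral.
Context d (T : measurableType d) (R : realType) (P : probability T R).
Variables (F : R -> set (set T)) (W : R -> {RV P >-> R}).

(* The process \sum_(i < n) h_i 1_{]t_i, t_i.+1]}. *)
Record simple_process := SimpleProcess {
  sp_size : nat ;
  sp_time : nat -> R ;
  sp_coef : nat -> T -> R ;
  sp_time0 : 0 <= sp_time 0%N ;
  sp_time_le : forall i, sp_time i <= sp_time i.+1 ;
  sp_coef_measurable : forall i, sigma_rv (sp_coef i) `<=` F (sp_time i) ;
  sp_coef_bounded : forall i, exists C, forall w, `|sp_coef i w| <= C }.

Definition sp_eval (H : simple_process) (s : R) (w : T) : R :=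
  \sum_(i < sp_size H)
    sp_coef H i w * \1_(`]sp_time H i, sp_time H i.+1]) s.

Definition sp_integral (H : simple_process) (t : R) (w : T) : R :=
  \sum_(i < sp_size H) sp_coef H i w *
    (W (Num.min (sp_time H i.+1) t) w - W (Num.min (sp_time H i) t) w).

Definition ito_integrable (H : R -> T -> R) (t : R) : Prop :=
  [/\ measurable_fun [set z : R * T | 0 <= z.1] (fun z => H z.1 z.2),
      adapted F H &
      {ae P, forall w,
        (\int[lebesgue_measure]_(s in `[0%R, t]) ((H s w) ^+ 2)%:E < +oo)%E}].

(* Y is (a version of) the integral of H dW over [0, t]: the limit in
   probability of the integrals of simple processes S n such that the integral
   of (S n - H)^2 over [0, t] tends to 0 in probability. *)
Definition is_ito_integral (H : R -> T -> R) (t : R) (Y : {RV P >-> R}) : Prop :=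
  ito_integrable H t /\
  exists S : nat -> simple_process,
    (forall e : R, 0 < e ->
       P [set w | (e%:E < \int[lebesgue_measure]_(s in `[0%R, t])
                            ((sp_eval (S n) s w - H s w) ^+ 2)%:E)%E]
         @[n --> \oo] --> 0%E) /\
    (forall e : R, 0 < e ->
       P [set w | e < `|sp_integral (S n) t w - Y w|] @[n --> \oo] --> 0%E).

End ito_integral.

Section risk_process.
Context d (T : measurableType d) (R : realType) (P : probability T R).

Record risk_process (a sigma c : R) (F : R -> set (set T))
    (W : R -> {RV P >-> R}) (N : R -> {RV P >-> nat})
    (xi : nat -> {RV P >-> R}) (u : R) (X : R -> T -> R) : Prop :=
  RiskProcess {
  risk_initial : forall w, X 0 w = u ;
  risk_cadlag : forall w, cadlag (fun t => X t w) ;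
  risk_adapted : adapted F X ;
  risk_equation : exists I : R -> {RV P >-> R},
    (forall t, 0 <= t ->
       is_ito_integral F W (fun s w => sigma * X s w) t (I t)) /\
    (forall t, 0 <= t -> {ae P, forall w,
       X t w = X 0 w + \int[lebesgue_measure]_(s in `[0, t]) (a * X s w)
               + I t w + c * t - total_claims N xi t w}) }.

Definition ruin_time (X : R -> T -> R) (ustar : R) (w : T) : \bar R :=
  ereal_inf [set t%:E | t in [set t | 0 < t /\ X t w < ustar]].

(* psi_{ustar}(u), when X is the risk process started at u *)
Definition ruin_probability (X : R -> T -> R) (ustar : R) : \bar R :=
  P [set w | (ruin_time X ustar w < +oo)%E].

End risk_process.

(* Main.v *)
Require Import Defs.
From mathcomp Require Import all_boot all_order all_algebra.
From mathcomp Require Import all_classical all_reals all_analysis.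
From mathcomp Require Import measurable_realfun ring lra.
Set Implicit Arguments.
Unset Strict Implicit.
Unset Printing Implicit Defensive.
Import Order.TTheory GRing.Theory Num.Theory.
Import numFieldNormedType.Exports.
Local Open Scope classical_set_scope.
Local Open Scope ring_scope.

(* For any ustar > 0 survival above ustar forces
   ln X_t <= ln u + (a + c/ustar - sigma^2/2) t + sigma W_t, since on survival
   the premium is at most (c/ustar) X and claims only decrease X. For ustar
   large the drift is negative (this is rho < 1) and W_t = O(sqrt t) in
   probability, so survival up to t has probability tending to 0.

   The logarithmic bound is obtained without Itô's formula. On a grid of mesh h
   one has X_{i+1} <= X_i (1 + a' h + sigma dW_i + eps_i), one takes logarithms,
   expands to third order and uses the quadratic variation of W. The error eps
   comes from replacing X by its values on the grid; it is controlled because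
   the squared L^2(0,t)-distance of a càdlàg path to its grid values tends to 0
   and because a stochastic integral is small in probability when the integral
   of the squared integrand is. The same estimate, applied to a simple process
   minus the values of X on a grid, first shows that the Itô integral is a limit
   in probability of Riemann sums. *)

(** * Moments of the normal distribution *)

(** The obstacle is that [X] has no known moments: the integrand is square integrable only path by
    path, and its Itô integral is only a limit in probability. Every estimate is therefore a
    [holds_but] statement whose failure probabilities are added up, and the L^2 isometry is applied
    only to a transform cut off when its own running energy becomes too large. A second obstacle is
    the number of errors. Each increment of the Itô integral differs from its frozen value by an
    error that is small only in probability, and a union bound over the cells would compete with the
    mesh. The errors are treated together, as one martingale transform along a much finer grid, with
    energy controlled by the two grid energies; the isometry then bounds their sum and their sum of
    squares. Riemann sums need to be close to the Itô integral only at the finitely many coarse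
    times, and the fine grid is chosen after the coarse one. *)

Section normal_moments.
Context (R : realType).
Local Notation mu := lebesgue_measure.

Lemma ge0_integral_normal_prob (m s : R) (f : measurableTypeR R -> \bar R) :
  measurable_fun setT f -> (forall x, 0 <= f x)%E ->
  (\int[normal_prob m s]_x f x = \int[mu]_x (f x * (normal_pdf m s x)%:E))%E.
Proof.
move=> mf f0.
have dom : normal_prob m s `<< mu by exact: normal_prob_dominates.
rewrite -(Radon_Nikodym_SigmaFinite.change_of_variables dom)//.
have mpdf : measurable_fun setT (fun x : measurableTypeR R => (normal_pdf m s x)%:E).
  by apply/measurable_EFinP; exact: measurable_normal_pdf.
have irn := Radon_Nikodym_SigmaFinite.f_integrable dom.
apply: ae_eq_integral => //.
- by apply: emeasurable_funM => //; exact: measurable_int irn.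
- by apply: emeasurable_funM.
- apply: ae_eqe_mul2l; apply: integral_ae_eq => //.
  move=> A _ mA.
  by rewrite -Radon_Nikodym_SigmaFinite.f_integral.
Qed.

Lemma ge0_integralN (f : measurableTypeR R -> \bar R) :
  measurable_fun setT f -> (forall x, 0 <= f x)%E ->
  (\int[mu]_x f (- x)%R = \int[mu]_x f x)%E.
Proof.
move=> mf f0.
have mN : measurable_fun setT (-%R : measurableTypeR R -> measurableTypeR R).
  exact: oppr_measurable.
transitivity (\int[pushforward mu (-%R : _ -> measurableTypeR R)]_x f x)%E.
  by rewrite ge0_integral_pushforward.
by apply: eq_measure_integral => A mA _; exact: lebesgue_measureN.
Qed.

Lemma ge0_integral_normal_law d (T : measurableType d) (P : probability T R)
    (Z : T -> R) (m s : R) (f : R -> \bar R) :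
  measurable_fun setT Z ->
  (forall B, measurable B -> P [set w | B (Z w)] = normal_prob m s B) ->
  measurable_fun setT f -> (forall x, 0 <= f x)%E ->
  (\int[P]_w f (Z w) = \int[mu]_x (f x * (normal_pdf m s x)%:E))%E.
Proof.
move=> mZ lawZ mf f0; rewrite -ge0_integral_normal_prob//.
pose Z' : T -> measurableTypeR R := Z.
have mZ' : measurable_fun setT Z' by exact: mZ.
have := @ge0_integral_pushforward _ _ T (measurableTypeR R) R Z' mZ' P setT f measurableT mf (fun y _ => f0 y).
rewrite preimage_setT => <-.
by apply: eq_measure_integral => A mA _; exact: lawZ.
Qed.

(* With 1 + x <= exp x, comparing the densities of two centered normal laws
   bounds the second moment from both sides; the bounds meet as r tends to 1. *)
Lemma normal_pdf_scale (s r x : R) : 0 < s -> 0 < r ->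
  normal_pdf 0 (s / r) x =
  r * normal_pdf 0 s x * expR (- ((r ^+ 2 - 1) / (2 * s ^+ 2)) * x ^+ 2).
Proof.
move=> s0 r0.
have sr0 : s / r != 0 by rewrite gt_eqF// divr_gt0.
rewrite !normal_pdfE// ?gt_eqF// /normal_fun !subr0.
have -> : normal_peak (s / r) = r * normal_peak s.
  rewrite /normal_peak.
  have -> : (s / r) ^+ 2 * pi *+ 2 = r^-1 ^+ 2 * (s ^+ 2 * pi *+ 2).
    by rewrite exprMn; ring.
  rewrite sqrtrM ?sqr_ge0// sqrtr_sqr ger0_norm ?invr_ge0 ?ltW//.
  by rewrite invfM invrK.
rewrite -!mulrA; congr (_ * (_ * _)); rewrite -expRD; congr expR.
by field; rewrite (gt_eqF r0) (gt_eqF s0).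
Qed.

Local Notation nm s f := (\int[mu]_x ((f x)%:E * (normal_pdf 0 s x)%:E))%E.

Lemma measurable_EFin_normal_pdf (s : R) :
  measurable_fun setT (fun x : measurableTypeR R => (normal_pdf 0 s x)%:E).
Proof. by apply/measurable_EFinP; exact: measurable_normal_pdf. Qed.

Lemma measurable_EFin_exp (n : nat) :
  measurable_fun setT (fun x : measurableTypeR R => (x ^+ n)%:E).
Proof. by apply/measurable_EFinP; exact: measurable_funX. Qed.

Lemma normal_mom2_le (s r : R) : 0 < s -> 0 < r -> r < 1 ->
  (nm s (fun x => x ^+ 2)%R <= (2 * s ^+ 2 / (r * (r + 1)))%:E)%E.
Proof.
move=> s0 r0 r1.
have k0 : 0 < r * (1 - r ^+ 2) / (2 * s ^+ 2).
  rewrite divr_gt0 ?mulr_gt0 ?exprn_gt0// subr_gt0.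
  by rewrite expr_lt1 ?ltW.
(* [k] is [r] times the coefficient of x^2 in the exponent of [normal_pdf_scale]. Integrating 1 + y
   <= exp y gives r + k m <= 1, with m the second moment. *)
set k := r * (1 - r ^+ 2) / (2 * s ^+ 2) in k0.
have H : (r%:E + k%:E * nm s (fun x => x ^+ 2)%R <= 1)%E.
  rewrite -[leRHS](integral_normal_pdf 0 (s / r)).
  rewrite -[X in (X + _ <= _)%E]mule1 -(integral_normal_pdf 0 s).
  rewrite -ge0_integralZl//=; last 3 first.
  - exact: measurable_EFin_normal_pdf.
  - by move=> x _; rewrite lee_fin normal_pdf_ge0.
  - by rewrite lee_fin ltW.
  rewrite -ge0_integralZl//=; last 3 first.
  - by apply: emeasurable_funM; [exact: measurable_EFin_exp|exact: measurable_EFin_normal_pdf].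
  - by move=> x _; rewrite mule_ge0// lee_fin ?sqr_ge0 ?normal_pdf_ge0.
  - by rewrite lee_fin ltW.
  rewrite -ge0_integralD//; last 4 first.
  - by move=> x _; rewrite mule_ge0// lee_fin ?normal_pdf_ge0// ltW.
  - by apply: measurable_funeM; exact: measurable_EFin_normal_pdf.
  - move=> x _; rewrite !mule_ge0// lee_fin ?sqr_ge0 ?normal_pdf_ge0//.
    exact: ltW.
  - apply: measurable_funeM; apply: emeasurable_funM.
      exact: measurable_EFin_exp.
    exact: measurable_EFin_normal_pdf.
  apply: ge0_le_integral => //.
  - move=> x _; rewrite adde_ge0// !mule_ge0// ?lee_fin ?sqr_ge0 ?normal_pdf_ge0//.
    exact: ltW.
    exact: ltW.
  - apply: emeasurable_funD; first by apply: measurable_funeM; exact: measurable_EFin_normal_pdf.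
    apply: measurable_funeM; apply: emeasurable_funM.
      exact: measurable_EFin_exp.
    exact: measurable_EFin_normal_pdf.
  - exact: measurable_EFin_normal_pdf.
  - move=> x _; rewrite -!EFinM -EFinD lee_fin normal_pdf_scale//.
    have -> : r * normal_pdf 0 s x + k * (x ^+ 2 * normal_pdf 0 s x) =
      r * normal_pdf 0 s x * (1 + - ((r ^+ 2 - 1) / (2 * s ^+ 2)) * x ^+ 2).
      by rewrite /k; field; rewrite gt_eqF.
    by rewrite ler_wpM2l ?expR_ge1Dx// mulr_ge0 ?normal_pdf_ge0// ltW.
have := H; rewrite addeC -leeBrDr// -EFinB => {}H.
rewrite -(@lee_pmul2l _ k%:E)// (le_trans H)// -EFinM lee_fin.
rewrite /k le_eqVlt; apply/orP; left; apply/eqP.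
by field; rewrite !gt_eqF// addr_gt0.
Qed.

(** For r > 1 the exponent in [normal_pdf_scale] is negative. The integrated inequality is written r
    <= 1 + k m, so that only nonnegative functions are integrated. *)
Lemma normal_mom2_ge (s r : R) : 0 < s -> 1 < r ->
  ((2 * s ^+ 2 / (r * (r + 1)))%:E <= nm s (fun x => x ^+ 2)%R)%E.
Proof.
move=> s0 r1.
have r0 : 0 < r by rewrite (lt_trans _ r1).
have k0 : 0 < r * (r ^+ 2 - 1) / (2 * s ^+ 2).
  rewrite divr_gt0 ?mulr_gt0 ?exprn_gt0// subr_gt0.
  by rewrite expr_gt1 ?ltW.
set k := r * (r ^+ 2 - 1) / (2 * s ^+ 2) in k0.
have H : (r%:E <= 1 + k%:E * nm s (fun x => x ^+ 2)%R)%E.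
  rewrite -[X in (_ <= X + _)%E](integral_normal_pdf 0 (s / r)).
  rewrite -[X in (X <= _)%E]mule1 -(integral_normal_pdf 0 s).
  rewrite -ge0_integralZl//=; last 3 first.
  - exact: measurable_EFin_normal_pdf.
  - by move=> x _; rewrite lee_fin normal_pdf_ge0.
  - by rewrite lee_fin ltW.
  rewrite -ge0_integralZl//=; last 3 first.
  - by apply: emeasurable_funM; [exact: measurable_EFin_exp|exact: measurable_EFin_normal_pdf].
  - by move=> x _; rewrite mule_ge0// lee_fin ?sqr_ge0 ?normal_pdf_ge0.
  - by rewrite lee_fin ltW.
  rewrite -ge0_integralD//; last 4 first.
  - by move=> x _; rewrite lee_fin ?normal_pdf_ge0// ltW.
  - exact: measurable_EFin_normal_pdf.
  - move=> x _; rewrite !mule_ge0// lee_fin ?sqr_ge0 ?normal_pdf_ge0//.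
    exact: ltW.
  - apply: measurable_funeM; apply: emeasurable_funM.
      exact: measurable_EFin_exp.
    exact: measurable_EFin_normal_pdf.
  apply: ge0_le_integral => //.
  - move=> x _; rewrite mule_ge0// ?lee_fin ?normal_pdf_ge0//.
    exact: ltW.
  - by apply: measurable_funeM; exact: measurable_EFin_normal_pdf.
  - apply: emeasurable_funD; first exact: measurable_EFin_normal_pdf.
    apply: measurable_funeM; apply: emeasurable_funM.
      exact: measurable_EFin_exp.
    exact: measurable_EFin_normal_pdf.
  - move=> x _; rewrite -!EFinM -EFinD lee_fin normal_pdf_scale//.
    rewrite -lerBlDr.
    have -> : r * normal_pdf 0 s x - k * (x ^+ 2 * normal_pdf 0 s x) =
      r * normal_pdf 0 s x * (1 + - ((r ^+ 2 - 1) / (2 * s ^+ 2)) * x ^+ 2).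
      by rewrite /k; field; rewrite gt_eqF.
    by rewrite ler_wpM2l ?expR_ge1Dx// mulr_ge0 ?normal_pdf_ge0// ltW.
have := H; rewrite addeC -leeBlDr// -EFinB => {}H.
rewrite -(@lee_pmul2l _ k%:E)// (le_trans _ H)// -EFinM lee_fin.
rewrite /k le_eqVlt; apply/orP; left; apply/eqP.
by field; rewrite !gt_eqF// addr_gt0.
Qed.

Lemma normal_mom2 (s : R) : 0 < s ->
  nm s (fun x => x ^+ 2)%R = (s ^+ 2)%:E.
Proof.
move=> s0.
have fin : nm s (fun x => x ^+ 2)%R \is a fin_num.
  rewrite ge0_fin_numE; last first.
    apply: integral_ge0 => x _.
    by rewrite mule_ge0// lee_fin ?sqr_ge0 ?normal_pdf_ge0.
  have h2 : 0 < 2^-1 :> R by rewrite invr_gt0.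
  apply: le_lt_trans (@normal_mom2_le s 2^-1 s0 h2 _) _; last exact: ltry.
  by rewrite invf_lt1// ltr1n.
rewrite -(fineK fin); congr EFin.
have m0 : 0 <= fine (nm s (fun x => x ^+ 2)%R).
  apply: fine_ge0; apply: integral_ge0 => x _.
  by rewrite mule_ge0// lee_fin ?sqr_ge0 ?normal_pdf_ge0.
set m := fine _ in m0 *.
have mE : nm s (fun x => x ^+ 2)%R = m%:E by rewrite fineK.
apply/eqP; rewrite eq_le; apply/andP; split.
- apply/ler_addgt0Pr => e e0.
  (* With r = 1 - t the bound reads m (1 - t) (2 - t) <= 2 s^2, hence 2 m <= 2 s^2 + 3 t m. *)
  have [t [t0 t1 te]] : exists t, [/\ 0 < t, t < 1 & 3 * t * m <= 2 * e].
    exists (Num.min 2^-1 (e / (3 * (m + 1)))); split.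
    + by rewrite lt_min invr_gt0// ltr0n divr_gt0// mulr_gt0// ltr_wpDl.
    + by rewrite gt_min invf_lt1 ?ltr1n.
    + have : Num.min 2^-1 (e / (3 * (m + 1))) <= e / (3 * (m + 1)).
        by rewrite ge_min lexx orbT.
      rewrite ler_pdivlMr ?mulr_gt0 ?ltr_wpDl//.
      by set u := Num.min _ _; nra.
  have r0 : 0 < 1 - t by lra.
  have r1 : 1 - t < 1 by lra.
  have := normal_mom2_le s0 r0 r1; rewrite mE lee_fin.
  rewrite ler_pdivlMr ?mulr_gt0//; last lra.
  by nra.
- apply/ler_addgt0Pr => e e0.
  have [t [t0 t1 te]] : exists t, [/\ 0 < t, t < 1 & 4 * t * m <= 2 * e].
    exists (Num.min 2^-1 (e / (3 * (m + 1)))); split.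
    + by rewrite lt_min invr_gt0// ltr0n divr_gt0// mulr_gt0// ltr_wpDl.
    + by rewrite gt_min invf_lt1 ?ltr1n.
    + have : Num.min 2^-1 (e / (3 * (m + 1))) <= e / (3 * (m + 1)).
        by rewrite ge_min lexx orbT.
      rewrite ler_pdivlMr ?mulr_gt0 ?ltr_wpDl//.
      by set u := Num.min _ _; nra.
  have r1 : 1 < 1 + t by lra.
  have := normal_mom2_ge s0 r1; rewrite mE lee_fin.
  rewrite ler_pdivrMr ?mulr_gt0//; [|lra|lra].
  by nra.
Qed.

(** Comparison with the law of deviation 2 s: for y = 3 x^2 / (8 s^2), the inequality (1 + y/2)^2 <=
    exp y gives x^4 <= 32 s^4 exp y, and the density ratio contributes a factor 2. The constant is
    far from the optimal 3, but only its finiteness matters. *)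
Lemma normal_mom4 (s : R) : 0 < s ->
  (nm s (fun x => x ^+ 4)%R <= (64 * s ^+ 4)%:E)%E.
Proof.
move=> s0.
have h0 : 0 < 2^-1 :> R by rewrite invr_gt0.
rewrite -[leRHS]mule1 -(integral_normal_pdf 0 (s / 2^-1)).
rewrite -ge0_integralZl//=; last 3 first.
- exact: measurable_EFin_normal_pdf.
- by move=> x _; rewrite lee_fin normal_pdf_ge0.
- by rewrite lee_fin mulr_ge0// exprn_ge0// ltW.
apply: ge0_le_integral => //.
- by move=> x _; rewrite mule_ge0// lee_fin ?normal_pdf_ge0// (exprM _ 2 2) sqr_ge0.
- by apply: emeasurable_funM; [exact: measurable_EFin_exp|exact: measurable_EFin_normal_pdf].
- by apply: measurable_funeM; exact: measurable_EFin_normal_pdf.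
move=> x _; rewrite -!EFinM lee_fin normal_pdf_scale//.
set k := - _.
have kE : k = 3 / 8 / s ^+ 2 by rewrite /k; field; rewrite gt_eqF.
have y0 : 0 <= k * x ^+ 2 / 2.
  have k0 : 0 <= k by rewrite kE !divr_ge0 ?sqr_ge0.
  by rewrite divr_ge0// mulr_ge0 ?sqr_ge0.
have H : (1 + k * x ^+ 2 / 2) ^+ 2 <= expR (k * x ^+ 2).
  rewrite [leRHS](_ : _ = expR (k * x ^+ 2 / 2) ^+ 2); last first.
    by rewrite -expRM_natl; congr expR; field.
  by rewrite lerXn2r ?nnegrE ?expR_ge0 ?expR_ge1Dx// addr_ge0.
have H2 : x ^+ 4 <= 32 * s ^+ 4 * expR (k * x ^+ 2).
  have : (k * x ^+ 2 / 2) ^+ 2 <= expR (k * x ^+ 2) by apply: le_trans H; nra.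
  have -> : (k * x ^+ 2 / 2) ^+ 2 = 9 / 256 * (x ^+ 4 / s ^+ 4).
    by rewrite kE; field; rewrite gt_eqF.
  have s4 : 0 < s ^+ 4 by rewrite exprn_gt0.
  have -> : 32 * s ^+ 4 * expR (k * x ^+ 2) = 32 * expR (k * x ^+ 2) * s ^+ 4.
    by ring.
  rewrite -ler_pdivrMr//; set q := x ^+ 4 / s ^+ 4.
  by have := expR_ge0 (k * x ^+ 2); lra.
have -> : 64 * s ^+ 4 * (2^-1 * normal_pdf 0 s x * expR (k * x ^+ 2)) =
  32 * s ^+ 4 * expR (k * x ^+ 2) * normal_pdf 0 s x by field.
by rewrite ler_wpM2r ?normal_pdf_ge0.
Qed.

(** Symmetry of the density, stated for positive and negative parts so that it concerns nonnegative
    integrands only; the mean is then their difference. *)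
Lemma normal_mom1 (s : R) : 0 < s ->
  (nm s (fun x => Num.max x 0%R) = nm s (fun x => Num.max (- x) 0%R))%R.
Proof.
move=> s0; rewrite -ge0_integralN; last 2 first.
- apply: emeasurable_funM; last exact: measurable_EFin_normal_pdf.
  by apply/measurable_EFinP; exact: measurable_maxr.
- by move=> x; rewrite mule_ge0// lee_fin ?normal_pdf_ge0// le_max lexx orbT.
apply: eq_integral => x _.
have s1 : s != 0 by rewrite gt_eqF.
by rewrite !normal_pdfE// /normal_fun !subr0 sqrrN.
Qed.
End normal_moments.

(** * Independence *)

Section centered_normal.
Context d (T : measurableType d) (R : realType) (P : probability T R).
Variables (Z : T -> R) (h : R).
Hypotheses (mZ : measurable_fun setT Z) (h0 : 0 < h)
  (lawZ : forall B, measurable B ->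
    P [set w | B (Z w)] = normal_prob 0 (Num.sqrt h) B).

Lemma centered_normal_mom2 : (\int[P]_w (Z w ^+ 2)%:E = h%:E)%E.
Proof.
rewrite (ge0_integral_normal_law (f := fun x => (x ^+ 2)%:E) mZ lawZ).
- by rewrite normal_mom2 ?sqrtr_gt0// sqr_sqrtr// ltW.
- exact: measurable_EFin_exp.
- by move=> x; rewrite lee_fin sqr_ge0.
Qed.

Lemma centered_normal_mom4 :
  (\int[P]_w (Z w ^+ 4)%:E <= (64 * h ^+ 2)%:E)%E.
Proof.
rewrite (ge0_integral_normal_law (f := fun x => (x ^+ 4)%:E) mZ lawZ).
- apply: le_trans (normal_mom4 _) _; first by rewrite sqrtr_gt0.
  by rewrite (exprM _ 2 2) sqr_sqrtr// ltW.
- exact: measurable_EFin_exp.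
- by move=> x; rewrite lee_fin (exprM _ 2 2) sqr_ge0.
Qed.

Lemma integrable_sqr_integrable (f : T -> R) : measurable_fun setT f ->
  (\int[P]_w (f w ^+ 2)%:E < +oo)%E -> P.-integrable setT (EFin \o f).
Proof.
move=> mf f2.
have i2 : P.-integrable setT (fun w => (1 + f w ^+ 2)%:E).
  apply: (eq_integrable _ (fun w => 1%:E + (f w ^+ 2)%:E)%E) => //.
  apply: integrableD => //; first exact: finite_measure_integrable_cst.
  apply/integrableP; split.
    by apply/measurable_EFinP; exact: measurable_funX.
  by under eq_integral do rewrite gee0_abs ?lee_fin ?sqr_ge0//.
apply: le_integrable i2 => //; first exact/measurable_EFinP.
move=> w _ /=; rewrite lee_fin ler_norml ger0_norm ?addr_ge0 ?sqr_ge0//.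
by apply/andP; split; nra.
Qed.

Lemma centered_normal_integrable : P.-integrable setT (EFin \o Z).
Proof.
by apply: integrable_sqr_integrable => //; rewrite centered_normal_mom2 ltry.
Qed.

Lemma centered_normal_mom1 : (\int[P]_w (Z w)%:E = 0)%E.
Proof.
rewrite integralE.
have -> : (\int[P]_w (fun w => (Z w)%:E)^\+ w =
           \int[P]_w (fun w => (Z w)%:E)^\- w)%E.
  rewrite (eq_integral (fun w => (fun x => (Num.max x 0)%:E) (Z w))); last first.
    by move=> w _; rewrite funeposE EFin_max.
  rewrite (ge0_integral_normal_law (f := fun x => (Num.max x 0)%:E) mZ lawZ); last 2 first.
  - by apply/measurable_EFinP; exact: measurable_maxr.
  - by move=> x; rewrite lee_fin le_max lexx orbT.
  rewrite normal_mom1 ?sqrtr_gt0//.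
  rewrite -(ge0_integral_normal_law (f := fun x => (Num.max (-x) 0)%:E) mZ lawZ); last 2 first.
  - by apply/measurable_EFinP; exact: measurable_maxr.
  - by move=> x; rewrite lee_fin le_max lexx orbT.
  by apply: eq_integral => w _; rewrite funenegE EFin_max.
rewrite subee//.
have /integrable_funeneg := centered_normal_integrable => /(_ measurableT) H.
exact: integrable_fin_num.
Qed.
End centered_normal.

(** * Expectations of products of independent variables *)

Section independence_expectation.
Context d (T : measurableType d) (R : realType) (P : probability T R).
Variables (X Y : T -> R).
Hypotheses (mX : measurable_fun setT X) (mY : measurable_fun setT Y).
Hypothesis indXY : forall A B, measurable A -> measurable B ->
  P (Y @^-1` A `&` X @^-1` B) = (P (Y @^-1` A) * P (X @^-1` B))%E.

Let X' : {RV P >-> R} := mfun_Sub (mem_set mX).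
Let Y' : {RV P >-> R} := mfun_Sub (mem_set mY).
Let mZ : measurable_fun setT (fun w => (Y w, X w)).
Proof. exact: measurable_fun_pair. Qed.
Let Z' : {RV P >-> (R * R)%type} := mfun_Sub (mem_set mZ).

(** Independence is the product formula on rectangles, and these determine the product measure. In
    the applications [Y] is a noise variable and [X] a coefficient depending on the past. *)
Let joint_law (A : set (R * R)) : measurable A ->
  (distribution P Y' \x distribution P X')%E A = distribution P Z' A.
Proof.
by move=> mA; exact: product_measure_unique.
Qed.

Lemma independent_ge0_integralM (g h : R -> R) :
  measurable_fun setT g -> measurable_fun setT h ->
  (forall x, 0 <= g x) -> (forall x, 0 <= h x) ->
  (\int[P]_w (g (Y w) * h (X w))%:E =
    (\int[P]_w (g (Y w))%:E) * (\int[P]_w (h (X w))%:E))%E.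
Proof.
move=> mg mh g0 h0.
pose f (z : R * R) := (g z.1 * h z.2)%:E.
have mf : measurable_fun setT f.
  by apply/measurable_EFinP; apply: measurable_funM; exact: measurableT_comp.
have f0 z : (0 <= f z)%E by rewrite lee_fin mulr_ge0.
transitivity (\int[distribution P Z']_z f z)%E.
  by rewrite ge0_integral_distribution.
transitivity (\int[distribution P Y' \x distribution P X']_z f z)%E.
  by apply: eq_measure_integral => A mA _; exact/esym/joint_law.
rewrite fubini_tonelli1//.
have mg' : measurable_fun setT (EFin \o g) by exact/measurable_EFinP.
have mh' : measurable_fun setT (EFin \o h) by exact/measurable_EFinP.
have Eh : (\int[distribution P X']_x (h x)%:E = \int[P]_w (h (X w))%:E)%E.
  by rewrite ge0_integral_distribution// => y; rewrite lee_fin.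
have Eg : (\int[distribution P Y']_x (g x)%:E = \int[P]_w (g (Y w))%:E)%E.
  by rewrite ge0_integral_distribution// => y; rewrite lee_fin.
rewrite -Eh -Eg -ge0_integralZr//; last 2 first.
- by move=> x _; rewrite lee_fin.
- by apply: integral_ge0 => x _; rewrite lee_fin.
apply: eq_integral => y _; rewrite /fubini_F /f/=.
under eq_integral do rewrite EFinM.
by rewrite ge0_integralZl// => [x _|]; rewrite lee_fin.
Qed.

Lemma independent_integrableM :
  P.-integrable setT (EFin \o X) -> P.-integrable setT (EFin \o Y) ->
  P.-integrable setT (fun w => (X w * Y w)%:E).
Proof.
move=> /integrableP[_ iX] /integrableP[_ iY]; apply/integrableP; split.
  by apply/measurable_EFinP; exact: measurable_funM.
under eq_integral do rewrite /= normrM mulrC.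
rewrite (independent_ge0_integralM (g := Num.norm) (h := Num.norm))//.
by rewrite lte_mul_pinfty// ?ge0_fin_numE// integral_ge0.
Qed.

Lemma independent_integralM :
  P.-integrable setT (EFin \o X) -> P.-integrable setT (EFin \o Y) ->
  (\int[P]_w (X w * Y w)%:E =
    (\int[P]_w (X w)%:E) * (\int[P]_w (Y w)%:E))%E.
Proof.
move=> iX iY.
pose f (z : R * R) := (z.2 * z.1)%:E.
have mf : measurable_fun setT f.
  by apply/measurable_EFinP; apply: measurable_funM.
have iXY := independent_integrableM iX iY.
have mi : measurable_fun setT (EFin : R -> \bar R).
  by apply/measurable_EFinP.
transitivity (\int[distribution P Z']_z f z)%E.
  by rewrite integral_distribution.
transitivity (\int[distribution P Y' \x distribution P X']_z f z)%E.
  by apply: eq_measure_integral => A mA _; exact/esym/joint_law.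
have If : (distribution P Y' \x distribution P X')%E.-integrable setT f.
  apply/integrableP; split => //.
  rewrite (_ : (\int[_]_z _)%E = \int[distribution P Z']_z `|f z|)%E; last first.
    by apply: eq_measure_integral => A mA _; exact/joint_law.
  rewrite ge0_integral_distribution//; last exact: measurableT_comp.
  by have /integrableP[] := iXY.
rewrite -integral12_prod_meas1//.
have Eh : (\int[distribution P X']_x x%:E = \int[P]_w (X w)%:E)%E.
  by rewrite integral_distribution.
have Eg : (\int[distribution P Y']_x x%:E = \int[P]_w (Y w)%:E)%E.
  by rewrite integral_distribution.
have IX' : (distribution P X').-integrable setT (EFin : R -> \bar R).
  apply/integrableP; split => //; rewrite ge0_integral_distribution//.
    by have /integrableP[] := iX.
  exact: measurableT_comp.
have IY' : (distribution P Y').-integrable setT (EFin : R -> \bar R).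
  apply/integrableP; split => //; rewrite ge0_integral_distribution//.
    by have /integrableP[] := iY.
  exact: measurableT_comp.
rewrite -Eh -Eg.
rewrite -(fineK (integrable_fin_num measurableT IX')).
rewrite -integralZl//.
apply: eq_integral => y _; rewrite /fubini_F /f/=.
under eq_integral do rewrite mulrC EFinM.
by rewrite integralZl// muleC fineK// integrable_fin_num.
Qed.
End independence_expectation.

(** * Martingale transforms *)

Section sub_sigma_algebra.
Context d (T : measurableType d) (R : realType).
Variable G : set (set T).
Hypothesis sG : sigma_algebra setT G.

(** Translates adaptedness into measurability for the smaller sigma-algebra, so that closure of
    measurable functions under sums, products and compositions applies to adapted processes. *)
Lemma sigma_rvP d' (T' : measurableType d') (f : T -> T') :
  sigma_rv f `<=` G <->
  measurable_fun setT (f : g_sigma_algebraType G -> T').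
Proof.
split => [fG _ B mB|mf _ [B mB <-]].
  by rewrite /measurable/= sigma_algebra_id//; apply: fG; exists B.
have := mf measurableT B mB; rewrite /measurable/=.
by rewrite sigma_algebra_id.
Qed.

Lemma sigma_rv_measurable d' (T' : measurableType d') (f : T -> T') :
  G `<=` measurable -> sigma_rv f `<=` G -> measurable_fun setT f.
Proof.
by move=> Gm fG _ B mB; apply: Gm; apply: fG; exists B.
Qed.
End sub_sigma_algebra.


Lemma measurable_le_set d (T : measurableType d) (R : realType) (f g : T -> R) :
  measurable_fun setT f -> measurable_fun setT g ->
  measurable [set w | f w <= g w].
Proof.
move=> mf mg.
have := measurable_fun_ler mf mg => /(_ measurableT [set true]).
by rewrite setTI; apply.
Qed.

(** * Statements that hold off an event of small probability *)

Section holds_but.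
Context d (T : measurableType d) (R : realType) (P : probability T R).

(* Q has inner probability at least 1 - eta; Q need not be measurable. *)
Definition holds_but (eta : R) (Q : T -> Prop) : Prop :=
  exists B, [/\ measurable B, (P B <= eta%:E)%E & forall w, ~ B w -> Q w].

Lemma holds_but_and (eta1 eta2 : R) (Q1 Q2 : T -> Prop) :
  holds_but eta1 Q1 -> holds_but eta2 Q2 ->
  holds_but (eta1 + eta2) (fun w => Q1 w /\ Q2 w).
Proof.
move=> [B1 [mB1 B1e H1]] [B2 [mB2 B2e H2]].
exists (B1 `|` B2); split; first exact: measurableU.
  rewrite (le_trans (measureU2 _ _ _))// EFinD leeD//.
by move=> w /not_orP[b1 b2]; split; [exact: H1|exact: H2].
Qed.

Lemma holds_but_le (eta1 eta2 : R) (Q1 Q2 : T -> Prop) : eta1 <= eta2 ->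
  (forall w, Q1 w -> Q2 w) -> holds_but eta1 Q1 -> holds_but eta2 Q2.
Proof.
move=> eta12 Q12 [B [mB Be H]]; exists B; split => //.
  by rewrite (le_trans Be)// lee_fin.
by move=> w /H /Q12.
Qed.

Lemma holds_but_ae (eta : R) (Q : T -> Prop) : 0 <= eta ->
  {ae P, forall w, Q w} -> holds_but eta Q.
Proof.
move=> eta0 [B [mB B0 QB]]; exists B; split => //.
  by rewrite [leLHS]B0 lee_fin.
by move=> w Bw; apply: contrapT => nQ; apply: Bw; exact: QB.
Qed.

Lemma holds_but_all (eta : R) (n : nat) (Q : nat -> T -> Prop) :
  (forall i, (i < n)%N -> holds_but eta (Q i)) ->
  holds_but (n%:R * eta) (fun w => forall i, (i < n)%N -> Q i w).
Proof.
elim: n => [|n IH] H.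
  by exists set0; split; rewrite ?measure0 ?mul0r.
have H1 := IH (fun i ni => H i (ltnW ni)).
have H2 := H n (ltnSn n).
apply: holds_but_le (holds_but_and H1 H2).
  by rewrite -natr1 mulrDl mul1r.
move=> w [Q1 Q2] i; rewrite ltnS leq_eqVlt => /orP[/eqP->//|]; exact: Q1.
Qed.

Lemma holds_but_markov (f : T -> R) (C e : R) : measurable_fun setT f ->
  (forall w, 0 <= f w) -> 0 < e -> (\int[P]_w (f w)%:E <= C%:E)%E ->
  holds_but (C / e) (fun w => f w <= e).
Proof.
move=> mf f0 e0 fC.
exists [set w | e <= f w]; split.
- exact: measurable_le_set.
- have := @le_integral_comp_abse _ _ _ P setT measurableT (EFin \o f) e id.
  rewrite setTI => /(_ (@measurable_id _ _ _)) H.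
  rewrite EFinM lee_pdivlMr// muleC.
  apply: le_trans fC.
  rewrite (eq_integral (fun w => `|(EFin \o f) w|)%E); last first.
    by move=> w _ /=; rewrite ger0_norm.
  rewrite (_ : [set w | e <= f w] = [set x | (e%:E <= `|(EFin \o f) x|)%E]); last first.
    by apply/seteqP; split => w /=; rewrite lee_fin ger0_norm.
  apply: H => //; exact/measurable_EFinP.
- by move=> w /negP; rewrite -ltNge => /ltW.
Qed.
End holds_but.

Section martingale_transform.
Context d (T : measurableType d) (R : realType) (P : probability T R).
Variables (G : nat -> set (set T)) (zeta : nat -> T -> R) (v : nat -> R).
Hypotheses (sG : forall k, sigma_algebra setT (G k))
  (Gm : forall k, G k `<=` measurable)
  (Gmono : forall k, G k `<=` G k.+1)
  (zetaG : forall k, sigma_rv (zeta k) `<=` G k.+1)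
  (zeta_indep : forall k, independent P (sigma_rv (zeta k)) (G k))
  (zeta_mom1 : forall k, (\int[P]_w (zeta k w)%:E = 0)%E)
  (zeta_mom2 : forall k, (\int[P]_w (zeta k w ^+ 2)%:E = (v k)%:E)%E)
  (zeta_deg : forall k, v k = 0 -> forall w, zeta k w = 0).

Let v_ge0 k : 0 <= v k.
Proof.
rewrite -lee_fin -zeta_mom2; apply: integral_ge0 => w _.
by rewrite lee_fin sqr_ge0.
Qed.

Let mzeta k : measurable_fun setT (zeta k).
Proof. exact: sigma_rv_measurable (@Gm k.+1) (@zetaG k). Qed.

Let izeta k : P.-integrable setT (EFin \o zeta k).
Proof.
by apply: integrable_sqr_integrable; rewrite ?zeta_mom2 ?ltry.
Qed.

Definition transform (D : nat -> T -> R) (N : nat) (w : T) : R :=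
  \sum_(k < N) D k w * zeta k w.

Lemma transform_adapted (D : nat -> T -> R) N :
  (forall k, sigma_rv (D k) `<=` G k) -> sigma_rv (transform D N) `<=` G N.
Proof.
move=> DG; elim: N => [|N IH].
  rewrite (_ : transform D 0 = cst 0); last first.
    by apply/funext => w; rewrite /transform big_ord0.
  by apply/(sigma_rvP (sG 0)); exact: measurable_cst.
rewrite (_ : transform D N.+1 = (fun w => transform D N w + D N w * zeta N w)); last first.
  by apply/funext => w; rewrite /transform big_ord_recr.
apply/(sigma_rvP (sG N.+1)); apply: measurable_funD; last apply: measurable_funM.
- by apply/(sigma_rvP (sG N.+1)) => A /IH; exact: Gmono.
- by apply/(sigma_rvP (sG N.+1)) => A /DG; exact: Gmono.
- by apply/(sigma_rvP (sG N.+1)).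
Qed.

(** Orthogonality of the increments: the transform up to N times [D N] belongs to the past [G N],
    hence is independent of the centered [zeta N], and the cross term vanishes. Bounded coefficients
    supply the integrability. *)
Lemma transform_isometry (D : nat -> T -> R) (C : nat -> R) N :
  (forall k, sigma_rv (D k) `<=` G k) -> (forall k w, `|D k w| <= C k) ->
  (\int[P]_w (transform D N w ^+ 2)%:E =
   \int[P]_w (\sum_(k < N) D k w ^+ 2 * v k)%:E)%E.
Proof.
move=> DG DC.
have mD k : measurable_fun setT (D k) by exact: sigma_rv_measurable (@Gm k) (@DG k).
have C0 k : 0 <= C k by exact: le_trans (normr_ge0 _) (DC k point).
have msum n : measurable_fun setT (fun w => \sum_(k < n) D k w ^+ 2 * v k).
  by apply: measurable_sum => i; apply: measurable_funM => //; exact: measurable_funX.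
(* Finiteness of the second moment is carried through the induction, because the cross term at the
   next step must be integrable. *)
suff [] : (\int[P]_w (transform D N w ^+ 2)%:E =
   \int[P]_w (\sum_(k < N) D k w ^+ 2 * v k)%:E)%E /\
   (\int[P]_w (transform D N w ^+ 2)%:E < +oo)%E by [].
elim: N => [|N [IH fin]].
  split; first by apply: eq_integral => w _; rewrite /transform !big_ord0 expr0n.
  rewrite (eq_integral (cst 0%:E)).
    by rewrite integral_cst// mul0e.
  by move=> w _; rewrite /transform !big_ord0 expr0n.
have SG : sigma_rv (transform D N) `<=` G N by exact: transform_adapted.
have mS : measurable_fun setT (transform D N).
  exact: sigma_rv_measurable (@Gm N) SG.
have iS := integrable_sqr_integrable mS fin.
have iS2 : P.-integrable setT (fun w => (transform D N w ^+ 2)%:E).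
  apply/integrableP; split; first by apply/measurable_EFinP; exact: measurable_funX.
  by under eq_integral do rewrite gee0_abs ?lee_fin ?sqr_ge0//.
pose X w := transform D N w * D N w.
have XG : sigma_rv X `<=` G N.
  by apply/(sigma_rvP (sG N)); apply: measurable_funM; exact/(sigma_rvP (sG N)).
have mX := sigma_rv_measurable (@Gm N) XG.
have iX : P.-integrable setT (EFin \o X).
  apply: (@le_integrable _ _ _ _ _ measurableT _ (fun w => (C N)%:E * (transform D N w)%:E)%E).
  - exact/measurable_EFinP.
  - move=> w _ /=; rewrite lee_fin /X !normrM mulrC ler_wpM2r//.
    by rewrite (le_trans (DC N w))// ler_norm.
  - exact: integrableZl.
have ind A B : measurable A -> measurable B ->
  P (zeta N @^-1` A `&` X @^-1` B) = (P (zeta N @^-1` A) * P (X @^-1` B))%E.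
  move=> mA mB; apply: zeta_indep; first by exists A => //; rewrite setTI.
  by apply: XG; exists B => //; rewrite setTI.
have indD A B : measurable A -> measurable B ->
  P (zeta N @^-1` A `&` D N @^-1` B) = (P (zeta N @^-1` A) * P (D N @^-1` B))%E.
  move=> mA mB; apply: zeta_indep; first by exists A => //; rewrite setTI.
  by apply: (@DG N); exists B => //; rewrite setTI.
have iXz := independent_integrableM mX (@mzeta N) ind iX (@izeta N).
have eXz : (\int[P]_w (X w * zeta N w)%:E = 0)%E.
  by rewrite (independent_integralM mX (@mzeta N) ind iX (@izeta N)) zeta_mom1 mule0.
have eD2 : (\int[P]_w (D N w ^+ 2 * zeta N w ^+ 2)%:E =
            \int[P]_w (D N w ^+ 2 * v N)%:E)%E.
  under eq_integral do rewrite mulrC.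
  rewrite (independent_ge0_integralM (mD N) (@mzeta N) indD (g := fun x => x ^+ 2) (h := fun x => x ^+ 2)); last 4 first.
  - exact: measurable_funX.
  - exact: measurable_funX.
  - by move=> x; rewrite sqr_ge0.
  - by move=> x; rewrite sqr_ge0.
  rewrite zeta_mom2 -ge0_integralZl//; last 3 first.
  - by apply/measurable_EFinP; exact: measurable_funX.
  - by move=> w _; rewrite lee_fin sqr_ge0.
  - by rewrite lee_fin.
  by apply: eq_integral => w _; rewrite -EFinM mulrC.
have mD2z : measurable_fun setT (fun w => D N w ^+ 2 * zeta N w ^+ 2).
  by apply: measurable_funM; exact: measurable_funX.
have finD2 : (\int[P]_w (D N w ^+ 2 * zeta N w ^+ 2)%:E < +oo)%E.
  rewrite eD2; apply: (@le_lt_trans _ _ (\int[P]_w (C N ^+ 2 * v N)%:E)%E).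
    apply: ge0_le_integral => //.
    - by move=> w _; rewrite lee_fin mulr_ge0 ?sqr_ge0.
    - by apply/measurable_EFinP; apply: measurable_funM => //; exact: measurable_funX.
    - move=> w _; rewrite lee_fin ler_wpM2r// -(real_normK (num_real (D N w))).
      by rewrite lerXn2r ?nnegrE.
  by rewrite integral_cst//= probability_setT mule1 ltry.
have iD2 : P.-integrable setT (fun w => (D N w ^+ 2 * zeta N w ^+ 2)%:E).
  apply/integrableP; split; first exact/measurable_EFinP.
  rewrite (eq_integral (fun w => (D N w ^+ 2 * zeta N w ^+ 2)%:E))//.
  by move=> w _; rewrite gee0_abs// lee_fin mulr_ge0 ?sqr_ge0.
have E : (\int[P]_w (transform D N.+1 w ^+ 2)%:E =
   \int[P]_w (\sum_(k < N.+1) D k w ^+ 2 * v k)%:E)%E.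
  rewrite (eq_integral (fun w => ((transform D N w ^+ 2)%:E +
      (2%:E * (X w * zeta N w)%:E + (D N w ^+ 2 * zeta N w ^+ 2)%:E)))%E); last first.
    move=> w _; rewrite -EFinM -!EFinD /transform big_ord_recr/= -/(transform D N w).
    by congr EFin; rewrite /X; ring.
  rewrite integralD//; last first.
    by apply: integrableD => //; exact: integrableZl.
  rewrite integralD//; last exact: integrableZl.
  rewrite integralZl// eXz mule0 add0e IH eD2 -ge0_integralD//; last 4 first.
  - by move=> w _; rewrite lee_fin sumr_ge0// => i _; rewrite mulr_ge0 ?sqr_ge0.
  - by apply/measurable_EFinP.
  - by move=> w _; rewrite lee_fin mulr_ge0 ?sqr_ge0.
  - by apply/measurable_EFinP; apply: measurable_funM => //; exact: measurable_funX.
  by apply: eq_integral => w _; rewrite big_ord_recr.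
split => //; rewrite E.
apply: (@le_lt_trans _ _ (\int[P]_w (\sum_(k < N.+1) C k ^+ 2 * v k)%:E)%E).
  apply: ge0_le_integral => //.
  - by move=> w _; rewrite lee_fin sumr_ge0// => i _; rewrite mulr_ge0 ?sqr_ge0.
  - by apply/measurable_EFinP.
  - move=> w _; rewrite lee_fin ler_sum// => i _.
    rewrite ler_wpM2r// -(real_normK (num_real (D i w))).
    by rewrite lerXn2r ?nnegrE.
by rewrite integral_cst//= probability_setT mule1 ltry.
Qed.


(* D' vanishes as soon as the running energy of D exceeds delta. *)
Lemma transform_truncation (D : nat -> T -> R) N (delta : R) : 0 < delta ->
  (forall k, sigma_rv (D k) `<=` G k) ->
  exists (D' : nat -> T -> R) (C : nat -> R), [/\ forall k, sigma_rv (D' k) `<=` G k,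
    forall k w, `|D' k w| <= C k,
    forall w, \sum_(k < N) D' k w ^+ 2 * v k <= delta &
    forall w, \sum_(k < N) D k w ^+ 2 * v k <= delta ->
      forall k, (k < N)%N -> D' k w * zeta k w = D k w * zeta k w].
Proof.
move=> delta0 DG.
(* The energy includes the term of index k itself: it is still known in [G k], and the truncated
   energy never overshoots [delta]. Where [v k] is 0 the energy says nothing about [D k], which is
   replaced by 0; [zeta k] vanishes there. *)
pose A k := [set w | \sum_(j < k.+1) D j w ^+ 2 * v j <= delta].
pose D' k w := if v k == 0 then 0 else D k w * \1_(A k) w.
have Dm j k : (j <= k)%N ->
    measurable_fun setT (D j : g_sigma_algebraType (G k) -> R).
  elim: k => [|k IH]; first by rewrite leqn0 => /eqP ->; exact/(sigma_rvP (sG 0)).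
  rewrite leq_eqVlt => /orP[/eqP ->|]; first exact/(sigma_rvP (sG _)).
  rewrite ltnS => /IH /(sigma_rvP (sG _)) H; apply/(sigma_rvP (sG _)).
  by move=> B /H; exact: Gmono.
have mA k : measurable (A k : set (g_sigma_algebraType (G k))).
  apply: measurable_le_set => //; apply: measurable_sum => j.
  apply: measurable_funM => //; apply: measurable_funX; apply: Dm.
  by rewrite -ltnS.
have partial_le w k : (k <= N)%N ->
    \sum_(j < k) D j w ^+ 2 * v j <= \sum_(j < N) D j w ^+ 2 * v j.
  move=> kN; rewrite -!(big_mkord xpredT (fun j => D j w ^+ 2 * v j)).
  rewrite [leRHS](big_cat_nat (n := k))//= lerDl sumr_ge0// => i _.
  by rewrite mulr_ge0 ?sqr_ge0.
have bound w n : \sum_(k < n) D' k w ^+ 2 * v k <= delta.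
  elim: n => [|n IH]; first by rewrite big_ord0 ltW.
  rewrite big_ord_recr/= {2}/D'; case: ifPn => [_|vn].
    by rewrite expr0n/= mul0r addr0.
  rewrite indicE; case: (boolP (w \in A n)) => [/set_mem wA|_]; last first.
    by rewrite mulr0 expr0n/= mul0r addr0.
  rewrite mulr1; apply: le_trans wA; rewrite big_ord_recr/= lerD2r.
  apply: ler_sum => k _; rewrite ler_wpM2r//.
  rewrite /D'; case: ifP => _; first by rewrite expr0n/= sqr_ge0.
  rewrite indicE; case: (w \in A k); rewrite ?mulr1//.
  by rewrite mulr0 expr0n/= sqr_ge0.
(* A single term of the energy is at most [delta]. When [v k] is 0 the quotient is 0 by convention,
   in agreement with [D' k] being 0. *)
exists D', (fun k => Num.sqrt (delta / v k)); split.
- move=> k; apply/(sigma_rvP (sG k)); rewrite /D'.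
  case: (v k == 0); first exact: measurable_cst.
  by apply: measurable_funM; [exact: Dm|exact: measurable_indic].
- move=> k w; have := bound w k.+1.
  rewrite -sqrtr_sqr ler_sqrt; last by apply: divr_ge0 => //; exact: ltW.
  have [v0|vk] := eqVneq (v k) 0.
    by move=> _; rewrite /D' v0 eqxx expr0n/= invr0 mulr0.
  rewrite ler_pdivlMr; last by rewrite lt0r vk v_ge0.
  apply: le_trans.
  rewrite big_ord_recr/= lerDr sumr_ge0// => i _.
  by rewrite mulr_ge0 ?sqr_ge0.
- by move=> w; exact: bound.
- move=> w tot k kN; rewrite /D'; case: ifPn => [/eqP vk|_].
    by rewrite zeta_deg// !mulr0.
  by rewrite indicE mem_set ?mulr1//= /A/= (le_trans (partial_le w _ _)).
Qed.

(** The isometry is applied to the truncated coefficients restricted to each block. An index lies in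
    at most one block, so the block energies add up to at most [delta], and Markov's inequality
    concludes. *)
Lemma transform_block_small (D : nat -> T -> R) N (b : nat -> nat) n (delta e eta : R) :
  0 < delta -> 0 < e -> (forall k, sigma_rv (D k) `<=` G k) ->
  holds_but P eta (fun w => \sum_(k < N) D k w ^+ 2 * v k <= delta) ->
  holds_but P (eta + delta / e) (fun w =>
    \sum_(i < n) (\sum_(k < N | b k == i) D k w * zeta k w) ^+ 2 <= e).
Proof.
move=> delta0 e0 DG small.
have [D' [C [D'G D'C D'd D'E]]] := @transform_truncation D N delta delta0 DG.
pose Di i k w := if b k == i then D' k w else 0.
have DiG i k : sigma_rv (Di i k) `<=` G k.
  apply/(sigma_rvP (sG k)); rewrite /Di; case: (b k == i).
    exact/(sigma_rvP (sG k)).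
  exact: measurable_cst.
have C0 k : 0 <= C k by exact: le_trans (normr_ge0 _) (D'C k point).
have DiC i k w : `|Di i k w| <= C k by rewrite /Di; case: ifP; rewrite ?normr0.
have mt i : measurable_fun setT (transform (Di i) N).
  by apply: sigma_rv_measurable (@Gm N) _; apply: transform_adapted.
have mD' k : measurable_fun setT (D' k).
  exact: sigma_rv_measurable (@Gm k) (@D'G k).
have mDi i k : measurable_fun setT (Di i k).
  exact: sigma_rv_measurable (@Gm k) (@DiG i k).
have trE i w : transform (Di i) N w = \sum_(k < N | b k == i) D' k w * zeta k w.
  rewrite /transform [RHS]big_mkcond/=; apply: eq_bigr => k _.
  by rewrite /Di; case: ifP; rewrite ?mul0r.
have H : holds_but P (delta / e) (fun w =>
    \sum_(i < n) (transform (Di i) N w) ^+ 2 <= e).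
  apply: holds_but_markov => //.
  - by apply: measurable_sum => i; exact: measurable_funX.
  - by move=> w; rewrite sumr_ge0// => i _; rewrite sqr_ge0.
  under eq_integral do rewrite -sumEFin.
  rewrite ge0_integral_sum//; last 2 first.
  - by move=> i; apply/measurable_EFinP; exact: measurable_funX.
  - by move=> i w _; rewrite lee_fin sqr_ge0.
  under eq_bigr do rewrite (transform_isometry _ (DiG _) (DiC _)).
  rewrite -ge0_integral_sum//; last 2 first.
  - move=> i; apply/measurable_EFinP; apply: measurable_sum => k.
    by apply: measurable_funM => //; exact: measurable_funX.
  - move=> i w _; rewrite lee_fin sumr_ge0// => k _.
    by rewrite mulr_ge0 ?sqr_ge0.
  apply: (@le_trans _ _ (\int[P]_w delta%:E)%E); last first.
    by rewrite integral_cst//= probability_setT mule1.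
  apply: ge0_le_integral => //.
  - move=> w _; rewrite sume_ge0// => i _; rewrite lee_fin sumr_ge0// => k _.
    by rewrite mulr_ge0 ?sqr_ge0.
  - apply: emeasurable_sum => i; apply/measurable_EFinP; apply: measurable_sum => k.
    by apply: measurable_funM => //; exact: measurable_funX.
  move=> w _; rewrite sumEFin lee_fin; apply: le_trans (D'd w).
  rewrite exchange_big/=; apply: ler_sum => k _.
  have [bk|bk] := ltnP (b k) n.
    rewrite (bigD1 (Ordinal bk))//= big1 ?addr0; last first.
      move=> i /eqP ib; rewrite /Di ifF ?expr0n/= ?mul0r//.
      by apply/negbTE/eqP => bi; apply: ib; apply/val_inj.
    by rewrite /Di eqxx.
  rewrite big1 => [|i _]; first by rewrite mulr_ge0 ?sqr_ge0.
  rewrite /Di ifF ?expr0n/= ?mul0r//.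
  by apply/negbTE/eqP => bi; move: bk; rewrite bi leqNgt ltn_ord.
apply: holds_but_le (holds_but_and small H) => // w [tot]; apply: le_trans.
rewrite le_eqVlt; apply/orP; left; apply/eqP; apply: eq_bigr => i _.
rewrite trE; congr (_ ^+ 2); apply: eq_bigr => k _.
by rewrite D'E.
Qed.

Lemma transform_small (D : nat -> T -> R) N (delta e eta : R) :
  0 < delta -> 0 < e -> (forall k, sigma_rv (D k) `<=` G k) ->
  holds_but P eta (fun w => \sum_(k < N) D k w ^+ 2 * v k <= delta) ->
  holds_but P (eta + delta / e ^+ 2) (fun w => `|transform D N w| <= e).
Proof.
move=> delta0 e0 DG small.
have e20 : 0 < e ^+ 2 by rewrite exprn_gt0.
have := @transform_block_small D N (fun=> 0%N) 1 _ _ _ delta0 e20 DG small.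
apply: holds_but_le => // w; rewrite big_ord1 /transform/=.
by rewrite -(real_normK (num_real (\sum_(k < N) _))) ler_pXn2r// nnegrE ltW.
Qed.

End martingale_transform.

(** * Càdlàg paths *)

(** From pointwise to uniform thresholds: the events that the bound fails at some n >= N decrease to
    the empty set, so their probabilities tend to 0. *)
Lemma holds_but_cvg d (T : measurableType d) (R : realType)
    (P : probability T R) (f : nat -> T -> \bar R) (e eta : R) :
  (forall n, measurable_fun setT (f n)) ->
  (forall w, exists N, forall n, (N <= n)%N -> (f n w <= e%:E)%E) ->
  0 < eta ->
  exists N, forall n, (N <= n)%N -> holds_but P eta (fun w => (f n w <= e%:E)%E).
Proof.
move=> mf fe eta0.
pose B N := \bigcup_(n in [set n | (N <= n)%N]) [set w | (e%:E < f n w)%E].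
have mB N : measurable (B N).
  apply: bigcup_measurable => n _.
  rewrite -[X in measurable X]setTI.
  exact: emeasurable_fun_o_infty.
have B0 : \bigcap_N B N = set0.
  apply/seteqP; split => // w Bw.
  have [N HN] := fe w.
  have [n /= Nn] := Bw N I.
  by rewrite ltNge (HN n Nn).
have : P (B N) @[N --> \oo] --> P (\bigcap_N B N).
  apply: nonincreasing_cvg_mu => //.
  - by rewrite (le_lt_trans (probability_le1 P (mB _)))// ltry.
  - exact: bigcap_measurable.
  - move=> m n mn; apply/subsetPset => w [k /= nk ?]; exists k => //=.
    exact: leq_trans nk.
rewrite B0 measure0 => /fine_cvgP[_ /cvgrPdist_le /(_ _ eta0)[N _ HN]].
exists N => n Nn; exists (B N); split => //.
  have := HN N (leqnn N); rewrite /= sub0r normrN ger0_norm ?fine_ge0//.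
  by rewrite -lee_fin fineK// fin_num_measure.
move=> w Bw; rewrite leNgt; apply/negP => fw; apply: Bw; exists n => //.
Qed.

Section cadlag_paths.
Context (R : realType).
Implicit Types x : R -> R.

(** A finite substitute for the modulus of continuity. Only cuts in ]s, s'] are excluded: a jump at
    s is already contained in the value at s, by right-continuity. *)
Definition cut_points x (t e : R) (L : seq R) : Prop :=
  forall s s', 0 <= s -> s <= s' -> s' <= t ->
    (forall r, r \in L -> ~ (s < r /\ r <= s')) -> `|x s - x s'| <= e.

(** Compactness by a supremum: let b be the supremum of the times up to which finitely many cuts
    suffice. The left limit at b shows that b is such a time, and right-continuity goes beyond b
    unless b = t. *)
Lemma cadlag_cut_points x t e : cadlag x -> 0 <= t -> 0 < e ->
  exists L, cut_points x t e L.
Proof.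
move=> [xr xl] t0 e0.
have e2 : 0 < e / 2 by rewrite divr_gt0.
pose A := [set u | 0 <= u <= t /\ exists L, cut_points x u e L].
have A0 : A 0.
  split; first by rewrite lexx.
  exists [::] => s s' s0 ss' s'0 _.
  have -> : s = 0 by apply/le_anti; rewrite s0 (le_trans ss').
  have -> : s' = 0 by apply/le_anti; rewrite s'0 (le_trans s0).
  by rewrite subrr normr0 ltW.
have supA : has_sup A.
  by split; [exists 0|exists t => u [/andP[]]].
set b := sup A.
have ubA u : A u -> u <= b by move: u; exact: ub_le_sup supA.2.
have b0 : 0 <= b by exact: ubA.
have bt : b <= t by apply: ge_sup; [exists 0|move=> u [/andP[]]].
have Ab : A b.
  split; first by rewrite b0.
  have [b_eq0|b_neq0] := eqVneq b 0.
    by rewrite b_eq0; have [_] := A0.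
  have bgt0 : 0 < b by rewrite lt0r b_neq0.
  have /cvgrPdist_le/(_ _ e2) := xl b bgt0.
  move=> [del /= del0 Hdel].
  have [u Au bu] := sup_adherent del0 supA.
  have [/andP[u0 ut] [L HL]] := Au.
  (* From [u] up to, but excluding, [b] the path stays within e/2 of its left limit at [b]; the cut
     at [b] accounts for the jump there, and the cut at [u] separates the part handled by [L]. *)
  exists (b :: u :: L) => s s' s0 ss' s'b cuts.
  have [->|ss's] := eqVneq s s'; first by rewrite subrr normr0 ltW.
  have s's : s < s' by rewrite lt_neqAle ss's.
  have s'b' : s' < b.
    rewrite ltNge; apply/negP => bs'; apply: (cuts b); first by rewrite inE eqxx.
    split => //; apply: lt_le_trans s's s'b.
  have [us'|s'u] := ltP u s'.
    have us : u <= s.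
      rewrite leNgt; apply/negP => su; apply: (cuts u).
        by rewrite !inE eqxx orbT.
      by split => //; exact: ltW.
    have Hs r : u <= r -> r < b -> `|lim (x s0 @[s0 --> b^'-]) - x r| <= e / 2.
      move=> ur rb; apply: Hdel => //=.
      rewrite ger0_norm ?subr_ge0 ?ltW//.
      by rewrite ltrBlDr -ltrBlDl (lt_le_trans bu).
    rewrite (splitr e) -(subrK (lim (x s1 @[s1 --> b^'-])) (x s)) -addrA.
    rewrite (le_trans (ler_normD _ _))// lerD//.
      by rewrite distrC Hs// (lt_trans s's).
    by rewrite Hs// ltW.
  apply: HL => // r rL; apply: cuts.
  by rewrite !inE rL !orbT.
suff bE : b = t by move: Ab; rewrite bE => -[].
apply/eqP; rewrite eq_le bt leNgt; apply/negP => btlt.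
have [_ [L HL]] := Ab.
have /cvgrPdist_le/(_ _ e2) := xr b b0.
move=> [del /= del0 Hdel].
pose u := Num.min t (b + del / 2).
have bu : b < u by rewrite lt_min btlt ltrDl divr_gt0.
suff /ubA : A u by rewrite leNgt bu.
split; first by rewrite (le_trans b0 (ltW bu)) ge_min lexx.
exists (b :: L) => s s' s0 ss' s'u cuts.
have [s'b|bs'] := leP s' b.
  by apply: HL => // r rL; apply: cuts; rewrite inE rL orbT.
have bs : b <= s.
  rewrite leNgt; apply/negP => sb; apply: (cuts b); first by rewrite inE eqxx.
  by split => //; exact: ltW.
have Hs r : b <= r -> r <= s' -> `|x b - x r| <= e / 2.
  rewrite le_eqVlt => /orP[/eqP <- _|br rs']; first by rewrite subrr normr0 ltW.
  apply: Hdel => //=.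
  rewrite distrC ger0_norm ?subr_ge0 ?ltW//.
  rewrite ltrBlDl (le_lt_trans rs')// (le_lt_trans s'u)//.
  by rewrite gt_min ltrD2l gtr_pMr// invf_lt1// ltr1n orbT.
rewrite (splitr e) -(subrK (x b) (x s)) -addrA.
rewrite (le_trans (ler_normD _ _))// lerD//.
  by rewrite distrC Hs.
by rewrite Hs// ltW.
Qed.

Lemma last_cut (L : seq R) s : 0 <= s -> exists r, [/\ r \in 0 :: L,
  0 <= r <= s & forall r', r' \in L -> ~ (r < r' /\ r' <= s)].
Proof.
move=> s0; elim: L => [|a L [r [rL /andP[r0 rs] H]]].
  by exists 0; rewrite inE eqxx lexx s0.
have [/andP[ra as_]|nra] := boolP (r < a <= s).
  exists a; rewrite !inE eqxx orbT (le_trans r0 (ltW ra)) as_; split => // r'.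
  rewrite inE => /orP[/eqP ->|r'L [ar' r's]]; first by rewrite ltxx => -[].
  by apply: (H r') => //; split => //; exact: lt_trans ar'.
exists r; split; rewrite ?r0 ?rs//.
  by move: rL; rewrite !inE => /orP[->//|->]; rewrite !orbT.
move=> r'; rewrite inE => /orP[/eqP -> [ra as_]|]; last exact: H.
by move: nra; rewrite ra as_.
Qed.

Lemma cadlag_bounded x t : cadlag x -> 0 <= t ->
  exists2 B, 0 <= B & forall s, 0 <= s -> s <= t -> `|x s| <= B.
Proof.
move=> cx t0; have [L HL] := cadlag_cut_points cx t0 ltr01.
(* The value at s is within 1 of the value at the last cut before s, or at 0 if there is none; the
   sum bounds all these values. *)
exists (1 + \sum_(r <- 0 :: L) `|x r|).
  by rewrite addr_ge0// sumr_ge0.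
move=> s s0 st.
have [r [rL /andP[r0 rs] H]] := last_cut L s0.
have := HL r s r0 rs st H; rewrite distrC => xrs.
rewrite -(subrK (x r) (x s)) (le_trans (ler_normD _ _))// lerD//.
by rewrite (big_rem r)//= lerDl sumr_ge0.
Qed.

(** For h > 0 negative times are sent to 0, so a path is never evaluated before time 0. *)
Definition gridl (h s : R) : R := h * (Num.truncn (s / h))%:R.

Lemma gridl_ge0 h s : 0 < h -> 0 <= gridl h s.
Proof. by move=> h0; rewrite mulr_ge0// ltW. Qed.

Lemma gridl_itv h s : 0 < h -> 0 <= s -> gridl h s <= s < gridl h s + h.
Proof.
move=> h0 s0; have sh0 : 0 <= s / h by rewrite divr_ge0// ltW.
have /andP[H1 H2] := truncn_itv sh0.
rewrite /gridl mulrC; apply/andP; split; first by rewrite -ler_pdivlMr.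
by rewrite -[X in _ + X]mul1r -mulrDl natr1 -ltr_pdivrMr.
Qed.

Lemma gridl_eq h s (j : nat) : 0 < h -> h * j%:R <= s < h * j.+1%:R ->
  gridl h s = h * j%:R.
Proof.
move=> h0 /andP[H1 H2]; rewrite /gridl; congr (h * _%:R); apply: truncn_def.
by rewrite ler_pdivlMr// ltr_pdivrMr// mulrC H1 mulrC.
Qed.

Lemma measurable_gridl h : 0 < h -> measurable_fun setT (gridl h).
Proof.
move=> h0; apply: nondecreasing_measurable => // s s' ss'.
rewrite /gridl ler_pM2l// ler_nat le_truncn//.
by rewrite ler_pM2r ?invr_gt0.
Qed.

Local Notation mu := lebesgue_measure.

Definition grid_energy x (t h : R) : \bar R :=
  (\int[mu]_(s in `[0%R, t]) ((x s - x (gridl h s)) ^+ 2)%:E)%E.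

Lemma measurable_grid_path x (h : R) : 0 < h ->
  measurable_fun setT (fun s : R => x (Num.max s 0)) ->
  measurable_fun setT (fun s : R => x (gridl h s)).
Proof.
move=> h0 mx.
have := measurableT_comp mx (measurable_gridl h0).
congr measurable_fun; apply/funext => s /=.
by rewrite max_l// gridl_ge0.
Qed.

Lemma measurable_grid_energy x (t h : R) : 0 < h ->
  measurable_fun setT (fun s : R => x (Num.max s 0)) ->
  measurable_fun (`[0, t] : set R) (fun s : R => ((x s - x (gridl h s)) ^+ 2)%:E).
Proof.
move=> h0 mx.
apply: (eq_measurable_fun (fun s : R => ((x (Num.max s 0) - x (gridl h s)) ^+ 2)%:E)).
  by move=> s; rewrite inE/= in_itv/= => /andP[s0 _]; rewrite max_l.
apply: measurable_funTS; apply/measurable_EFinP; apply: measurable_funX.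
by apply: measurable_funB => //; exact: measurable_grid_path.
Qed.

(* If x s and x (gridl h s) differ by more than the oscillation between cuts,
   some cut r lies in ]gridl h s, s], so that s is in [r, r + h]. *)
Lemma grid_energy_le x (t e : R) : cadlag x -> 0 <= t -> 0 < e ->
  measurable_fun setT (fun s : R => x (Num.max s 0)) ->
  exists K, 0 <= K /\ forall h, 0 < h -> (grid_energy x t h <= (e + K * h)%:E)%E.
Proof.
move=> cx t0 e0 mx.
(* [c] is the oscillation allowed between cuts; away from the cuts it costs at most c^2 t in the
   energy. *)
have [c [c0 ct]] : exists c, 0 < c /\ c ^+ 2 * t <= e.
  exists (Num.min 1 (e / (t + 1))).
  have t1 : 0 < t + 1 by rewrite ltr_wpDl.
  split; first by rewrite lt_min ltr01 divr_gt0.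
  have : Num.min 1 (e / (t + 1)) <= e / (t + 1) by rewrite ge_min lexx orbT.
  have : 0 < Num.min 1 (e / (t + 1)) by rewrite lt_min ltr01 divr_gt0.
  have : Num.min 1 (e / (t + 1)) <= 1 by rewrite ge_min lexx.
  rewrite ler_pdivlMr//.
  by set m := Num.min _ _; nra.
have [L HL] := cadlag_cut_points cx t0 c0.
have [B B0 HB] := cadlag_bounded cx t0.
(* Each cut spoils a set of times of length at most h, on which the squared difference is at most (2
   B)^2. *)
exists ((2 * B) ^+ 2 * (size L)%:R); split; first by rewrite mulr_ge0 ?sqr_ge0.
move=> h h0.
pose bad s := \sum_(r <- L) \1_(`[r, r + h]) s : R.
have bad0 s : 0 <= bad s by rewrite sumr_ge0.
have mbad : measurable_fun setT bad.
  by apply: measurable_sum => r; exact: measurable_indic.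
have pw s : 0 <= s <= t ->
    (x s - x (gridl h s)) ^+ 2 <= c ^+ 2 + (2 * B) ^+ 2 * bad s.
  move=> /andP[s0 st].
  have /andP[gs sg] := gridl_itv h0 s0.
  have g0 := gridl_ge0 s h0.
  have [/hasP[r rL /andP[gr rs]]|nocut] :=
    boolP (has (fun r => (gridl h s < r) && (r <= s)) L).
    have b1 : 1 <= bad s.
      rewrite /bad (big_rem r)//= indicE mem_set/=.
        by rewrite lerDl sumr_ge0.
      by rewrite in_itv/= rs/= (le_trans (ltW sg))// lerD2r ltW.
    have : `|x s - x (gridl h s)| <= 2 * B.
      rewrite (le_trans (ler_normB _ _))// [leRHS]mulr_natl mulr2n lerD//.
        exact: HB.
      by apply: HB => //; exact: le_trans st.
    move=> H; rewrite (@le_trans _ _ ((2 * B) ^+ 2))//.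
      rewrite -[leLHS](real_normK (num_real _)) lerXn2r ?nnegrE//.
      by rewrite mulr_ge0.
    by rewrite ler_wpDl ?sqr_ge0// ler_peMr ?sqr_ge0.
  have := HL _ _ g0 gs st; rewrite distrC => H.
  rewrite ler_wpDr ?mulr_ge0 ?sqr_ge0//.
  rewrite -[leLHS](real_normK (num_real _)) lerXn2r ?nnegrE//; first exact: ltW.
  apply: H => r rL [r1 r2]; move/hasPn: nocut => /(_ r rL).
  by rewrite r1 r2.
have itv_le (u v : R) : u <= v -> (mu `[u, v] = (v - u)%:E :> \bar R)%E.
  rewrite lebesgue_measure_itv/= lte_fin le_eqVlt => /orP[/eqP ->|->]; last by rewrite EFinB.
  by rewrite ltxx subrr.
apply: (@le_trans _ _
  (\int[mu]_(s in `[0%R, t]) ((c ^+ 2)%:E + ((2 * B) ^+ 2)%:E * (bad s)%:E))%E).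
  apply: ge0_le_integral => //.
  - by move=> s _; rewrite lee_fin sqr_ge0.
  - exact: measurable_grid_energy.
  - apply: measurable_funTS; apply: emeasurable_funD => //.
    by apply: measurable_funeM; exact/measurable_EFinP.
rewrite ge0_integralD//; last 3 first.
- by move=> s _; rewrite lee_fin sqr_ge0.
- by move=> s _; rewrite mule_ge0// lee_fin ?sqr_ge0.
- by apply: measurable_funTS; apply: measurable_funeM; exact/measurable_EFinP.
rewrite integral_cst// EFinD leeD//.
  by rewrite [X in (_ * X)%E]itv_le// subr0 -EFinM lee_fin.
rewrite ge0_integralZl//; last 3 first.
- by apply: measurable_funTS; exact/measurable_EFinP.
- by move=> s _; rewrite lee_fin.
- by rewrite lee_fin sqr_ge0.
have -> : (2 * B) ^+ 2 * (size L)%:R * h = (2 * B) ^+ 2 * ((size L)%:R * h).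
  by rewrite mulrA.
rewrite [leRHS]EFinM lee_wpmul2l ?lee_fin ?sqr_ge0//.
under eq_integral do rewrite /bad -sumEFin.
rewrite ge0_integral_sum//; last first.
  by move=> r; apply: measurable_funTS; apply/measurable_EFinP; exact: measurable_indic.
apply: (@le_trans _ _ (\sum_(r <- L) h%:E)%E); last first.
  by rewrite sumEFin big_const_seq count_predT iter_addr addr0 mulr_natl.
apply: lee_sum => r _; rewrite integral_indic//.
apply: (@le_trans _ _ (mu `[r, r + h])).
  by apply: le_measure; rewrite ?inE//; exact: measurableI.
rewrite itv_le; last by rewrite lerDl ltW.
by rewrite addrC addKr.
Qed.

End cadlag_paths.

(** * The grid energy as a random variable *)

Section jointly_measurable.
Context d (T : measurableType d) (R : realType).
Local Notation mu := lebesgue_measure.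

Lemma measurable_time_integral (t : R) (f : R * T -> \bar R) :
  measurable_fun setT f -> (forall z, 0 <= f z)%E ->
  measurable_fun setT (fun w => (\int[mu]_(s in `[0%R, t]) f (s, w))%E).
Proof.
move=> mf f0.
pose g (z : measurableTypeR R * T) := (f z * (\1_(`[0%R, t] : set R) z.1)%:E)%E.
have mg : measurable_fun setT g.
  apply: emeasurable_funM; first exact: mf.
  apply/measurable_EFinP.
  by apply: (measurableT_comp (measurable_indic _)) => //.
have g0 z : (0 <= g z)%E by rewrite mule_ge0// lee_fin.
have := measurable_fun_fubini_tonelli_G (m1 := lebesgue_measure) g mg g0.
congr measurable_fun; apply/funext => w.
rewrite [RHS]integral_mkcond; apply: eq_integral => s _.
rewrite /g patchE indicE; case: ifP => /=; first by rewrite mule1.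
by rewrite mule0.
Qed.

Variable X : R -> T -> R.
Hypothesis mX : measurable_fun setT (fun z : R * T => X (Num.max z.1 0) z.2).

Lemma measurable_section (w : T) :
  measurable_fun setT (fun s : R => X (Num.max s 0) w).
Proof.
have mp : measurable_fun setT (fun s : R => (s, w)) by exact: measurable_fun_pair.
exact: (measurableT_comp mX mp).
Qed.

Lemma measurable_grid (h : R) : 0 < h ->
  measurable_fun setT (fun z : R * T => X (gridl h z.1) z.2).
Proof.
move=> h0.
have mp : measurable_fun setT (fun z : R * T => (gridl h z.1, z.2)).
  apply: measurable_fun_pair => //.
  by apply: (measurableT_comp (measurable_gridl h0)).
have := measurableT_comp mX mp.
by congr measurable_fun; apply/funext => z /=; rewrite max_l// gridl_ge0.
Qed.

Lemma measurable_grid_energy_rv (t h : R) : 0 < h ->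
  measurable_fun setT (fun w => grid_energy (X^~ w) t h).
Proof.
move=> h0.
have := @measurable_time_integral t
  (fun z => ((X (Num.max z.1 0) z.2 - X (gridl h z.1) z.2) ^+ 2)%:E).
have H : (forall z : R * T, 0 <=
   ((X (Num.max z.1 0) z.2 - X (gridl h z.1) z.2) ^+ 2)%:E)%E.
  by move=> z; rewrite lee_fin sqr_ge0.
move=> /(_ _ H).
have mf : measurable_fun setT (fun z : R * T =>
   ((X (Num.max z.1 0) z.2 - X (gridl h z.1) z.2) ^+ 2)%:E).
  apply/measurable_EFinP; apply: measurable_funX; apply: measurable_funB => //.
  exact: measurable_grid.
move=> /(_ mf); congr measurable_fun; apply/funext => w.
apply: eq_integral => s; rewrite inE/= in_itv/= => /andP[s0 _].
by rewrite max_l.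
Qed.

(** The constant K of [grid_energy_le] depends on the path, hence the passage through
    [holds_but_cvg]. Validity for every n >= N matters: it covers all refinements of a grid. *)
Lemma grid_energy_small (P : probability T R) (t e eta : R) :
  (forall w, cadlag (X^~ w)) -> 0 < t -> 0 < e -> 0 < eta ->
  exists N, forall n, (N <= n)%N ->
    holds_but P eta (fun w => (grid_energy (X^~ w) t (t / n.+1%:R) <= e%:E)%E).
Proof.
move=> cX t0 e0 eta0.
have tn n : 0 < t / n.+1%:R by rewrite divr_gt0.
apply: (@holds_but_cvg _ _ _ P (fun n w => grid_energy (X^~ w) t (t / n.+1%:R))) => //.
  by move=> n; exact: measurable_grid_energy_rv.
move=> w.
have e2 : 0 < e / 2 by rewrite divr_gt0.
have [K [K0 HK]] := grid_energy_le (cX w) (ltW t0) e2 (measurable_section w).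
exists (Num.truncn (K * t / (e / 2))) => n Nn.
rewrite (le_trans (HK _ (tn n)))// lee_fin [leRHS]splitr lerD2l.
have : K * t / (e / 2) <= n.+1%:R.
  by rewrite (le_trans (ltW (truncnS_gt _)))// ler_nat.
by rewrite mulrA !ler_pdivrMr// => H; rewrite [leRHS]mulrC.
Qed.
End jointly_measurable.

(** * Brownian increments on a grid *)

Section brownian_grid.
Context d (T : measurableType d) (R : realType) (P : probability T R).
Variables (F : R -> set (set T)) (W : R -> {RV P >-> R}).
Hypotheses (fF : filtration F) (bW : brownian_motion W)
  (aW : adapted F (fun t => W t : T -> R))
  (iW : forall s t, 0 <= s -> s <= t ->
    independent P (sigma_rv (fun w => W t w - W s w)) (F s)).

Lemma measurable_brownian_increment (s t : R) :
  measurable_fun setT (fun w => W t w - W s w).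
Proof. exact: measurable_funB. Qed.

Lemma brownian_law (s t : R) : 0 <= s -> s < t -> forall B, measurable B ->
  P [set w | B (W t w - W s w)] = normal_prob 0 (Num.sqrt (t - s)) B.
Proof. by move=> s0 st B mB; exact: (brownian_normal bW). Qed.

Section grid.
Variable u : nat -> R.
Hypotheses (u0 : 0 <= u 0%N) (umono : forall k, u k <= u k.+1).

Let dW k w := W (u k.+1) w - W (u k) w.

Lemma grid_ge0 k : 0 <= u k.
Proof. by elim: k => // k; move=> /le_trans; apply. Qed.

Let sG k : sigma_algebra setT (F (u k)).
Proof. by apply: filtration_sigma fF _ _; exact: grid_ge0. Qed.

Let Gm k : F (u k) `<=` measurable.
Proof. by apply: filtration_sub fF _ _; exact: grid_ge0. Qed.

Let Gmono k : F (u k) `<=` F (u k.+1).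
Proof. by apply: filtration_mono fF _ _ _ _; [exact: grid_ge0|exact: umono]. Qed.

Lemma brownian_increment_adapted k : sigma_rv (dW k) `<=` F (u k.+1).
Proof.
apply/(sigma_rvP (sG k.+1)); apply: measurable_funB.
  by apply/(sigma_rvP (sG k.+1)); apply: aW; exact: grid_ge0.
apply/(sigma_rvP (sG k.+1)) => A /aW H; apply: Gmono; apply: H; exact: grid_ge0.
Qed.

Lemma brownian_increment_indep k : independent P (sigma_rv (dW k)) (F (u k)).
Proof. by apply: iW => //; exact: grid_ge0. Qed.

(** Grid points may coincide, as they do when the times of a simple process are clipped to a cell;
    the increment then vanishes and has no normal density. *)
Let uS k : u k = u k.+1 \/ 0 < u k.+1 - u k.
Proof.
by have := umono k; rewrite le_eqVlt => /orP[/eqP|]; [left|right; rewrite subr_gt0].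
Qed.

Let dW_deg k : u k.+1 - u k = 0 -> forall w, dW k w = 0.
Proof. by move=> /eqP; rewrite subr_eq0 => /eqP E w; rewrite /dW E subrr. Qed.

Let dW_mom1 k : (\int[P]_w (dW k w)%:E = 0)%E.
Proof.
have [E|lt] := uS k.
  rewrite (eq_integral (cst 0%E)) ?integral_cst ?mul0e// => w _.
  by rewrite dW_deg// E subrr.
apply: (centered_normal_mom1 (measurable_brownian_increment _ _) lt) => B mB.
by apply: brownian_law => //; [exact: grid_ge0|rewrite -subr_gt0].
Qed.

Let dW_mom2 k : (\int[P]_w (dW k w ^+ 2)%:E = (u k.+1 - u k)%:E)%E.
Proof.
have [E|lt] := uS k.
  rewrite (eq_integral (cst 0%E)) ?integral_cst ?mul0e// => [|w _].
    by rewrite E subrr.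
  by rewrite dW_deg ?expr0n// E subrr.
apply: (centered_normal_mom2 (measurable_brownian_increment _ _) lt) => B mB.
by apply: brownian_law => //; [exact: grid_ge0|rewrite -subr_gt0].
Qed.

Let dW_mom4 k : (\int[P]_w (dW k w ^+ 4)%:E <= (64 * (u k.+1 - u k) ^+ 2)%:E)%E.
Proof.
have [E|lt] := uS k.
  rewrite (eq_integral (cst 0%E)) ?integral_cst ?mul0e// => [|w _].
    by rewrite lee_fin mulr_ge0 ?sqr_ge0.
  by rewrite dW_deg ?expr0n// E subrr.
apply: (centered_normal_mom4 (measurable_brownian_increment _ _) lt) => B mB.
by apply: brownian_law => //; [exact: grid_ge0|rewrite -subr_gt0].
Qed.

Lemma brownian_transform_small (D : nat -> T -> R) N (delta e eta : R) :
  0 < delta -> 0 < e -> (forall k, sigma_rv (D k) `<=` F (u k)) ->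
  holds_but P eta (fun w => \sum_(k < N) D k w ^+ 2 * (u k.+1 - u k) <= delta) ->
  holds_but P (eta + delta / e ^+ 2) (fun w =>
    `|\sum_(k < N) D k w * (W (u k.+1) w - W (u k) w)| <= e).
Proof.
move=> delta0 e0 DG small.
exact: (transform_small sG Gm Gmono brownian_increment_adapted
  brownian_increment_indep dW_mom1 dW_mom2 dW_deg delta0 e0 DG small).
Qed.

Lemma brownian_block_small (D : nat -> T -> R) N (b : nat -> nat) n (delta e eta : R) :
  0 < delta -> 0 < e -> (forall k, sigma_rv (D k) `<=` F (u k)) ->
  holds_but P eta (fun w => \sum_(k < N) D k w ^+ 2 * (u k.+1 - u k) <= delta) ->
  holds_but P (eta + delta / e) (fun w =>
    \sum_(i < n) (\sum_(k < N | b k == i)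
      D k w * (W (u k.+1) w - W (u k) w)) ^+ 2 <= e).
Proof.
move=> delta0 e0 DG small.
exact: (transform_block_small sG Gm Gmono brownian_increment_adapted
  brownian_increment_indep dW_mom1 dW_mom2 dW_deg b n delta0 e0 DG small).
Qed.

(** Serves to bound all increments at once, since one fourth power is at most the sum. On a uniform
    grid the expected sum is of the order of the mesh, whereas the sum of squares does not tend to
    0. *)
Lemma brownian_fourth_powers_small N (e : R) : 0 < e ->
  holds_but P ((\sum_(k < N) 64 * (u k.+1 - u k) ^+ 2) / e) (fun w =>
    \sum_(k < N) (W (u k.+1) w - W (u k) w) ^+ 4 <= e).
Proof.
move=> e0.
have m4 k : measurable_fun setT (fun w => dW k w ^+ 4).
  by apply: measurable_funX; exact: measurable_brownian_increment.
have p4 k w : 0 <= dW k w ^+ 4 by rewrite (exprM _ 2 2) sqr_ge0.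
apply: holds_but_markov => //.
- by apply: measurable_sum => k; exact: m4.
- by move=> w; rewrite sumr_ge0// => k _; exact: p4.
under eq_integral do rewrite -sumEFin.
rewrite ge0_integral_sum//; last 2 first.
- by move=> k; apply/measurable_EFinP; exact: m4.
- by move=> k w _; rewrite lee_fin; exact: p4.
by rewrite -sumEFin; apply: lee_sum => k _; exact: dW_mom4.
Qed.

(** The centered squares [q k] are themselves centered and independent of the past, so the isometry
    with coefficients 1 computes the second moment of their sum, and Chebyshev's inequality
    applies. *)
Lemma brownian_quadratic_variation N (e : R) : 0 < e ->
  holds_but P ((\sum_(k < N) 64 * (u k.+1 - u k) ^+ 2) / e ^+ 2) (fun w =>
    `|\sum_(k < N) ((W (u k.+1) w - W (u k) w) ^+ 2 - (u k.+1 - u k))| <= e).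
Proof.
move=> e0.
pose v k := u k.+1 - u k.
pose q k w := dW k w ^+ 2 - v k.
have v0 k : 0 <= v k by rewrite subr_ge0.
have mdW k : measurable_fun setT (dW k) by exact: measurable_brownian_increment.
have mq k : measurable_fun setT (q k).
  by apply: measurable_funB => //; exact: measurable_funX.
have i2 k : P.-integrable setT (fun w => (dW k w ^+ 2)%:E).
  apply/integrableP; split; first by apply/measurable_EFinP; exact: measurable_funX.
  rewrite (eq_integral (fun w => (dW k w ^+ 2)%:E)) ?dW_mom2 ?ltry//.
  by move=> w _; rewrite gee0_abs// lee_fin sqr_ge0.
have i4 k : P.-integrable setT (fun w => (dW k w ^+ 4)%:E).
  apply/integrableP; split; first by apply/measurable_EFinP; exact: measurable_funX.
  rewrite (eq_integral (fun w => (dW k w ^+ 4)%:E)).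
    by rewrite (le_lt_trans (dW_mom4 k))// ltry.
  by move=> w _; rewrite gee0_abs// lee_fin (exprM _ 2 2) sqr_ge0.
have ic c : P.-integrable setT (fun=> c%:E) by exact: finite_measure_integrable_cst.
have intc c : (\int[P]_w c%:E = c%:E)%E.
  by rewrite integral_cst//= probability_setT mule1.
have q1 k : (\int[P]_w (q k w)%:E = 0)%E.
  rewrite (eq_integral (fun w => (dW k w ^+ 2)%:E - (v k)%:E)%E); last first.
    by move=> w _; rewrite -EFinB.
  by rewrite integralB// dW_mom2 intc subee.
have q2 k : (\int[P]_w (q k w ^+ 2)%:E <= (64 * v k ^+ 2)%:E)%E.
  apply: le_trans (dW_mom4 k).
  rewrite (eq_integral (fun w => (dW k w ^+ 4)%:E +
     ((- (2 * v k))%:E * (dW k w ^+ 2)%:E + (v k ^+ 2)%:E))%E); last first.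
    by move=> w _; rewrite -EFinM -!EFinD; congr EFin; rewrite /q; ring.
  rewrite integralD//; last first.
    by apply: integrableD => //; exact: integrableZl.
  rewrite integralD//; last exact: integrableZl.
  rewrite integralZl// dW_mom2 intc -EFinM -EFinD -[leRHS]adde0 leeD2l// lee_fin.
  by rewrite -/(v k); nra.
(* The isometry needs the exact second moment as a real number; the bound [q2] enters only at the
   end. *)
have q2fin k : (\int[P]_w (q k w ^+ 2)%:E = (fine (\int[P]_w (q k w ^+ 2)%:E))%:E)%E.
  rewrite fineK// ge0_fin_numE; first by rewrite (le_lt_trans (q2 k))// ltry.
  by apply: integral_ge0 => w _; rewrite lee_fin sqr_ge0.
have qG k : sigma_rv (q k) `<=` F (u k.+1).
  apply/(sigma_rvP (sG k.+1)); apply: measurable_funB => //.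
  apply: measurable_funX; apply/(sigma_rvP (sG k.+1)).
  exact: brownian_increment_adapted.
have qind k : independent P (sigma_rv (q k)) (F (u k)).
  move=> A B [C mC <-] FB; apply: (brownian_increment_indep (k := k)); last exact: FB.
  exists ((fun x => x ^+ 2 - v k) @^-1` C).
    rewrite -[X in measurable X]setTI.
    have mm : measurable_fun setT (fun x : R => x ^+ 2 - v k).
      by apply: measurable_funB => //; exact: measurable_funX.
    exact: mm.
  by rewrite !setTI.
have c1G : forall k, sigma_rv (cst (1 : R) : T -> R) `<=` F (u k).
  by move=> k; apply/(sigma_rvP (sG k)); exact: measurable_cst.
have trE w : transform q (fun=> cst 1) N w = \sum_(k < N) q k w.
  by apply: eq_bigr => k _; rewrite mul1r.
have iso : (\int[P]_w ((\sum_(k < N) q k w) ^+ 2)%:E =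
    \int[P]_w (\sum_(k < N) fine (\int[P]_w (q k w ^+ 2)%:E))%:E)%E.
  under eq_integral do rewrite -trE.
  rewrite (transform_isometry sG Gm Gmono qG qind q1 q2fin (C := fun=> 1)) => //.
    apply: eq_integral => w _; congr EFin; apply: eq_bigr => k _.
    by rewrite expr1n mul1r.
  by move=> k w; rewrite normr1.
have e20 : 0 < e ^+ 2 by rewrite exprn_gt0.
have := @holds_but_markov _ _ _ P (fun w => (\sum_(k < N) q k w) ^+ 2)
  (\sum_(k < N) 64 * (u k.+1 - u k) ^+ 2) (e ^+ 2).
move=> H; apply: holds_but_le (H _ _ _ _) => //.
- move=> w; rewrite -(real_normK (num_real (\sum_(k < N) _))).
  by rewrite ler_pXn2r// nnegrE ltW.
- by apply: measurable_funX; apply: measurable_sum => k; exact: mq.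
- by move=> w; rewrite sqr_ge0.
rewrite iso intc lee_fin; apply: ler_sum => k _.
by rewrite -lee_fin -q2fin; exact: q2.
Qed.
End grid.
End brownian_grid.

(** * Itô integrals as limits of Riemann sums *)

Lemma sum_blocks (V : nmodType) (n q : nat) (f : nat -> V) :
  \sum_(k < n * q) f k = \sum_(j < n) \sum_(l < q) f (j * q + l)%N.
Proof.
rewrite -(big_mkord xpredT f) big_nat_mul -(big_mkord xpredT (fun j => \sum_(l < q) f (j * q + l)%N)).
apply: eq_bigr => j _; rewrite -(big_mkord xpredT (fun l => f (j * q + l)%N)).
rewrite -{1}[(j * q)%N]add0n big_addn mulSn addnK.
by apply: eq_bigr => l _; rewrite addnC.
Qed.

Lemma cvg0_le (R : realType) (f : nat -> \bar R) (eta : R) : 0 < eta ->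
  f n @[n --> \oo] --> 0%E -> \forall n \near \oo, (f n <= eta%:E)%E.
Proof.
move=> eta0 /fine_cvgP[ff /cvgrPdist_le /(_ _ eta0) H].
near=> n.
have fn : f n \is a fin_num by near: n.
rewrite -(fineK fn) lee_fin (le_trans (ler_norm _))// -normrN -sub0r.
by near: n.
Unshelve. all: by end_near. Qed.

(** Open cells avoid a clash of conventions: simple processes are constant on ]s, t], grid values on
    [s, t[. The endpoints do not contribute, and an inequality suffices. *)
Lemma sum_integral_cells (R : realType) (u : nat -> R) (f : R -> \bar R) N :
  (forall k, u k <= u k.+1) -> measurable_fun setT f -> (forall s, 0 <= f s)%E ->
  (\sum_(k < N) \int[lebesgue_measure]_(s in `]u k, u k.+1[) f s <=
   \int[lebesgue_measure]_(s in `[u 0%N, u N]) f s)%E.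
Proof.
move=> u_mono mf f0.
have mf' (A : set R) : measurable_fun A f by exact: measurable_funTS.
elim: N => [|N IH]; first by rewrite big_ord0 integral_ge0.
have u0N : u 0%N <= u N by elim: {IH} N => // N; move=> /le_trans; apply.
rewrite big_ord_recr/= (le_trans (leeD IH (lexx _)))//.
rewrite -ge0_integral_setU//; last first.
  apply/disj_setPS => s []; rewrite /= !in_itv/= => /andP[_ suN] /andP[uNs _].
  by have := lt_le_trans uNs suN; rewrite ltxx.
  exact: mf'.
apply: ge0_subset_integral => //; [exact: measurableU|exact: mf'|].
move=> s []; rewrite /= !in_itv/= => /andP[s1 s2]; rewrite ?s1 ?(ltW s2) ?andbT/=.
  exact: le_trans s2 (u_mono N).
by rewrite (le_trans u0N)// ltW.
Qed.

(** * A simple process minus grid values, as a martingale transform *)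

Section clip_grid.
Context d (T : measurableType d) (R : realType) (P : probability T R).
Variables (F : R -> set (set T)) (W : R -> {RV P >-> R}).
Hypotheses (fF : filtration F) (bW : brownian_motion W)
  (aW : adapted F (fun t => W t : T -> R))
  (iW : forall s t, 0 <= s -> s <= t ->
    independent P (sigma_rv (fun w => W t w - W s w)) (F s)).
Variable H : R -> T -> R.
Hypotheses (aH : adapted F H) (cH : forall w, cadlag (H^~ w))
  (mH : measurable_fun setT (fun z : R * T => H (Num.max z.1 0) z.2)).
Variables (S : simple_process F) (h : R) (h0 : 0 < h).
Local Notation mu := lebesgue_measure.

Let L := sp_size S.
(** [S] has [L.+1] times, and inserting them into a cell cuts it into [L.+2] pieces, some of them
    possibly empty. *)
Let q := L.+2.
Let v (j : nat) : R := h * j%:R.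
Let clip (j : nat) (x : R) : R := Num.min (Num.max x (v j)) (v j.+1).

(* The times of S are inserted into the cell [v j, v j.+1] as points
   0 < l < q, with [clip_time j 0 = v j] and [clip_time j q = v j.+1]. *)
Let clip_time (j l : nat) : R :=
  if l is l'.+1 then (if (l < q)%N then clip j (sp_time S l') else v j.+1)
  else v j.

(** The index is shifted by one: piece 0 lies before the first time of [S], and the last piece after
    all of them. A coefficient whose time is not before the end of the cell is replaced by 0, since
    it need not be known yet; its piece is empty. *)
Let clip_coef (j l : nat) (w : T) : R :=
  if l is l'.+1 then
    (if (l' < L)%N && (sp_time S l' < v j.+1) then sp_coef S l' w else 0)
  else 0.

Let u (k : nat) : R := clip_time (k %/ q) (k %% q).
Let D (k : nat) (w : T) : R := clip_coef (k %/ q) (k %% q) w - H (v (k %/ q)) w.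

Let v_ge0 j : 0 <= v j. Proof. by rewrite mulr_ge0// ltW. Qed.
Let v_lt j : v j < v j.+1. Proof. by rewrite ltr_pM2l// ltr_nat. Qed.

Let clip_itv j x : v j <= clip j x <= v j.+1.
Proof.
rewrite /clip le_min le_max lexx orbT (ltW (v_lt j))/=.
by rewrite ge_min lexx orbT.
Qed.

Let clip_mono j x y : x <= y -> clip j x <= clip j y.
Proof.
move=> xy; rewrite /clip le_min ge_min ge_max le_max xy/= le_max lexx orbT/=.
by rewrite ge_min lexx orbT.
Qed.

Let clip_time_mono j l : (l < q)%N -> clip_time j l <= clip_time j l.+1.
Proof.
case: l => [|l] lq /=.
  by case/andP: (clip_itv j (sp_time S 0)).
rewrite lq; case: ifP => _.
  by apply: clip_mono; exact: sp_time_le.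
by case/andP: (clip_itv j (sp_time S l)).
Qed.

Let uE j l : (l <= q)%N -> u (j * q + l) = clip_time j l.
Proof.
rewrite leq_eqVlt => /orP[/eqP ->|lq].
  by rewrite /u -mulSnr mulnK// modnMl /= ltnn.
by rewrite /u divnMDl// divn_small// addn0 modnMDl modn_small.
Qed.

Let DE j l w : (l < q)%N -> D (j * q + l) w = clip_coef j l w - H (v j) w.
Proof. by move=> lq; rewrite /D divnMDl// divn_small// addn0 modnMDl modn_small. Qed.

Let u_mono k : u k <= u k.+1.
Proof.
rewrite (divn_eq k q) -addnS !uE ?ltn_pmod//; last exact/ltnW/ltn_pmod.
by apply: clip_time_mono; rewrite ltn_pmod.
Qed.

Let u_ge0 : 0 <= u 0.
Proof. by rewrite /u div0n mod0n; exact: (v_ge0 0). Qed.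

Let D_adapted k : sigma_rv (D k) `<=` F (u k).
Proof.
have uk0 : 0 <= u k by exact: grid_ge0.
have sG : sigma_algebra setT (F (u k)) by exact: filtration_sigma fF _ uk0.
have vu : v (k %/ q) <= u k.
  rewrite /u /clip_time; case: (k %% q)%N (ltn_pmod k (isT : 0 < q)%N) => // l ->.
  by case/andP: (clip_itv (k %/ q) (sp_time S l)).
apply/(sigma_rvP sG); apply: measurable_funB; last first.
  apply/(sigma_rvP sG) => A /aH HA.
  by apply: (filtration_mono fF _ vu) => //; exact: HA.
rewrite /clip_coef; move: (ltn_pmod k (isT : 0 < q)%N); case E : (k %% q)%N => [|l] lq.
  exact: measurable_cst.
have [/andP[_ slv]|_] := boolP ((l < L)%N && (sp_time S l < v (k %/ q).+1)); last exact: measurable_cst.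
apply/(sigma_rvP sG) => A /(sp_coef_measurable (s := S)) HA.
apply: (filtration_mono fF _ _ HA).
  by elim: l {E lq slv HA} => [|l IH]; [exact: sp_time0|exact: le_trans IH (sp_time_le S l)].
by rewrite /u /clip_time E lq /clip le_min le_max lexx/= ltW.
Qed.

Let W_clip j x w :
  W (clip j x) w = W (Num.min x (v j.+1)) w - W (Num.min x (v j)) w + W (v j) w.
Proof.
rewrite /clip; have [xv|vx] := leP x (v j).
  by rewrite !min_l ?subrr ?add0r// ltW// (le_lt_trans xv).
by rewrite subrK.
Qed.

Lemma clip_block_sum j w :
  \sum_(l < q) D (j * q + l) w * (W (u (j * q + l).+1) w - W (u (j * q + l)) w)
  = sp_integral W S (v j.+1) w - sp_integral W S (v j) w -
    H (v j) w * (W (v j.+1) w - W (v j) w).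
Proof.
transitivity (\sum_(l < q) (clip_coef j l w * (W (clip_time j l.+1) w - W (clip_time j l) w)
   - H (v j) w * (W (clip_time j l.+1) w - W (clip_time j l) w))).
  apply: eq_bigr => l _; rewrite DE// -addnS !uE//; last exact: ltnW.
  by rewrite mulrBl.
rewrite sumrB; congr (_ - _); last first.
  rewrite -mulr_sumr; congr (_ * _).
  rewrite -(big_mkord xpredT (fun l => W (clip_time j l.+1) w - W (clip_time j l) w)).
  by rewrite (telescope_sumr (fun l => W (clip_time j l) w))//= ltnn.
rewrite big_ord_recl/= mul0r add0r big_ord_recr/= ltnn/= mul0r addr0.
rewrite /sp_integral -sumrB; apply: eq_bigr => i _.
have iL : (i < L)%N by [].
rewrite iL/= !ltnS iL (ltnW iL)/= !W_clip.
(* If the coefficient was replaced by 0, both of its times are at least [v j.+1], and the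
   corresponding term of [sp_integral] does not change over the cell. *)
case: ifPn => [_|]; first by ring.
rewrite -leNgt => vs.
have vs1 : v j.+1 <= sp_time S i.+1 by exact: le_trans vs (sp_time_le _ _).
have vs0 : v j <= sp_time S i by rewrite (le_trans _ vs)// ltW.
have vs2 : v j <= sp_time S i.+1 by rewrite (le_trans _ vs1)// ltW.
by rewrite !min_r//; ring.
Qed.

Lemma clip_sum n w :
  \sum_(k < n * q) D k w * (W (u k.+1) w - W (u k) w) =
  sp_integral W S (v n) w - \sum_(j < n) H (v j) w * (W (v j.+1) w - W (v j) w).
Proof.
rewrite (sum_blocks _ _ (fun k => D k w * (W (u k.+1) w - W (u k) w))).
under eq_bigr do rewrite clip_block_sum.
rewrite sumrB; congr (_ - _).
rewrite -(big_mkord xpredT (fun j => sp_integral W S (v j.+1) w - sp_integral W S (v j) w)).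
rewrite (telescope_sumr (fun j => sp_integral W S (v j) w))//.
rewrite [X in _ - X](_ : _ = 0) ?subr0// /sp_integral big1// => i _.
have s0 l : 0 <= sp_time S l.
  by elim: l => [|l IH]; [exact: sp_time0|exact: le_trans IH (sp_time_le S l)].
by rewrite /v mulr0 !min_r// subrr mulr0.
Qed.

Let sp_time_mono i j : (i <= j)%N -> sp_time S i <= sp_time S j.
Proof.
apply: (@homo_leq _ (sp_time S) (fun x y => x <= y)) => // [y x z|k].
  exact: le_trans.
exact: sp_time_le.
Qed.

Let clip_lt j x s : v j < s -> s < clip j x -> s < x.
Proof. by move=> vs; rewrite lt_min lt_max (ltNge s (v j)) (ltW vs)/= orbF => /andP[]. Qed.

Let lt_clip j x s : s < v j.+1 -> clip j x < s -> x < s.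
Proof. by move=> vs; rewrite gt_min gt_max (ltNge (v j.+1) s) (ltW vs)/= orbF => /andP[]. Qed.

Let clip_time_itv j l : v j <= clip_time j l <= v j.+1.
Proof.
case: l => [|l] /=; first by rewrite lexx ltW.
case: ifP => _; first exact: clip_itv.
by rewrite lexx ltW.
Qed.

Let sp_eval_clip j l s w : (l < q)%N -> clip_time j l < s < clip_time j l.+1 ->
  sp_eval S s w = clip_coef j l w.
Proof.
move=> lq /andP[s1 s2].
have vs : v j < s by rewrite (le_lt_trans _ s1)//; case/andP: (clip_time_itv j l).
have sv : s < v j.+1 by rewrite (lt_le_trans s2)//; case/andP: (clip_time_itv j l.+1).
have out i : (s <= sp_time S i) || (sp_time S i.+1 < s) ->
    sp_coef S i w * \1_(`]sp_time S i, sp_time S i.+1] : set R) s = 0.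
  move=> si; rewrite indicE memNset ?mulr0//= in_itv/= => /andP[i1 i2].
  by move: si; rewrite leNgt i1/= ltNge i2.
case: l lq s1 s2 => [|l] lq s1 s2.
  rewrite /sp_eval big1// => i _; apply: out.
  have /clip_lt : s < clip j (sp_time S 0) by [].
  move=> /(_ vs)/ltW/le_trans ->//; exact: sp_time_mono.
have sl : sp_time S l < s by apply: lt_clip sv _; move: s1; rewrite /= lq.
have [lL|Ll] := ltnP l L; last first.
  rewrite /= ltnNge Ll/= /sp_eval big1// => i _; apply: out.
  by rewrite (le_lt_trans _ sl) ?orbT// sp_time_mono// (leq_trans _ Ll).
have sl1 : s < sp_time S l.+1.
  by apply: clip_lt vs _; move: s2; rewrite /= !ltnS lL.
rewrite /= lL (lt_trans sl sv)/= /sp_eval (bigD1 (Ordinal lL))//= big1 ?addr0.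
  by rewrite indicE mem_set ?mulr1//= in_itv/= sl ltW.
move=> i /eqP il; apply: out.
have [ilt|] := ltnP i l; first by rewrite (le_lt_trans _ sl) ?orbT// sp_time_mono.
rewrite leq_eqVlt => /orP[/eqP li|li]; first by case: il; apply/val_inj.
by rewrite (le_trans (ltW sl1))// sp_time_mono.
Qed.

Let cell_value k s w : u k < s < u k.+1 -> D k w = sp_eval S s w - H (gridl h s) w.
Proof.
have kq : (k %% q < q)%N by exact: ltn_pmod.
rewrite (divn_eq k q) -addnS !uE//; last exact: ltnW.
move=> us; rewrite DE// (sp_eval_clip w kq us); congr (_ - H _ _).
rewrite (gridl_eq (j := k %/ q))//.
move: us => /andP[s1 s2]; apply/andP; split.
  by rewrite (le_trans _ (ltW s1))//; case/andP: (clip_time_itv (k %/ q) (k %% q)).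
by rewrite (lt_le_trans s2)//; case/andP: (clip_time_itv (k %/ q) (k %% q).+1).
Qed.

Let measurable_sp_eval w : measurable_fun setT (fun s : R => sp_eval S s w).
Proof.
by apply: measurable_sum => i; apply: measurable_funM => //; exact: measurable_indic.
Qed.

Lemma clip_energy n w :
  ((\sum_(k < n * q) D k w ^+ 2 * (u k.+1 - u k))%:E <=
   \int[mu]_(s in `[0%R, (h * n%:R)%R]) ((sp_eval S s w - H (gridl h s) w) ^+ 2)%:E)%E.
Proof.
set f := (fun s : R => ((sp_eval S s w - H (gridl h s) w) ^+ 2)%:E).
have mf : measurable_fun setT f.
  apply/measurable_EFinP; apply: measurable_funX; apply: measurable_funB => //.
  exact: (measurable_grid_path (x := H^~ w) h0 (measurable_section mH w)).
have f0 s : (0 <= f s)%E by rewrite lee_fin sqr_ge0.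
have u00 : u 0%N = 0 by rewrite /u div0n mod0n /= /v mulr0.
have uN : u (n * q)%N = h * n%:R by rewrite -[(n * q)%N]addn0 uE.
have := sum_integral_cells (n * q) u_mono mf f0.
rewrite u00 uN; apply: le_trans; rewrite -sumEFin; apply: lee_sum => k _.
rewrite (eq_integral (cst (D k w ^+ 2)%:E)); last first.
  by move=> s; rewrite inE/= in_itv/= => /cell_value ->.
rewrite integral_cst// [X in (_ * X)%E]lebesgue_measure_itv/= lte_fin.
have := u_mono k; rewrite le_eqVlt => /orP[/eqP ->|->]; last by rewrite -EFinB -EFinM.
by rewrite ltxx subrr mulr0 mule0.
Qed.

Lemma riemann_simple_small n (delta e eta : R) : 0 < delta -> 0 < e ->
  holds_but P eta (fun w => (\int[mu]_(s in `[0%R, (h * n%:R)%R])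
    ((sp_eval S s w - H (gridl h s) w) ^+ 2)%:E <= delta%:E)%E) ->
  holds_but P (eta + delta / e ^+ 2) (fun w =>
    `|sp_integral W S (h * n%:R) w -
      \sum_(j < n) H (h * j%:R) w * (W (h * j.+1%:R) w - W (h * j%:R) w)| <= e).
Proof.
move=> delta0 e0 small.
have := brownian_transform_small fF bW aW iW u_ge0 u_mono delta0 e0 D_adapted (N := n * q) (eta := eta).
move=> HT; apply: holds_but_le (HT _) => //.
  by move=> w; rewrite clip_sum.
apply: holds_but_le small => // w H1; rewrite -lee_fin.
exact: le_trans (clip_energy n w) H1.
Qed.

End clip_grid.

(** * Riemann sums converge to the Itô integral *)

Section ito_riemann.
Context d (T : measurableType d) (R : realType) (P : probability T R).
Variables (F : R -> set (set T)) (W : R -> {RV P >-> R}).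
Hypotheses (fF : filtration F) (bW : brownian_motion W)
  (aW : adapted F (fun t => W t : T -> R))
  (iW : forall s t, 0 <= s -> s <= t ->
    independent P (sigma_rv (fun w => W t w - W s w)) (F s)).
Variable H : R -> T -> R.
Hypotheses (cH : forall w, cadlag (H^~ w)).
Local Notation mu := lebesgue_measure.

Lemma measurable_nonneg_time :
  measurable_fun [set z : R * T | 0 <= z.1] (fun z => H z.1 z.2) ->
  measurable_fun setT (fun z : R * T => H (Num.max z.1 0) z.2).
Proof.
move=> mH.
have mp : measurable_fun setT (fun z : R * T => (Num.max z.1 0, z.2)).
  by apply: measurable_fun_pair => //; exact: measurable_maxr.
have mD : measurable [set z : R * T | 0 <= z.1] by exact: measurable_le_set.
apply: (measurable_comp mD _ mH mp) => z [y _ <-] /=.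
by rewrite le_max lexx orbT.
Qed.

Lemma measurable_simple_error (S : simple_process F) (t : R) :
  measurable_fun setT (fun z : R * T => H (Num.max z.1 0) z.2) ->
  measurable_fun setT (fun w =>
    (\int[mu]_(s in `[0%R, t]) ((sp_eval S s w - H s w) ^+ 2)%:E)%E).
Proof.
move=> mH.
have s0 i : 0 <= sp_time S i.
  by elim: i => [|i IH]; [exact: sp_time0|exact: le_trans IH (sp_time_le S i)].
have mc i : measurable_fun setT (sp_coef S i).
  apply: (sigma_rv_measurable _ (sp_coef_measurable (s := S) (i := i))).
  exact: filtration_sub fF _ (s0 i).
have mf : measurable_fun setT (fun z : R * T =>
    ((sp_eval S z.1 z.2 - H (Num.max z.1 0) z.2) ^+ 2)%:E).
  apply/measurable_EFinP; apply: measurable_funX; apply: measurable_funB => //.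
  apply: measurable_sum => i; apply: measurable_funM.
    exact: (measurableT_comp (mc i)).
  exact: (measurableT_comp (measurable_indic _)).
have := measurable_time_integral t mf.
have f0 : forall z : R * T, (0 <= ((sp_eval S z.1 z.2 - H (Num.max z.1 0) z.2) ^+ 2)%:E)%E.
  by move=> z; rewrite lee_fin sqr_ge0.
move=> /(_ f0); congr measurable_fun; apply/funext => w.
apply: eq_integral => s; rewrite inE/= in_itv/= => /andP[sge0 _].
by rewrite max_l.
Qed.

(** The integral of a good simple process is the intermediate term: it is close to [Y] by definition
    and to the Riemann sum by the energy estimate. The simple process plays no part in the choice of
    N, which comes from the grid energy alone. *)
Lemma ito_riemann (t : R) (Y : {RV P >-> R}) (e eta : R) :
  is_ito_integral F W H t Y -> 0 < t -> 0 < e -> 0 < eta ->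
  exists N, forall n, (N <= n)%N -> holds_but P eta (fun w =>
    `|Y w - \sum_(j < n.+1) H (t / n.+1%:R * j%:R) w *
       (W (t / n.+1%:R * j.+1%:R) w - W (t / n.+1%:R * j%:R) w)| <= e).
Proof.
move=> [[/measurable_nonneg_time mH aH _] [S [S_H S_Y]]] t0 e0 eta0.
(* The Chebyshev term delta / (e/2)^2 is then eta/4. The energy [delta] is split by (x + y)^2 <= 2
   x^2 + 2 y^2 into two parts, each of energy delta/4. *)
pose delta := eta / 4 * (e / 2) ^+ 2.
have e2 : 0 < e / 2 by rewrite divr_gt0.
have eta4 : 0 < eta / 4 by rewrite divr_gt0.
have delta0 : 0 < delta by rewrite mulr_gt0// exprn_gt0.
have delta4 : 0 < delta / 4 by rewrite divr_gt0.
have [N HN] := grid_energy_small mH P cH t0 delta4 eta4.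
exists N => n Nn.
have {}HN := HN n Nn.
have tn : 0 < t / n.+1%:R by rewrite divr_gt0.
have [m [Hm1 Hm2]] : exists m,
  (P [set w | ((delta / 4)%:E < \int[mu]_(s in `[0%R, t])
      ((sp_eval (S m) s w - H s w) ^+ 2)%:E)%E] <= (eta / 4)%:E)%E /\
  (P [set w | (e / 2 < `|sp_integral W (S m) t w - Y w|)%R] <= (eta / 4)%:E)%E.
  have [m1 _ K1] := cvg0_le eta4 (S_H _ delta4).
  have [m2 _ K2] := cvg0_le eta4 (S_Y _ e2).
  exists (maxn m1 m2); split; [apply: K1|apply: K2].
    exact: leq_maxl.
  exact: leq_maxr.
have mI : measurable_fun setT (sp_integral W (S m) t).
  apply: measurable_sum => i; apply: measurable_funM.
    have s0 : 0 <= sp_time (S m) i.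
      elim: (i : nat) => [|k IH]; [exact: sp_time0|exact: le_trans IH (sp_time_le (S m) k)].
    apply: (sigma_rv_measurable _ (sp_coef_measurable (s := S m) (i := i))).
    exact: filtration_sub fF _ s0.
  by apply: measurable_funB.
have small1 : holds_but P (eta / 4) (fun w => (\int[mu]_(s in `[0%R, t])
      ((sp_eval (S m) s w - H s w) ^+ 2)%:E <= (delta / 4)%:E)%E).
  exists [set w | ((delta / 4)%:E < \int[mu]_(s in `[0%R, t])
      ((sp_eval (S m) s w - H s w) ^+ 2)%:E)%E]; split => //.
    rewrite -[X in measurable X]setTI; apply: emeasurable_fun_o_infty => //.
    exact: measurable_simple_error.
  by move=> w /negP; rewrite -leNgt.
have small2 : holds_but P (eta / 4) (fun w => `|sp_integral W (S m) t w - Y w| <= e / 2).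
  exists [set w | e / 2 < `|sp_integral W (S m) t w - Y w|]; split => //.
    rewrite (_ : [set w | _] = ~` [set w | `|sp_integral W (S m) t w - Y w| <= e / 2]).
      apply: measurableC; apply: measurable_le_set => //.
      by apply: measurableT_comp => //; exact: measurable_funB.
    by apply/seteqP; split => w /=; rewrite ltNge => /negP.
  by move=> w /negP; rewrite -leNgt.
have tE : t / n.+1%:R * n.+1%:R = t by rewrite divfK.
have energy : holds_but P (eta / 4 + eta / 4) (fun w =>
    (\int[mu]_(s in `[0%R, (t / n.+1%:R * n.+1%:R)%R])
    ((sp_eval (S m) s w - H (gridl (t / n.+1%:R) s) w) ^+ 2)%:E <= delta%:E)%E).
  apply: holds_but_le (holds_but_and HN small1) => // w [H1 H2].
  rewrite tE.
  have ms := measurable_section mH w.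
  have mg := measurable_grid_path (x := H^~ w) tn ms.
  have mse : measurable_fun setT (fun s : R => sp_eval (S m) s w).
    by apply: measurable_sum => i; apply: measurable_funM => //; exact: measurable_indic.
  have mA : measurable_fun (`[0, t] : set R) (fun s => ((sp_eval (S m) s w - H s w) ^+ 2)%:E).
    apply: (eq_measurable_fun (fun s : R => ((sp_eval (S m) s w - H (Num.max s 0) w) ^+ 2)%:E)).
      by move=> s; rewrite inE/= in_itv/= => /andP[s0 _]; rewrite max_l.
    apply: measurable_funTS; apply/measurable_EFinP; apply: measurable_funX.
    exact: measurable_funB.
  have mB : measurable_fun (`[0, t] : set R) (fun s => ((H s w - H (gridl (t / n.+1%:R) s) w) ^+ 2)%:E).
    exact: (measurable_grid_energy (x := H^~ w)).
  apply: (@le_trans _ _ (\int[mu]_(s in `[0%R, t]) (2%:E * ((sp_eval (S m) s w - H s w) ^+ 2)%:E +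
     2%:E * ((H s w - H (gridl (t / n.+1%:R) s) w) ^+ 2)%:E))%E).
    apply: ge0_le_integral => //.
    - by move=> s _; rewrite lee_fin sqr_ge0.
    - apply: measurable_funTS; apply/measurable_EFinP; apply: measurable_funX.
      exact: measurable_funB.
    - by apply: emeasurable_funD; exact: measurable_funeM.
    - move=> s _; rewrite -!EFinM -EFinD lee_fin.
      set x := sp_eval _ _ _; set y := H s w; set z := H _ w.
      have := sqr_ge0 ((x - y) - (y - z)); nra.
  rewrite ge0_integralD//; last 4 first.
  - by move=> s _; rewrite mule_ge0// lee_fin ?sqr_ge0.
  - exact: measurable_funeM.
  - by move=> s _; rewrite mule_ge0// lee_fin ?sqr_ge0.
  - exact: measurable_funeM.
  rewrite !ge0_integralZl//; last 2 first.
  - by move=> s _; rewrite lee_fin ?sqr_ge0.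
  - by move=> s _; rewrite lee_fin ?sqr_ge0.
  rewrite (_ : delta = 2 * (delta / 4) + 2 * (delta / 4)); last by field.
  rewrite [leRHS]EFinD !EFinM leeD// lee_wpmul2l//.
have := riemann_simple_small fF bW aW iW aH mH tn delta0 e2 energy.
rewrite tE => HR.
apply: holds_but_le (holds_but_and small2 HR).
  rewrite /delta mulfK ?gt_eqF ?exprn_gt0//.
  by lra.
move=> w [H1 H2].
set Q := sp_integral W (S m) t w in H1 H2.
rewrite -(subrK Q (Y w)) -addrA (le_trans (ler_normD _ _))// [leRHS]splitr lerD//.
by rewrite distrC.
Qed.
End ito_riemann.

(** * The logarithm of the risk process *)

Section log_estimate.
Context (R : realType).

(** The right side minus the left has derivative x^3 / (1 + x), of the sign of x, so its minimum is
    its value 0 at the origin. *)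
Lemma ln1D_le (y : R) : -1 < y -> ln (1 + y) <= y - y ^+ 2 / 2 + y ^+ 3 / 3.
Proof.
move=> y1.
pose f (x : R) := x - x ^+ 2 / 2 + x ^+ 3 / 3 - ln (1 + x).
have df (x : R) : -1 < x -> is_derive x 1 f (x ^+ 3 / (1 + x)).
  move=> x1; have x0 : 0 < 1 + x by lra.
  have dl : is_derive x 1 (fun z : R => ln (1 + z)) (1 + x)^-1.
    have := is_derive1_comp (is_derive1_ln x0) (is_deriveD (is_derive_cst (1:R) x 1) (is_derive_id x 1)).
    by rewrite add0r mulr1.
  apply: is_derive_eq.
  rewrite /GRing.scale/=; field; lra.
have f0 : f 0 = 0 by rewrite /f addr0 ln1 !expr0n/= !mul0r subrr addr0 subr0.
have cf (a b : R) : -1 < a -> {within `[a, b], continuous f}.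
  move=> a1; apply: derivable_within_continuous => x; rewrite in_itv/= => /andP[ax _].
  by have [] := df x (lt_le_trans a1 ax).
suff : 0 <= f y by rewrite /f subr_ge0.
have m1 : -1 < 0 :> R by lra.
have [y0|y0] := leP 0 y.
  have [|c] := @MVT_segment R f (fun x => x ^+ 3 / (1 + x)) 0 y y0 _ (cf 0 y m1).
    by move=> x; rewrite in_itv/= => /andP[x0 _]; apply: df; lra.
  rewrite in_itv/= => /andP[c0 _]; rewrite f0 !subr0 => ->.
  by rewrite mulr_ge0// divr_ge0 ?exprn_ge0//; lra.
have [|c] := @MVT_segment R f (fun x => x ^+ 3 / (1 + x)) y 0 (ltW y0) _ (cf y 0 y1).
  by move=> x; rewrite in_itv/= => /andP[x0 _]; apply: df; lra.
rewrite in_itv/= => /andP[yc c0]; rewrite f0 => E.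
have E2 : f y = c ^+ 3 / (1 + c) * y by lra.
rewrite E2 -[X in 0 <= X]opprK oppr_ge0 -mulrN -oppr_ge0 -mulNr mulr_ge0//; last lra.
rewrite -mulNr divr_ge0//; last lra.
by rewrite oppr_ge0 exprS mulr_le0_ge0// sqr_ge0.
Qed.
(** [p] stands for the Brownian part and [q] for the remainder. The coefficient of -p^2 must stay
    near 1/2, since it yields the term -sigma^2/2; the cross term is absorbed by Young's inequality,
    at the price of a large factor on the negligible q^2. *)
Lemma ln1D_split_le (p q theta : R) : 0 < theta <= 1 / 2 ->
  `|p + q| <= theta -> -1 < p + q ->
  ln (1 + (p + q)) <= p + q - (1 / 2 - theta) * p ^+ 2 + theta^-1 * (q ^+ 2 / 2).
Proof.
move=> /andP[t0 t2] py y1; rewrite (le_trans (ln1D_le y1))//.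
set y := p + q in py y1 *.
have cube : y ^+ 3 <= theta * y ^+ 2.
  rewrite exprS ler_wpM2r ?sqr_ge0//.
  by rewrite (le_trans (ler_norm _)).
have cross : (1 - theta) * p ^+ 2 - (theta^-1 - 1) * q ^+ 2 <= y ^+ 2.
  have : 0 <= theta^-1 * (theta * p + q) ^+ 2.
    by rewrite mulr_ge0 ?sqr_ge0// invr_ge0 ltW.
  have -> : theta^-1 * (theta * p + q) ^+ 2 =
      theta * p ^+ 2 + 2 * p * q + theta^-1 * q ^+ 2.
    by field; rewrite gt_eqF.
  by rewrite /y; nra.
(* What is left of the coefficient 1/2 of -y^2 after y^3 / 3 is bounded by theta y^2 / 3. *)
set b := 1 / 2 - theta / 3.
have b0 : 0 <= b by rewrite /b; lra.
have b2 : b <= 1 / 2 by rewrite /b; lra.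
have H1 : b * ((1 - theta) * p ^+ 2 - (theta^-1 - 1) * q ^+ 2) <= b * y ^+ 2.
  by rewrite ler_wpM2l.
have H2 : (1 / 2 - theta) * p ^+ 2 <= b * ((1 - theta) * p ^+ 2).
  rewrite [leRHS]mulrA ler_wpM2r ?sqr_ge0// /b; nra.
have H3 : b * ((theta^-1 - 1) * q ^+ 2) <= theta^-1 * (q ^+ 2 / 2).
  have ti : 1 <= theta^-1 by rewrite -[leLHS]invr1 lef_pV2 ?posrE//; lra.
  have : 0 <= q ^+ 2 by exact: sqr_ge0.
  move: ti; set Q := q ^+ 2; set ti := theta^-1 => ti1 Q0.
  have Z0 : 0 <= (ti - 1) * Q by rewrite mulr_ge0// subr_ge0.
  have : b * ((ti - 1) * Q) <= 1 / 2 * ((ti - 1) * Q) by rewrite ler_wpM2r.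
  by nra.
rewrite mulrBr in H1.
have H4 : - (y ^+ 2 / 2) + y ^+ 3 / 3 <= - (b * y ^+ 2) by rewrite /b; lra.
lra.
Qed.

(** A deterministic statement for one path. Only upper bounds on the steps are needed, so claims may
    be dropped, and the quadratic variation, which enters with a negative sign, is needed only from
    below. *)
Lemma log_path_le (n : nat) (x dw eps : nat -> R)
    (a sigma h ustar theta e1 e2 e3 : R) :
  0 < theta <= 1 / 2 -> 0 < ustar ->
  (forall i, (i <= n)%N -> ustar <= x i) ->
  (forall i, (i < n)%N -> x i.+1 <= x i * (1 + (sigma * dw i + (a * h + eps i)))) ->
  (forall i, (i < n)%N ->
    3 * (a ^+ 2 * h ^+ 2 + sigma ^+ 2 * dw i ^+ 2 + eps i ^+ 2) <= theta ^+ 2) ->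
  \sum_(i < n) eps i <= e1 -> \sum_(i < n) eps i ^+ 2 <= e2 ->
  h * n%:R - e3 <= \sum_(i < n) dw i ^+ 2 ->
  ln (x n) <= ln (x 0%N) + a * (h * n%:R) + sigma * \sum_(i < n) dw i + e1
    - (1 / 2 - theta) * sigma ^+ 2 * (h * n%:R - e3)
    + theta^-1 * (a ^+ 2 * h ^+ 2 * n%:R + e2).
Proof.
move=> tt us0 xge step small E1 E2 E3.
have /andP[t0 t2] := tt.
have x0 i : (i <= n)%N -> 0 < x i by move=> /xge; exact: lt_le_trans.
have stepln i : (i < n)%N -> ln (x i.+1) - ln (x i) <=
    sigma * dw i + (a * h + eps i) - (1 / 2 - theta) * (sigma * dw i) ^+ 2
    + theta^-1 * (a ^+ 2 * h ^+ 2 + eps i ^+ 2).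
  move=> ni; have xi := x0 i (ltnW ni); have xi1 := x0 i.+1 ni.
  set y := sigma * dw i + (a * h + eps i).
  (* The argument of the logarithm is positive because the path survives at the next grid time. *)
  have y1 : -1 < y.
    have : 0 < x i * (1 + y) by rewrite (lt_le_trans xi1)// step.
    by rewrite pmulr_rgt0//; lra.
  have ynorm : `|y| <= theta.
    have : y ^+ 2 <= theta ^+ 2.
      apply: le_trans (small i ni); rewrite /y.
      have := sqr_ge0 (sigma * dw i - a * h).
      have := sqr_ge0 (sigma * dw i - eps i).
      have := sqr_ge0 (a * h - eps i).
      by nra.
    by rewrite -(real_normK (num_real y)) ler_pXn2r// nnegrE ltW.
  have H1 : ln (x i.+1) <= ln (x i) + ln (1 + y).
    rewrite -lnM ?posrE//; last lra.
    by rewrite ler_ln ?posrE ?step// mulr_gt0//; lra.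
  have H2 := ln1D_split_le tt ynorm y1.
  have H3 : theta^-1 * ((a * h + eps i) ^+ 2 / 2) <=
      theta^-1 * (a ^+ 2 * h ^+ 2 + eps i ^+ 2).
    rewrite ler_wpM2l ?invr_ge0 ?(ltW t0)//.
    by have := sqr_ge0 (a * h - eps i); nra.
  by rewrite lerBlDl; apply: (le_trans H1); rewrite lerD2l; apply: (le_trans H2); rewrite lerD2l.
have tele : ln (x n) - ln (x 0%N) = \sum_(i < n) (ln (x i.+1) - ln (x i)).
  rewrite -(big_mkord xpredT (fun i => ln (x i.+1) - ln (x i))).
  by rewrite (telescope_sumr (fun i => ln (x i))).
have : ln (x n) - ln (x 0%N) <= \sum_(i < n) (sigma * dw i + (a * h + eps i)
    - (1 / 2 - theta) * (sigma * dw i) ^+ 2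
    + theta^-1 * (a ^+ 2 * h ^+ 2 + eps i ^+ 2)).
  by rewrite tele; apply: ler_sum => i _; exact: stepln.
have -> : \sum_(i < n) (sigma * dw i + (a * h + eps i)
    - (1 / 2 - theta) * (sigma * dw i) ^+ 2
    + theta^-1 * (a ^+ 2 * h ^+ 2 + eps i ^+ 2)) =
  sigma * (\sum_(i < n) dw i) + (a * h * n%:R + \sum_(i < n) eps i)
   - (1 / 2 - theta) * sigma ^+ 2 * (\sum_(i < n) dw i ^+ 2)
   + theta^-1 * (a ^+ 2 * h ^+ 2 * n%:R + \sum_(i < n) eps i ^+ 2).
  clear; elim: n => [|n IH]; first by rewrite !big_ord0; ring.
  by rewrite !big_ord_recr/= IH -natr1; ring.
set s1 := \sum_(i < n) dw i in E1 E2 E3 *.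
set s2 := \sum_(i < n) dw i ^+ 2 in E1 E2 E3 *.
set s3 := \sum_(i < n) eps i in E1 E2 E3 *.
set s4 := \sum_(i < n) eps i ^+ 2 in E1 E2 E3 *.
have K1 : (1 / 2 - theta) * sigma ^+ 2 * (h * n%:R - e3) <=
    (1 / 2 - theta) * sigma ^+ 2 * s2.
  by rewrite ler_wpM2l// mulr_ge0 ?sqr_ge0// subr_ge0.
have K2 : theta^-1 * (a ^+ 2 * h ^+ 2 * n%:R + s4) <=
    theta^-1 * (a ^+ 2 * h ^+ 2 * n%:R + e2).
  by rewrite ler_wpM2l ?invr_ge0 ?(ltW t0)// lerD2l.
lra.
Qed.
End log_estimate.

(** * Freezing the Itô integrand on a grid *)

Section ito_errors.
Context d (T : measurableType d) (R : realType) (P : probability T R).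
Variables (F : R -> set (set T)) (W : R -> {RV P >-> R}).
Hypotheses (fF : filtration F) (bW : brownian_motion W)
  (aW : adapted F (fun t => W t : T -> R))
  (iW : forall s t, 0 <= s -> s <= t ->
    independent P (sigma_rv (fun w => W t w - W s w)) (F s)).
Variables (X : R -> T -> R) (sigma ustar : R) (I : R -> {RV P >-> R}).
Hypotheses (aX : adapted F X) (cX : forall w, cadlag (X^~ w))
  (mX : measurable_fun setT (fun z : R * T => X (Num.max z.1 0) z.2))
  (sigma0 : 0 < sigma) (ustar0 : 0 < ustar)
  (hI : forall t, 0 <= t -> is_ito_integral F W (fun s w => sigma * X s w) t (I t)).
Local Notation mu := lebesgue_measure.

Lemma cadlagZ w : cadlag (fun s => sigma * X s w).
Proof.
have [xr xl] := cX w; split => t t0.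
  by apply: cvgMr; exact: xr.
by apply: is_cvgMr; exact: xl.
Qed.

(** [I 0] is determined only as a limit in probability; the approximating integrals over an empty
    interval all vanish. *)
Lemma ito_integral0 (e eta : R) : 0 < e -> 0 < eta ->
  holds_but P eta (fun w => `|I 0 w| <= e).
Proof.
move=> e0 eta0.
have [_ [S [_ S_I]]] := hI (lexx 0).
have s0 n i : 0 <= sp_time (S n) i.
  by elim: i => [|i IH]; [exact: sp_time0|exact: le_trans IH (sp_time_le (S n) i)].
have z n w : sp_integral W (S n) 0 w = 0.
  by rewrite /sp_integral big1// => i _; rewrite !min_r// subrr mulr0.
have [m _ /(_ m (leqnn m)) Hm] := cvg0_le eta0 (S_I _ e0).
exists [set w | e < `|I 0 w|]; split => //.
- rewrite (_ : [set w | _] = ~` [set w | `|I 0 w| <= e]).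
    by apply: measurableC; apply: measurable_le_set => //; exact: measurableT_comp.
  by apply/seteqP; split => w /=; rewrite ltNge => /negP.
- apply: le_trans Hm; rewrite le_eqVlt; apply/orP; left; apply/eqP; congr (P _).
  by apply/seteqP; split => w /=; rewrite z sub0r normrN.
- by move=> w /negP; rewrite -leNgt.
Qed.

Lemma sum_block_pred (n q : nat) (f : nat -> R) i : (0 < q)%N -> (i < n)%N ->
  \sum_(k < n * q | (k %/ q)%N == i) f k = \sum_(l < q) f (i * q + l)%N.
Proof.
move=> q0 ni; rewrite big_mkcond/=.
rewrite (sum_blocks n q (fun k => if (k %/ q)%N == i then f k else 0)).
rewrite (bigD1 (Ordinal ni))//= [X in _ + X]big1 ?addr0 => [|j ji].
  by apply: eq_bigr => l _; rewrite divnMDl// divn_small// addn0 eqxx.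
apply: big1 => l _; rewrite divnMDl// divn_small// addn0 ifF//.
apply/negbTE; apply: contra ji => /eqP ji; exact/eqP/val_inj.
Qed.

(** * A fine grid of mesh [ka] inside the coarse grid of mesh [h] *)

Section nested_grids.
Variables (tau : R) (n m : nat).
Hypothesis tau0 : 0 < tau.
Let h := tau / n.+1%:R.
Let ka := h / m.+1%:R.
Let N := (n.+1 * m.+1)%N.

Let h0 : 0 < h. Proof. by rewrite divr_gt0. Qed.
Let ka0 : 0 < ka. Proof. by rewrite divr_gt0. Qed.

Let kaE i : ka * (i * m.+1)%:R = h * i%:R.
Proof. by rewrite natrM [(_ * m.+1%:R)]mulrC mulrA /ka divfK ?pnatr_eq0. Qed.

Let hN : h * n.+1%:R = tau.
Proof. by rewrite /h divfK ?pnatr_eq0. Qed.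

Let kaN : ka * N%:R = tau.
Proof. by rewrite kaE hN. Qed.

Let u k := ka * k%:R.

Let u_ge0 : 0 <= u 0%N. Proof. by rewrite /u mulr0. Qed.

Let u_step k : u k.+1 - u k = ka.
Proof. by rewrite /u -natr1 mulrDr mulr1 addrC addKr. Qed.

Let u_mono k : u k <= u k.+1.
Proof. by rewrite -subr_ge0 u_step ltW. Qed.

Let coarse k : h * (k %/ m.+1)%:R <= u k.
Proof. by rewrite -kaE ler_pM2l// ler_nat leq_trunc_div. Qed.

(** Both grid values are constant on a fine cell, and are compared there through the path itself by
    (y - z)^2 <= 2 (x - y)^2 + 2 (x - z)^2. *)
Lemma nested_energy w :
  ((\sum_(k < N) (X (u k) w - X (h * (k %/ m.+1)%:R) w) ^+ 2 * ka)%:E <=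
   2%:E * grid_energy (X^~ w) tau ka + 2%:E * grid_energy (X^~ w) tau h)%E.
Proof.
have ms := measurable_section mX w.
have mh := measurable_grid_path (x := X^~ w) h0 ms.
have mka := measurable_grid_path (x := X^~ w) ka0 ms.
pose f (s : R) := ((X (gridl ka s) w - X (gridl h s) w) ^+ 2)%:E.
have mf : measurable_fun setT f.
  by apply/measurable_EFinP; apply: measurable_funX; exact: measurable_funB.
have f0 s : (0 <= f s)%E by rewrite lee_fin sqr_ge0.
have m1 := measurable_grid_energy (x := X^~ w) (t := tau) ka0 ms.
have m2 := measurable_grid_energy (x := X^~ w) (t := tau) h0 ms.
apply: (@le_trans _ _ (\int[mu]_(s in `[u 0%N, u N]) f s)%E).
  apply: le_trans (sum_integral_cells N u_mono mf f0).
  rewrite -sumEFin; apply: lee_sum => k _.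
  set c := (X (u k) w - X (h * (k %/ m.+1)%:R) w) ^+ 2.
  rewrite (eq_integral (cst c%:E)); last first.
    move=> s; rewrite inE/= in_itv/= => /andP[s1 s2].
    rewrite /f (gridl_eq (j := k) ka0) ?(ltW s1)//.
    rewrite (gridl_eq (j := (k %/ m.+1)%N) h0)//.
    rewrite (le_trans (coarse k) (ltW s1))/= (lt_le_trans s2)//.
    by rewrite -kaE /u ler_pM2l// ler_nat ltn_ceil.
  rewrite integral_cst// [X in (_ * X)%E]lebesgue_measure_itv/= lte_fin.
  by rewrite -subr_gt0 u_step ka0 -EFinB u_step.
rewrite {1}/u mulr0 /u kaN.
apply: (@le_trans _ _ (\int[mu]_(s in `[0%R, tau])
  (2%:E * ((X s w - X (gridl ka s) w) ^+ 2)%:E +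
   2%:E * ((X s w - X (gridl h s) w) ^+ 2)%:E))%E).
  apply: ge0_le_integral => //.
  - exact: measurable_funTS.
  - by apply: emeasurable_funD; exact: measurable_funeM.
  - move=> s _; rewrite -!EFinM -EFinD lee_fin.
    set x := X s w; set y := X _ w; set z := X _ w.
    by have := sqr_ge0 ((x - y) + (x - z)); nra.
rewrite ge0_integralD//; last 4 first.
- by move=> s _; rewrite mule_ge0// lee_fin ?sqr_ge0.
- exact: measurable_funeM.
- by move=> s _; rewrite mule_ge0// lee_fin ?sqr_ge0.
- exact: measurable_funeM.
rewrite !ge0_integralZl//.
- by move=> s _; rewrite lee_fin ?sqr_ge0.
- by move=> s _; rewrite lee_fin ?sqr_ge0.
Qed.

(* 1 / X t w on survival above ustar; the maximum keeps it bounded elsewhere. *)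
Definition weight (t : R) (w : T) : R := (Num.max (X t w) ustar)^-1.

Lemma weight_ge0 t w : 0 <= weight t w.
Proof. by rewrite invr_ge0 le_max (ltW ustar0) orbT. Qed.

Lemma weight_le t w : weight t w <= ustar^-1.
Proof. by rewrite lef_pV2 ?posrE ?lt_max ?ustar0 ?orbT// le_max lexx orbT. Qed.

Lemma weight_adapted t : 0 <= t -> sigma_rv (weight t) `<=` F t.
Proof.
move=> t0; have sG : sigma_algebra setT (F t) by exact: filtration_sigma fF _ t0.
apply/(sigma_rvP sG).
have mw : measurable_fun setT (fun x : R => (Num.max x ustar)^-1).
  apply: nonincreasing_measurable => // x y xy.
  rewrite lef_pV2 ?posrE ?lt_max ?ustar0 ?orbT//.
  by rewrite ge_max !le_max xy lexx orbT.
by apply: (measurableT_comp mw); apply/(sigma_rvP sG); exact: aX.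
Qed.

(** Summed against [dW] over a coarse cell, this is the weighted difference between the fine Riemann
    sum and the increment frozen at the left end. The weight is known at that end, so it can be
    moved inside the transform. *)
Let D k w := weight (h * (k %/ m.+1)%:R) w * (sigma * (X (u k) w - X (h * (k %/ m.+1)%:R) w)).
Let dW k w := W (u k.+1) w - W (u k) w.

Let D_adapted k : sigma_rv (D k) `<=` F (u k).
Proof.
have uk0 : 0 <= u k by rewrite /u mulr_ge0// ltW.
have c0 : 0 <= h * (k %/ m.+1)%:R by rewrite mulr_ge0// ltW.
have sG : sigma_algebra setT (F (u k)) by exact: filtration_sigma fF _ uk0.
have mono A : F (h * (k %/ m.+1)%:R) A -> F (u k) A.
  by apply: filtration_mono fF _ _ c0 _ _; exact: coarse.
apply/(sigma_rvP sG); apply: measurable_funM.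
  by apply/(sigma_rvP sG) => A /(weight_adapted c0); exact: mono.
apply: measurable_funM => //; apply: measurable_funB.
  by apply/(sigma_rvP sG); exact: aX.
by apply/(sigma_rvP sG) => A /(aX c0); exact: mono.
Qed.

Let D_energy w (eps : R) : 0 <= eps ->
  (grid_energy (X^~ w) tau ka <= eps%:E)%E ->
  (grid_energy (X^~ w) tau h <= eps%:E)%E ->
  \sum_(k < N) D k w ^+ 2 * (u k.+1 - u k) <= 4 * (sigma / ustar) ^+ 2 * eps.
Proof.
move=> eps0 E1 E2.
have : \sum_(k < N) (X (u k) w - X (h * (k %/ m.+1)%:R) w) ^+ 2 * ka <= 4 * eps.
  rewrite -lee_fin (le_trans (nested_energy w))//.
  rewrite (_ : 4 * eps = 2 * eps + 2 * eps); last by ring.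
  by rewrite [leRHS]EFinD [in leRHS]EFinM leeD// lee_wpmul2l.
move=> E; apply: (@le_trans _ _ ((sigma / ustar) ^+ 2 *
    \sum_(k < N) (X (u k) w - X (h * (k %/ m.+1)%:R) w) ^+ 2 * ka)); last first.
  by rewrite -mulrA mulrCA ler_wpM2l ?sqr_ge0.
rewrite mulr_sumr; apply: ler_sum => k _; rewrite u_step /D.
have := weight_ge0 (h * (k %/ m.+1)%:R) w.
have := weight_le (h * (k %/ m.+1)%:R) w.
set wt := weight _ _; set x := (_ - _) => wt1 wt0.
have -> : (wt * (sigma * x)) ^+ 2 * ka = wt ^+ 2 * ((sigma * x) ^+ 2 * ka) by ring.
have -> : (sigma / ustar) ^+ 2 * (x ^+ 2 * ka) = ustar^-1 ^+ 2 * ((sigma * x) ^+ 2 * ka).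
  by ring.
have q0 : 0 <= (sigma * x) ^+ 2 * ka by exact: mulr_ge0 (sqr_ge0 _) (ltW ka0).
by rewrite ler_wpM2r// lerXn2r ?nnegrE// invr_ge0 ltW.
Qed.

Let partial i w := \sum_(k < i * m.+1) sigma * X (u k) w * dW k w.

Let block_sum i w : \sum_(l < m.+1) D (i * m.+1 + l)%N w * dW (i * m.+1 + l)%N w =
  weight (h * i%:R) w * (partial i.+1 w - partial i w -
    sigma * X (h * i%:R) w * (W (h * i.+1%:R) w - W (h * i%:R) w)).
Proof.
have -> : partial i.+1 w - partial i w =
    \sum_(l < m.+1) sigma * X (u (i * m.+1 + l)%N) w * dW (i * m.+1 + l)%N w.
  rewrite /partial !(sum_blocks _ _ (fun k => sigma * X (u k) w * dW k w)).
  by rewrite [X in X - _]big_ord_recr/= addrAC subrr add0r.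
have -> : W (h * i.+1%:R) w - W (h * i%:R) w = \sum_(l < m.+1) dW (i * m.+1 + l)%N w.
  rewrite /dW -(big_mkord xpredT (fun l => W (u (i * m.+1 + l).+1) w - W (u (i * m.+1 + l)%N) w)).
  under eq_bigr do rewrite -addnS.
  rewrite (telescope_sumr (fun l => W (u (i * m.+1 + l)%N) w))//.
  by rewrite addn0 -mulSnr /u !kaE.
rewrite mulr_sumr -sumrB mulr_sumr; apply: eq_bigr => l _.
rewrite /D divnMDl// divn_small// addn0; ring.
Qed.

(** One transform gives both bounds: the sum of all terms, and the squares of its blocks over coarse
    cells. Each application uses the two energy bounds, hence the factor 4 on [eta]. *)
Lemma nested_martingale_small (eta e eps delta : R) :
  0 < e -> 0 < delta -> 0 <= eps -> 4 * (sigma / ustar) ^+ 2 * eps <= delta ->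
  holds_but P eta (fun w => (grid_energy (X^~ w) tau ka <= eps%:E)%E) ->
  holds_but P eta (fun w => (grid_energy (X^~ w) tau h <= eps%:E)%E) ->
  holds_but P (eta *+ 4 + delta / e ^+ 2 + delta / e) (fun w =>
    let Y i := weight (h * i%:R) w * (partial i.+1 w - partial i w -
      sigma * X (h * i%:R) w * (W (h * i.+1%:R) w - W (h * i%:R) w)) in
    `|\sum_(i < n.+1) Y i| <= e /\ \sum_(i < n.+1) Y i ^+ 2 <= e).
Proof.
move=> e0 delta0 eps0 ed S1 S2.
have small : holds_but P (eta + eta) (fun w =>
    \sum_(k < N) D k w ^+ 2 * (u k.+1 - u k) <= delta).
  apply: holds_but_le (holds_but_and S1 S2) => // w [E1 E2].
  by apply: le_trans ed; exact: D_energy.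
have H1 := brownian_transform_small fF bW aW iW u_ge0 u_mono delta0 e0 D_adapted small.
have H2 := brownian_block_small fF bW aW iW u_ge0 u_mono (fun k => k %/ m.+1)%N n.+1 delta0 e0 D_adapted small.
apply: holds_but_le (holds_but_and H1 H2).
  by rewrite (_ : eta *+ 4 = eta + eta + (eta + eta)); [lra|ring].
move=> w [K1 K2] Y; split.
  move: K1; rewrite (sum_blocks _ _ (fun k => D k w * (W (u k.+1) w - W (u k) w))).
  by under eq_bigr do rewrite block_sum.
move: K2; congr (_ <= _); apply: eq_bigr => i _; congr (_ ^+ 2).
by rewrite (sum_block_pred (fun k => D k w * (W (u k.+1) w - W (u k) w)))//.
Qed.

End nested_grids.
(** The uniform grid with [i * m.+1] steps on [0, h i] has mesh [h / m.+1] for every i >= 1, so one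
    fine grid serves all coarse times. The coarse grid is fixed first, which makes the union over
    its [n.+2] points harmless. *)
Lemma ito_grid (tau e eta : R) (n : nat) : 0 < tau -> 0 < e -> 0 < eta ->
  let h := tau / n.+1%:R in
  exists M, forall m, (M <= m)%N -> let ka := h / m.+1%:R in
    holds_but P (n.+2%:R * eta) (fun w => forall i, (i < n.+2)%N ->
      `|I (h * i%:R) w - \sum_(k < i * m.+1)
         sigma * X (ka * k%:R) w * (W (ka * k.+1%:R) w - W (ka * k%:R) w)| <= e).
Proof.
move=> tau0 e0 eta0 h.
have h0 : 0 < h by rewrite divr_gt0.
have /choice[f Hf] : forall i : nat, exists M, forall m, (M <= m)%N ->
    holds_but P eta (fun w =>
      `|I (h * i%:R) w - \sum_(k < i * m.+1) sigma * X (h / m.+1%:R * k%:R) w *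
        (W (h / m.+1%:R * k.+1%:R) w - W (h / m.+1%:R * k%:R) w)| <= e).
  case=> [|i].
    exists 0%N => m _; apply: holds_but_le (ito_integral0 e0 eta0) => // w.
    by rewrite mulr0 mul0n big_ord0 subr0.
  have ti : 0 < h * i.+1%:R by rewrite mulr_gt0.
  have [M HM] := ito_riemann fF bW aW iW cadlagZ (hI (ltW ti)) ti e0 eta0.
  exists M => m Mm.
  have pos : (0 < i.+1 * m.+1)%N by rewrite muln_gt0.
  have := HM (i.+1 * m.+1).-1; rewrite prednK// => /(_ _)-/(_ _)[|B [mB PB HB]].
    by rewrite -ltnS prednK// (leq_trans (_ : M < m.+1)%N)// leq_pmull.
  exists B; split => // w /HB.
  have -> : h * i.+1%:R / (i.+1 * m.+1)%:R = h / m.+1%:R.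
    by rewrite natrM invfM mulrA mulfK// pnatr_eq0.
  by [].
exists (\max_(i < n.+2) f i) => m Mm ka.
apply: holds_but_all => i ni; apply: Hf; apply: leq_trans Mm.
exact: (leq_bigmax (Ordinal ni)).
Qed.

(** N depends only on the grid energy. Once n is given, the fine grid is taken so fine that
    replacing Itô integrals by Riemann sums costs little even after summation over the n + 1
    cells. *)
Lemma martingale_error_small (tau e eta : R) : 0 < tau -> 0 < e -> 0 < eta ->
  exists N, forall n, (N <= n)%N -> let h := tau / n.+1%:R in
  holds_but P eta (fun w =>
    let Y i := weight (h * i%:R) w * (I (h * i.+1%:R) w - I (h * i%:R) w -
      sigma * X (h * i%:R) w * (W (h * i.+1%:R) w - W (h * i%:R) w)) in
    `|\sum_(i < n.+1) Y i| <= e /\ \sum_(i < n.+1) Y i ^+ 2 <= e).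
Proof.
move=> tau0 e0 eta0.
have e4 : 0 < e / 4 by rewrite divr_gt0.
(* The minimum makes both [delta / (e / 4) ^+ 2] and [delta / (e / 4)] at most eta/16. *)
pose mi := Num.min ((e / 4) ^+ 2) (e / 4).
have mi0 : 0 < mi by rewrite lt_min exprn_gt0.
have eta16 : 0 < eta / 16 by rewrite divr_gt0.
pose delta := eta / 16 * mi.
have delta0 : 0 < delta by rewrite mulr_gt0.
have K0 : 0 < 4 * (sigma / ustar) ^+ 2.
  by rewrite mulr_gt0// exprn_gt0// divr_gt0.
pose eps := delta / (4 * (sigma / ustar) ^+ 2).
have eps0 : 0 < eps by rewrite divr_gt0.
have epsE : 4 * (sigma / ustar) ^+ 2 * eps <= delta.
  by rewrite /eps mulrC divfK// gt_eqF.
have [N HN] := grid_energy_small mX P cX tau0 eps0 eta16.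
exists N => n Nn h.
(* [r] bounds the change per cell: its sum over the cells is at most e/4, and r <= 1/2 makes the sum
   of r^2 small too. A weight of at most 1/ustar times two Itô errors [e1] gives exactly [r]. *)
pose r := Num.min (2^-1) (e / 4 / n.+1%:R).
have r0 : 0 < r by rewrite lt_min invr_gt0 ltr0n/= divr_gt0.
have r1 : r <= 2^-1 by rewrite ge_min lexx.
have r2 : r * n.+1%:R <= e / 4.
  by rewrite -ler_pdivlMr// ge_min lexx orbT.
pose e1 := r * ustar / 2.
have e10 : 0 < e1 by rewrite divr_gt0// mulr_gt0.
pose eta1 := eta / 16 / n.+2%:R.
have eta10 : 0 < eta1 by rewrite divr_gt0.
have [M HM] := @ito_grid tau e1 eta1 n tau0 e10 eta10.
pose m := M.
have pos : (0 < n.+1 * m.+1)%N by rewrite muln_gt0.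
have S2 := HN n Nn.
(* The mesh h / m.+1 of the nested grid is tau / n'.+1 for some n' >= n. *)
have S1 : holds_but P (eta / 16) (fun w =>
    (grid_energy (X^~ w) tau (h / m.+1%:R) <= eps%:E)%E).
  have := HN (n.+1 * m.+1).-1; rewrite prednK// natrM invfM mulrA; apply.
  by rewrite (leq_trans Nn)// -ltnS prednK// leq_pmulr.
have H1 := nested_martingale_small tau0 e4 delta0 (ltW eps0) epsE S1 S2.
have H2 := HM m (leqnn m).
apply: holds_but_le (holds_but_and H1 H2).
  rewrite /eta1 [X in _ + X]mulrC divfK ?pnatr_eq0//.
  have d1 : delta / (e / 4) ^+ 2 <= eta / 16.
    rewrite ler_pdivrMr ?exprn_gt0// /delta ler_pM2l//.
    by rewrite ge_min lexx.
  have d2 : delta / (e / 4) <= eta / 16.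
    by rewrite ler_pdivrMr// /delta ler_pM2l// ge_min lexx orbT.
  have -> : eta / 16 *+ 4 = eta / 4 by field.
  lra.
move=> w [Z12 close] Y.
pose S i := \sum_(k < i * m.+1) sigma * X (h / m.+1%:R * k%:R) w *
  (W (h / m.+1%:R * k.+1%:R) w - W (h / m.+1%:R * k%:R) w).
pose Z i := weight (h * i%:R) w * (S i.+1 - S i -
  sigma * X (h * i%:R) w * (W (h * i.+1%:R) w - W (h * i%:R) w)).
have [Z1 Z2] : `|\sum_(i < n.+1) Z i| <= e / 4 /\ \sum_(i < n.+1) Z i ^+ 2 <= e / 4
  := Z12.
have diff i : (i < n.+1)%N -> `|Y i - Z i| <= r.
  move=> ni; rewrite /Y /Z -mulrBr normrM ger0_norm ?weight_ge0//.
  have c1 := close i.+1 ni; have c2 := close i (ltnW ni).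
  rewrite -/(S i.+1) in c1; rewrite -/(S i) in c2.
  set q := sigma * _ * _.
  have -> : I (h * i.+1%:R) w - I (h * i%:R) w - q - (S i.+1 - S i - q) =
    (I (h * i.+1%:R) w - S i.+1) - (I (h * i%:R) w - S i) by ring.
  apply: (@le_trans _ _ (ustar^-1 * (e1 + e1))).
    apply: ler_pM => //; first exact: weight_ge0.
      exact: weight_le.
    by rewrite (le_trans (ler_normB _ _))// lerD.
  rewrite le_eqVlt; apply/orP; left; apply/eqP.
  by rewrite /e1; field; rewrite gt_eqF.
split.
  have -> : \sum_(i < n.+1) Y i = \sum_(i < n.+1) Z i + \sum_(i < n.+1) (Y i - Z i).
    by rewrite -big_split/=; apply: eq_bigr => i _; rewrite addrC subrK.
  rewrite (le_trans (ler_normD _ _))//.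
  have : `|\sum_(i < n.+1) (Y i - Z i)| <= e / 4.
    rewrite (le_trans (ler_norm_sum _ _ _))//.
    apply: (@le_trans _ _ (\sum_(i < n.+1) r)).
      by apply: ler_sum => i _; exact: diff.
    by rewrite sumr_const card_ord -[r *+ _]mulr_natr.
  by lra.
apply: (@le_trans _ _ (\sum_(i < n.+1) (2 * Z i ^+ 2 + 2 * r ^+ 2))).
  apply: ler_sum => i _.
  have : (Y i - Z i) ^+ 2 <= r ^+ 2.
    rewrite -(real_normK (num_real (Y i - Z i))) lerXn2r ?nnegrE ?(ltW r0)//.
    exact: diff.
  by have := sqr_ge0 (Z i - (Y i - Z i)); nra.
rewrite big_split/= -mulr_sumr sumr_const card_ord -[_ *+ n.+1]mulr_natr.
have : r * (r * n.+1%:R) <= 2^-1 * (e / 4).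
  by apply: ler_pM => //; [exact: ltW|rewrite mulr_ge0// ltW].
by rewrite expr2; nra.
Qed.

End ito_errors.

(** * Freezing the drift on a grid *)

Section drift_error.
Context (R : realType).
Local Notation mu := lebesgue_measure.
Variable x : R -> R.
Hypotheses (cx : cadlag x) (mx : measurable_fun setT (fun s : R => x (Num.max s 0))).

Lemma measurable_path (D : set R) : measurable D -> D `<=` [set s | 0 <= s] ->
  measurable_fun D x.
Proof.
move=> mD D0; apply: (eq_measurable_fun (fun s : R => x (Num.max s 0))).
  by move=> s; rewrite inE => /D0 /= s0; rewrite max_l.
exact: measurable_funTS.
Qed.

Lemma cadlag_integrable (a t : R) : 0 <= t ->
  mu.-integrable (`[0, t] : set R) (fun s => (a * x s)%:E).
Proof.
move=> t0.
have [B B0 HB] := cadlag_bounded cx t0.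
apply: measurable_bounded_integrable => //.
- by rewrite [X in (X < _)%E]lebesgue_measure_itv/=; case: ifP => _; rewrite -?EFinB ?ltry.
- by apply: measurable_funM => //; apply: measurable_path => // s; rewrite /= in_itv/= => /andP[].
- exists (`|a| * B); split; first exact: num_real.
  move=> M HM s; rewrite /= in_itv/= => /andP[s0 st].
  by rewrite normrM (le_trans _ (ltW HM))// ler_wpM2l// HB.
Qed.

Lemma drift_cell_error (a h : R) (i : nat) : 0 <= a -> 0 < h ->
  (`|\int[mu]_(s in `[0%R, (h * i.+1%:R)%R]) (a * x s)
     - \int[mu]_(s in `[0%R, (h * i%:R)%R]) (a * x s)
     - a * x (h * i%:R) * h|%:E <=
   \int[mu]_(s in `](h * i%:R)%R, (h * i.+1%:R)%R[)
     (a * `|x s - x (gridl h s)|)%:E)%E.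
Proof.
move=> a0 h0.
set t := h * i%:R; set t' := h * i.+1%:R.
have tt' : t < t' by rewrite ltr_pM2l// ltr_nat.
have t0 : 0 <= t by rewrite mulr_ge0// ltW.
have t'0 : 0 <= t' by rewrite (le_trans t0)// ltW.
have tE : t' - t = h by rewrite /t' /t -natr1; ring.
have int := cadlag_integrable a t'0.
have int2 : mu.-integrable (`]t, t'[ : set R) (EFin \o (fun s => a * x s)).
  apply: integrableS int => // s; rewrite /= !in_itv/= => /andP[s1 s2].
  by rewrite (le_trans t0 (ltW s1)) ltW.
have intc : mu.-integrable (`]t, t'[ : set R) (EFin \o (fun s => a * x t)).
  apply: measurable_bounded_integrable => //.
    by rewrite [X in (X < _)%E]lebesgue_measure_itv/=; case: ifP => _; rewrite -?EFinB ?ltry.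
  exists `|a * x t|; split; first exact: num_real.
  by move=> M HM s _; exact: ltW.
rewrite (Rintegral_itvB int); last 2 first.
- by rewrite bnd_simp.
- by rewrite bnd_simp ltW.
rewrite -Rintegral_itv_bndo_bndc//.
have -> : a * x t * h = \int[mu]_(s in `]t, t'[) (a * x t).
  rewrite Rintegral_cst//; congr (_ * _).
  by rewrite [X in fine X]lebesgue_measure_itv/= lte_fin tt' -EFinB/= tE.
rewrite -RintegralB//.
have intB : mu.-integrable (`]t, t'[ : set R) (EFin \o (fun s => a * x s - a * x t)).
  by apply: eq_integrable (integrableB _ int2 intc) => // s _; rewrite /= EFinB.
rewrite EFin_normr_Rintegral//.
apply: le_trans (le_abse_integral _ _ _) _ => //.
  by have /integrableP[] := intB.
rewrite le_eqVlt; apply/orP; left; apply/eqP.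
apply: eq_integral => s; rewrite inE/= in_itv/= => /andP[s1 s2].
rewrite (gridl_eq (j := i) h0) ?(ltW s1)//.
by rewrite -mulrBr normrM (ger0_norm a0).
Qed.

(** The error is an L^1 distance while the energy is an L^2 one; |y| <= c + y^2 / c links them, with
    [c] free for balancing the two terms. *)
Lemma drift_error_le (a tau eps c : R) (n : nat) : 0 < tau -> 0 <= a -> 0 < c ->
  let h := tau / n.+1%:R in
  (grid_energy x tau h <= eps%:E)%E ->
  \sum_(i < n.+1) `|\int[mu]_(s in `[0, h * i.+1%:R]) (a * x s)
     - \int[mu]_(s in `[0, h * i%:R]) (a * x s)
     - a * x (h * i%:R) * h| <= a * (c * tau + eps / c).
Proof.
move=> tau0 a0 c0 h E.
have h0 : 0 < h by rewrite divr_gt0.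
have hN : h * n.+1%:R = tau by rewrite /h divfK.
have mg := measurable_grid_path h0 mx.
pose f (s : R) := (a * `|x (Num.max s 0) - x (gridl h s)|)%:E.
have mf : measurable_fun setT f.
  apply/measurable_EFinP; apply: measurable_funM => //.
  by apply: measurableT_comp => //; exact: measurable_funB.
have f0 s : (0 <= f s)%E by rewrite lee_fin mulr_ge0.
pose u k := h * k%:R.
have um k : u k <= u k.+1 by rewrite /u ler_pM2l// ler_nat.
have := sum_integral_cells n.+1 um mf f0.
rewrite /u mulr0 hN => cells.
rewrite -lee_fin -sumEFin.
apply: le_trans (_ : _ <= _)%E _.
  apply: lee_sum => i _; exact: (@drift_cell_error a h i).
have -> : (\sum_(i < n.+1) \int[mu]_(s in `](h * i%:R)%R, (h * i.+1%:R)%R[)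
     (a * `|x s - x (gridl h s)|)%:E =
   \sum_(i < n.+1) \int[mu]_(s in `](h * i%:R)%R, (h * i.+1%:R)%R[) f s)%E.
  apply: eq_bigr => i _; apply: eq_integral => s; rewrite inE/= in_itv/= => /andP[s1 _].
  have s0 : 0 <= s by rewrite (le_trans _ (ltW s1))// mulr_ge0// ltW.
  by rewrite /f max_l.
apply: (le_trans cells).
apply: (@le_trans _ _ (\int[mu]_(s in `[0%R, tau])
   ((a * c)%:E + (a / c)%:E * ((x s - x (gridl h s)) ^+ 2)%:E))%E).
  apply: ge0_le_integral => //.
  - exact: measurable_funTS.
  - apply: emeasurable_funD => //; apply: measurable_funeM.
    exact: measurable_grid_energy.
  - move=> s; rewrite /= in_itv/= => /andP[s0 _]; rewrite -EFinM -EFinD lee_fin.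
    rewrite max_l// -mulrA -mulrDr ler_wpM2l//.
    set y := x s - _.
    have : 0 <= c^-1 * (`|y| - c) ^+ 2 by rewrite mulr_ge0 ?sqr_ge0// invr_ge0 ltW.
    have -> : c^-1 * (`|y| - c) ^+ 2 = c^-1 * `|y| ^+ 2 - 2 * `|y| + c.
      by field; rewrite gt_eqF.
    rewrite real_normK ?num_real//.
    by have := normr_ge0 y; lra.
rewrite ge0_integralD//; last 3 first.
- by move=> s _; rewrite lee_fin mulr_ge0// ltW.
- by move=> s _; rewrite mule_ge0// lee_fin ?sqr_ge0// divr_ge0// ltW.
- by apply: measurable_funeM; exact: measurable_grid_energy.
rewrite integral_cst// ge0_integralZl//; last 3 first.
- exact: measurable_grid_energy.
- by move=> s _; rewrite lee_fin sqr_ge0.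
- by rewrite lee_fin divr_ge0// ltW.
rewrite mulrDr EFinD leeD//.
  rewrite [X in (_ * X)%E]lebesgue_measure_itv/= lte_fin tau0 sube0 -EFinM.
  by rewrite mulrA.
have -> : a * (eps / c) = a / c * eps by ring.
rewrite [leRHS]EFinM lee_wpmul2l// lee_fin divr_ge0//.
exact: ltW.
Qed.
End drift_error.

(** * Ruin *)

Section brownian_terminal.
Context d (T : measurableType d) (R : realType) (P : probability T R).
Variables (F : R -> set (set T)) (W : R -> {RV P >-> R}).
Hypotheses (fF : filtration F) (bW : brownian_motion W)
  (aW : adapted F (fun t => W t : T -> R))
  (iW : forall s t, 0 <= s -> s <= t ->
    independent P (sigma_rv (fun w => W t w - W s w)) (F s)).

Lemma brownian_small (t e : R) : 0 < t -> 0 < e ->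
  holds_but P (t / e ^+ 2) (fun w => `|W t w| <= e).
Proof.
move=> t0 e0.
(* One cell [0, t], followed by empty ones: Chebyshev's inequality for [W t] becomes the simplest
   transform. *)
pose u (k : nat) : R := if k is 0%N then 0 else t.
have u0 : 0 <= u 0%N by [].
have um k : u k <= u k.+1 by case: k => [|k] //=; exact: ltW.
have one k : sigma_rv (cst (1 : R) : T -> R) `<=` F (u k).
  have sG : sigma_algebra setT (F (u k)).
    by apply: filtration_sigma fF _ _; exact: grid_ge0.
  by apply/(sigma_rvP sG); exact: measurable_cst.
have H : holds_but P 0 (fun w => \sum_(k < 1) (cst 1 w : R) ^+ 2 * (u k.+1 - u k) <= t).
  exists set0; split; rewrite ?measure0// => w _.
  by rewrite big_ord1 /= expr1n mul1r subr0.
have := brownian_transform_small fF bW aW iW u0 um (D := fun=> cst 1) t0 e0 one H.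
rewrite add0r; apply: holds_but_le => // w.
by rewrite big_ord1/= mul1r (brownian0 bW) subr0.
Qed.
End brownian_terminal.

(** * Measurability of the survival event *)

Section ruin_event.
Context d (T : measurableType d) (R : realType).
Variables (X : R -> T -> R) (ustar : R).
Hypotheses (cX : forall w, cadlag (X^~ w))
  (mX : forall t, 0 <= t -> measurable_fun setT (X t)).

Lemma ruin_timeE w : (ruin_time X ustar w < +oo)%E <->
  ~ (forall t, 0 < t -> ustar <= X t w).
Proof.
split => [/ereal_inf_lt[_ [t [t0 Xt] <-] _] H|].
  by have := lt_le_trans Xt (H t t0); rewrite ltxx.
move=> /existsNP[t /not_implyP[t0 /negP]]; rewrite -ltNge => Xt.
rewrite (le_lt_trans (ereal_inf_lbound _) (ltry t))//.
by exists t.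
Qed.

(** By right-continuity a value below [ustar] persists for a short while to the right, where some
    positive fraction is found. *)
Lemma survivalE : [set w | forall t, 0 < t -> ustar <= X t w] =
  \bigcap_i \bigcap_j [set w | ustar <= X (i.+1%:R / j.+1%:R) w].
Proof.
apply/seteqP; split => w H; first by move=> i _ j _; apply: H; rewrite divr_gt0.
move=> t t0; rewrite leNgt; apply/negP => Xt.
have [xr _] := cX w.
have /cvgrPdist_lt := xr t (ltW t0).
move=> /(_ (ustar - X t w)); rewrite subr_gt0 => /(_ Xt)[del /= del0 Hdel].
pose j := Num.truncn del^-1.
have j0 : 0 < j.+1%:R :> R by [].
have jdel : j.+1%:R^-1 < del.
  by rewrite -[ltRHS]invrK ltf_pV2 ?posrE ?invr_gt0// truncnS_gt.
pose i := Num.truncn (t * j.+1%:R).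
have tj0 : 0 <= t * j.+1%:R by rewrite mulr_ge0// ltW.
have /andP[i1 i2] := truncn_itv tj0.
have := H i I j I => /=; rewrite leNgt => /negP; apply.
have ti : t < i.+1%:R / j.+1%:R by rewrite ltr_pdivlMr.
have it : i.+1%:R / j.+1%:R < t + del.
  rewrite -natr1 mulrDl mul1r (le_lt_trans (_ : _ <= t + j.+1%:R^-1))//.
    by rewrite lerD2r ler_pdivrMr.
  by rewrite ltrD2l.
have := Hdel (i.+1%:R / j.+1%:R); rewrite /= ltr0_norm ?subr_lt0// opprB.
rewrite ltrBlDl => /(_ it ti); rewrite distrC => /(le_lt_trans (ler_norm _)).
by rewrite ltrD2r.
Qed.

Lemma measurable_survival :
  measurable [set w | forall t, 0 < t -> ustar <= X t w].
Proof.
rewrite survivalE; apply: bigcapT_measurable => i; apply: bigcapT_measurable => j.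
by apply: measurable_le_set => //; apply: mX; rewrite divr_ge0.
Qed.

(** The hypothesis controls only events containing the survival set; measurability of that set turns
    this into probability 0. *)
Lemma ruin_probability1 (P : probability T R) :
  (forall eta, 0 < eta ->
    holds_but P eta (fun w => ~ (forall t, 0 < t -> ustar <= X t w))) ->
  ruin_probability P X ustar = 1%E.
Proof.
move=> H.
have mS := measurable_survival.
have S0 : P [set w | forall t, 0 < t -> ustar <= X t w] = 0%E.
  apply/eqP; rewrite eq_le measure_ge0 andbT; apply/lee_addgt0Pr => eta eta0.
  rewrite add0e; have [B [mB PB HB]] := H eta eta0.
  apply: le_trans PB; apply: le_measure; rewrite ?inE// => w Sw.
  by apply: contrapT => Bw; exact: HB Bw Sw.
rewrite /ruin_probability (_ : [set w | _] =
   ~` [set w | forall t, 0 < t -> ustar <= X t w]).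
  by rewrite probability_setC// S0 sube0.
by apply/seteqP; split => w /=; rewrite ruin_timeE.
Qed.
End ruin_event.

Lemma holds_but_near d (T : measurableType d) (R : realType)
    (P : probability T R) (K eta : R) (Q : nat -> T -> Prop) : 0 < eta ->
  (forall n, holds_but P (K / n.+1%:R) (Q n)) ->
  exists N, forall n, (N <= n)%N -> holds_but P eta (Q n).
Proof.
move=> eta0 H; exists (Num.truncn (K / eta)) => n Nn.
apply: holds_but_le (H n) => //.
have : K / eta <= n.+1%:R.
  by rewrite (le_trans (ltW (truncnS_gt _)))// ler_nat.
by rewrite !ler_pdivrMr// mulrC.
Qed.

Lemma total_claims_mono d (T : measurableType d) (R : realType)
    (P : probability T R) (lambda : R) (N : R -> {RV P >-> nat})
    (xi : nat -> {RV P >-> R}) (s t : R) w :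
  poisson_process lambda N -> (forall j, 0 < xi j w) -> 0 <= s -> s <= t ->
  total_claims N xi s w <= total_claims N xi t w.
Proof.
move=> pN xi0 s0 st; rewrite /total_claims.
rewrite -!(big_mkord xpredT (fun j => xi j w)).
rewrite [leRHS](big_cat_nat (n := N s w))//=.
  by rewrite lerDl sumr_ge0// => j _; exact: ltW.
exact: (poisson_nondecreasing pN).
Qed.

Lemma sum_sqr_le (R : realDomainType) (n : nat) (f : nat -> R) :
  \sum_(i < n) f i ^+ 2 <= (\sum_(i < n) `|f i|) ^+ 2.
Proof.
elim: n => [|n IH]; first by rewrite !big_ord0 expr0n.
rewrite !big_ord_recr/= -(real_normK (num_real (f n))).
have : 0 <= \sum_(i < n) `|f i| by rewrite sumr_ge0.
by have := normr_ge0 (f n); nra.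
Qed.

(** * The logarithmic bound on survival *)

Section log_growth.
Context d (T : measurableType d) (R : realType) (P : probability T R).
Variables (a sigma c lambda mu : R) (p : R -> R) (F : R -> set (set T))
  (W : R -> {RV P >-> R}) (N : R -> {RV P >-> nat}) (xi : nat -> {RV P >-> R}).
Hypotheses (a0 : 0 < a) (sigma0 : 0 < sigma) (c0 : 0 < c)
  (model : cramer_lundberg_model lambda mu p F W N xi).
Variables (ustar x0 : R) (X : R -> T -> R).
Hypotheses (ustar0 : 0 < ustar) (x0_ge : ustar <= x0)
  (rX : risk_process a sigma c F W N xi x0 X).

Let fF := model_filtration model.
Let bW := model_brownian model.
Let aW := model_brownian_adapted model.
Let iW := model_brownian_increments model.
Let aX := risk_adapted rX.
Let cX := risk_cadlag rX.

(** The final 1 absorbs every discretization error: 1/4 from [theta], 1/8 from the quadratic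
    variation, 1/8 from the squares of drift and errors, and [2 * kap] from the sum of the
    errors. *)
Lemma log_growth (tau eta : R) : 0 < tau -> 0 < eta ->
  holds_but P eta (fun w => (forall t, 0 < t -> ustar <= X t w) ->
    ln ustar <= ln x0 + (a + c / ustar - sigma ^+ 2 / 2) * tau + sigma * W tau w + 1).
Proof.
move=> tau0 eta0.
have [I [hI Heq]] := risk_equation rX.
(* Joint measurability is part of the integrability of sigma X, and is recovered by dividing by
   [sigma]. *)
have mX : measurable_fun setT (fun z : R * T => X (Num.max z.1 0) z.2).
  have [[mH _ _] _] := hI 0 (lexx 0).
  have := measurable_funM (f := cst sigma^-1) (measurable_cst _) (measurable_nonneg_time (H := fun s w => sigma * X s w) mH).
  congr measurable_fun; apply/funext => z /=.
  by rewrite mulKf ?gt_eqF.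
pose a' := a + c / ustar.
have a'0 : 0 < a' by rewrite addr_gt0// divr_gt0.
(* The first bound is the one required by the expansion; the second makes the loss theta sigma^2 tau
   in the quadratic term at most 1/4. *)
pose theta := Num.min (1 / 2) (1 / (4 * (1 + sigma ^+ 2 * tau))).
have st0 : 0 < sigma ^+ 2 * tau by rewrite mulr_gt0// exprn_gt0.
have st1 : 0 < 4 * (1 + sigma ^+ 2 * tau) by lra.
have theta0 : 0 < theta by rewrite lt_min !divr_gt0.
have theta2 : theta <= 1 / 2 by rewrite ge_min lexx.
have theta_st : theta * (sigma ^+ 2 * tau) <= 1 / 4.
  have : theta <= 1 / (4 * (1 + sigma ^+ 2 * tau)) by rewrite ge_min lexx orbT.
  rewrite ler_pdivlMr//; nra.
(* The squared errors will be at most [4 * kap], that is theta^2 / 25. With theta^2 / 9 each for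
   drift and noise, three times the total stays below theta^2, as [log_path_le] demands. *)
pose kap := theta ^+ 2 / 100.
have t20 : 0 < theta ^+ 2 by rewrite exprn_gt0.
have kap0 : 0 < kap by rewrite divr_gt0.
pose g := theta ^+ 2 / (9 * sigma ^+ 2).
have s20 : 0 < sigma ^+ 2 by rewrite exprn_gt0.
have g0 : 0 < g by rewrite divr_gt0// mulr_gt0.
pose e3 := 1 / (4 * sigma ^+ 2).
have e30 : 0 < e3 by rewrite divr_gt0// mulr_gt0.
(* [k] and [eps] balance the two terms of [drift_error_le]: each becomes half of [kap * ustar], and
   the weight removes the factor [ustar]. *)
pose k := kap * ustar / (2 * a * tau).
have k0 : 0 < k by rewrite !(divr_gt0, mulr_gt0).
pose eps := k * (kap * ustar / (2 * a)).
have eps0 : 0 < eps by rewrite !(divr_gt0, mulr_gt0).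
have drift_bound : a * (k * tau + eps / k) = kap * ustar.
  by rewrite /eps /k; field; rewrite !gt_eqF ?mulr_gt0.
have eta4 : 0 < eta / 4 by rewrite divr_gt0.
have [N1 H1] := grid_energy_small mX P cX tau0 eps0 eta4.
have [N2 H2] := martingale_error_small fF bW aW iW aX cX mX sigma0 ustar0 hI tau0 kap0 eta4.
have sum64 n : \sum_(j < n.+1) 64 * (tau / n.+1%:R * j.+1%:R - tau / n.+1%:R * j%:R) ^+ 2 =
    64 * tau ^+ 2 / n.+1%:R.
  rewrite (eq_bigr (fun=> 64 * (tau / n.+1%:R) ^+ 2)); last first.
    by move=> j _; congr (_ * _ ^+ 2); rewrite -natr1; ring.
  rewrite sumr_const card_ord -[_ *+ n.+1]mulr_natr.
  by field; rewrite nat1r pnatr_eq0.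
have u0 n : 0 <= (fun j : nat => tau / n.+1%:R * j%:R) 0%N by rewrite mulr0.
have um n j : (fun j : nat => tau / n.+1%:R * j%:R) j <= (fun j : nat => tau / n.+1%:R * j%:R) j.+1.
  by rewrite ler_pM2l ?divr_gt0// ler_nat.
have [N3 H3] : exists M, forall n, (M <= n)%N -> holds_but P (eta / 4) (fun w =>
    `|\sum_(j < n.+1) ((W (tau / n.+1%:R * j.+1%:R) w - W (tau / n.+1%:R * j%:R) w) ^+ 2
      - (tau / n.+1%:R * j.+1%:R - tau / n.+1%:R * j%:R))| <= e3).
  apply: (@holds_but_near _ _ _ P (64 * tau ^+ 2 / e3 ^+ 2)) => // n.
  have := brownian_quadratic_variation fF bW aW iW (u0 n) (um n) n.+1 e30.
  by apply: holds_but_le => //; rewrite sum64 mulrAC.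
have [N4 H4] : exists M, forall n, (M <= n)%N -> holds_but P (eta / 4) (fun w =>
    \sum_(j < n.+1) (W (tau / n.+1%:R * j.+1%:R) w - W (tau / n.+1%:R * j%:R) w) ^+ 4 <= g ^+ 2).
  apply: (@holds_but_near _ _ _ P (64 * tau ^+ 2 / g ^+ 2)) => // n.
  have g20 : 0 < g ^+ 2 by rewrite exprn_gt0.
  have := brownian_fourth_powers_small bW (u0 n) (um n) n.+1 g20.
  by apply: holds_but_le => //; rewrite sum64 mulrAC.
(* Makes a'^2 h tau at most theta^2 / 9, which bounds the sum of the (a' h)^2 and therefore each of
   them. *)
pose N5 := Num.truncn (9 * a' ^+ 2 * tau ^+ 2 / theta ^+ 2).
pose n := maxn (maxn N1 N2) (maxn (maxn N3 N4) N5).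
have n1 : (N1 <= n)%N by rewrite /n !leq_max leqnn.
have n2 : (N2 <= n)%N by rewrite /n !leq_max leqnn ?orbT.
have n3 : (N3 <= n)%N by rewrite /n !leq_max leqnn ?orbT.
have n4 : (N4 <= n)%N by rewrite /n !leq_max leqnn ?orbT.
have n5 : (N5 <= n)%N by rewrite /n !leq_max leqnn ?orbT.
clearbody n.
pose h := tau / n.+1%:R.
have h0 : 0 < h by rewrite divr_gt0.
have hn : h * n.+1%:R = tau by rewrite /h divfK.
have a'h : a' ^+ 2 * h * tau <= theta ^+ 2 / 9.
  have : 9 * a' ^+ 2 * tau ^+ 2 / theta ^+ 2 <= n.+1%:R.
    by rewrite (le_trans (ltW (truncnS_gt _)))// ler_nat.
  rewrite ler_pdivrMr// => K.
  rewrite /h mulrA -mulrA (mulrC _^-1) mulrA ler_pdivrMr//.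
  by nra.
(* The equation holds almost surely at each single time, so it is used only at the finitely many
   grid times. *)
have H5 : holds_but P 0 (fun w => forall i, (i < n.+2)%N ->
    X (h * i%:R) w = X 0 w + \int[lebesgue_measure]_(s in `[0, h * i%:R]) (a * X s w)
       + I (h * i%:R) w + c * (h * i%:R) - total_claims N xi (h * i%:R) w).
  apply: (holds_but_le (eta1 := n.+2%:R * 0)); [by rewrite mulr0|move=> w; exact|].
  apply: holds_but_all => i _.
  have hi0 : 0 <= h * i%:R by rewrite mulr_ge0// ltW.
  exact: holds_but_ae (lexx 0) (Heq _ hi0).
have H6 : holds_but P 0 (fun w => forall j, 0 < xi j w).
  apply: holds_but_ae => //; apply/ae_foralln => j.
  exact: claims_positive (model_claims model) j.
have := holds_but_and (holds_but_and (holds_but_and (H1 n n1) (H2 n n2))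
  (holds_but_and (H3 n n3) (H4 n n4))) (holds_but_and H5 H6).
apply: holds_but_le; first by lra.
move=> w [] [] []; rewrite -/h => E [S1 S2] [Q1 Q2] [eqX xi0] survive.
pose x i := X (h * i%:R) w.
pose dw i := W (h * i.+1%:R) w - W (h * i%:R) w.
pose J i := \int[lebesgue_measure]_(s in `[0, h * i%:R]) (a * X s w).
pose Y i := I (h * i.+1%:R) w - I (h * i%:R) w - sigma * x i * dw i.
pose dr i := J i.+1 - J i - a * x i * h.
pose ph i := weight X ustar (h * i%:R) w.
(* Errors relative to the current value: on survival the weight is 1 / x, so [x i * ep i] is the
   absolute error and each step is multiplicative. *)
pose ep i := ph i * dr i + ph i * Y i.
(* Survival concerns positive times only; at time 0 the bound is that on the initial capital. *)
have xge i : ustar <= x i.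
  case: i => [|i]; first by rewrite /x mulr0 (risk_initial rX).
  by apply: survive; rewrite mulr_gt0.
have phE i : ph i = (x i)^-1 by rewrite /ph /weight max_l //; exact: xge.
have ph0 i : 0 <= ph i by exact: weight_ge0.
have dr_sum : \sum_(i < n.+1) `|ph i * dr i| <= kap.
  have := drift_error_le (cX w) (measurable_section mX w) tau0 (ltW a0) k0 E.
  rewrite drift_bound => D.
  apply: (@le_trans _ _ (\sum_(i < n.+1) ustar^-1 * `|dr i|)).
    apply: ler_sum => i _; rewrite normrM ger0_norm// ler_wpM2r//.
    exact: weight_le.
  by rewrite -mulr_sumr ler_pdivrMl// mulrC.
have kap1 : kap <= 1 / 100.
  rewrite /kap ler_pdivrMr//; have : theta ^+ 2 <= 1 by rewrite expr_le1 ?ltW//; lra.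
  by lra.
have ep1 : \sum_(i < n.+1) ep i <= 2 * kap.
  rewrite big_split/= mulr_natl mulr2n lerD//.
    by apply: le_trans dr_sum; apply: ler_sum => i _; exact: ler_norm.
  exact: le_trans (ler_norm _) S1.
have ep2 : \sum_(i < n.+1) ep i ^+ 2 <= 4 * kap.
  apply: (@le_trans _ _ (\sum_(i < n.+1) (2 * (ph i * dr i) ^+ 2 + 2 * (ph i * Y i) ^+ 2))).
    apply: ler_sum => i _; rewrite /ep.
    by have := sqr_ge0 (ph i * dr i - ph i * Y i); nra.
  rewrite big_split/= -!mulr_sumr.
  have := sum_sqr_le n.+1 (fun i => ph i * dr i).
  have sn0 : 0 <= \sum_(i < n.+1) `|ph i * dr i| by rewrite sumr_ge0.
  have : (\sum_(i < n.+1) `|ph i * dr i|) ^+ 2 <= kap ^+ 2.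
    by rewrite lerXn2r ?nnegrE ?(ltW kap0).
  have : \sum_(i < n.+1) (ph i * Y i) ^+ 2 <= kap by exact: S2.
  by nra.
have epi i : (i < n.+1)%N -> ep i ^+ 2 <= 4 * kap.
  move=> ni; apply: le_trans ep2; rewrite (bigD1 (Ordinal ni))//= lerDl.
  by rewrite sumr_ge0// => j _; rewrite sqr_ge0.
have dwi i : (i < n.+1)%N -> dw i ^+ 2 <= g.
  move=> ni; rewrite -(@ler_pXn2r _ 2)// ?nnegrE ?sqr_ge0 ?(ltW g0)//.
  rewrite -exprM; apply: le_trans Q2; rewrite (bigD1 (Ordinal ni))//= lerDl.
  by rewrite sumr_ge0// => j _; rewrite (exprM _ 2 2) sqr_ge0.
have qv : h * n.+1%:R - e3 <= \sum_(i < n.+1) dw i ^+ 2.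
  have hsum : \sum_(i < n.+1) (h * i.+1%:R - h * i%:R) = h * n.+1%:R.
    rewrite -(big_mkord xpredT (fun i => h * i.+1%:R - h * i%:R)).
    by rewrite (telescope_sumr (fun i => h * i%:R))// mulr0 subr0.
  move: Q1; rewrite sumrB hsum ler_norml => /andP[Q _].
  have {}Q : - e3 <= \sum_(i < n.+1) dw i ^+ 2 - h * n.+1%:R by exact: Q.
  by lra.
have step i : (i < n.+1)%N ->
    x i.+1 <= x i * (1 + (sigma * dw i + (a' * h + ep i))).
  move=> ni.
  have xpos : 0 < x i by exact: lt_le_trans (xge i).
  have claims : total_claims N xi (h * i%:R) w <= total_claims N xi (h * i.+1%:R) w.
    apply: total_claims_mono (model_poisson model) xi0 _ _.
      by rewrite mulr_ge0// ltW.
    by rewrite ler_pM2l// ler_nat.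
  have E1 := eqX i.+1 ni; have E2 := eqX i (ltnW ni).
  rewrite -/(x i.+1) -/(J i.+1) in E1; rewrite -/(x i) -/(J i) in E2.
  have xep : x i * ep i = dr i + Y i.
    by rewrite /ep phE -mulrDr mulrA divff ?mul1r// gt_eqF.
  have premium : c * h <= x i * (c / ustar * h).
    rewrite (_ : c * h = ustar * (c / ustar * h)); last by field; rewrite gt_eqF.
    by rewrite ler_wpM2r// mulr_ge0 ?(ltW h0)// divr_ge0// ltW.
  have -> : x i * (1 + (sigma * dw i + (a' * h + ep i))) =
      x i + sigma * x i * dw i + a * x i * h + x i * (c / ustar * h) + x i * ep i.
    by rewrite /a'; ring.
  have hi : c * (h * i.+1%:R) = c * (h * i%:R) + c * h by rewrite -natr1; ring.
  rewrite xep /dr /Y E1 hi; move: E2; lra.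
have := @log_path_le R n.+1 x dw ep a' sigma h ustar theta (2 * kap) (4 * kap) e3.
rewrite theta0 theta2 => /(_ isT ustar0 (fun i _ => xge i) step) H.
have {}H := H _ ep1 ep2 qv.
have Wsum : \sum_(i < n.+1) dw i = W tau w.
  rewrite -(big_mkord xpredT dw) (telescope_sumr (fun i => W (h * i%:R) w))//.
  by rewrite hn mulr0 (brownian0 bW) subr0.
have x00 : x 0%N = x0 by rewrite /x mulr0 (risk_initial rX).
have lnx : ln ustar <= ln (x n.+1).
  by rewrite ler_ln ?posrE// (lt_le_trans ustar0).
apply: (le_trans lnx).
have Hhn : a' ^+ 2 * h ^+ 2 * n.+1%:R = a' ^+ 2 * h * tau by rewrite -hn; ring.
rewrite Wsum x00 Hhn hn in H.
apply: le_trans (H _) _.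
  move=> i ni; have := dwi i ni; have := epi i ni => P1 P2.
  have P3 : sigma ^+ 2 * dw i ^+ 2 <= theta ^+ 2 / 9.
    rewrite (_ : theta ^+ 2 / 9 = sigma ^+ 2 * g); first by rewrite ler_wpM2l// ltW.
    by rewrite /g; field; rewrite gt_eqF.
  have P4 : a' ^+ 2 * h ^+ 2 <= theta ^+ 2 / 9.
    apply: le_trans a'h; rewrite expr2 mulrA ler_wpM2l//.
      by rewrite mulr_ge0 ?sqr_ge0// ltW.
    by rewrite -hn ler_peMr ?(ltW h0)// ler1n.
  by move: P1; rewrite /kap; lra.
have K1 : theta^-1 * (a' ^+ 2 * h * tau + 4 * kap) <= 1 / 8.
  apply: (@le_trans _ _ (theta^-1 * (theta ^+ 2 / 9 + 4 * kap))).
    by rewrite ler_wpM2l ?invr_ge0 ?(ltW theta0)// lerD2r.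
  rewrite /kap (_ : theta^-1 * _ = theta / 9 + theta / 25); first by lra.
  by field; rewrite gt_eqF.
have K2 : sigma ^+ 2 * e3 = 1 / 4 by rewrite /e3; field; rewrite gt_eqF.
have K3 : - ((1 / 2 - theta) * sigma ^+ 2 * (tau - e3)) <=
    - (sigma ^+ 2 * tau / 2) + 3 / 8.
  have -> : (1 / 2 - theta) * sigma ^+ 2 * (tau - e3) = sigma ^+ 2 * tau / 2
     - theta * (sigma ^+ 2 * tau) - (1 / 2 - theta) * (sigma ^+ 2 * e3) by field.
  by rewrite K2; lra.
by move: K1 K3 kap1; rewrite /a'; lra.
Qed.
End log_growth.

Theorem lemma2p2 (R : realType) (d : measure_display) (T : measurableType d)
    (P : probability T R) (a sigma c lambda mu M : R) (p : R -> R)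
    (F : R -> set (set T)) (W : R -> {RV P >-> R}) (N : R -> {RV P >-> nat})
    (xi : nat -> {RV P >-> R}) :
  0 < a -> 0 < sigma -> 0 < c -> 0 < lambda -> 0 < mu -> 0 < M ->
  cramer_lundberg_model lambda mu p F W N xi ->
  (forall j, {ae P, forall w, xi j w <= M}) ->
  2 * a / sigma ^+ 2 < 1 ->
  exists ustar : R, M < ustar /\
    forall u, ustar <= u ->
    forall X : R -> T -> R, risk_process a sigma c F W N xi u X ->
      ruin_probability P X ustar = 1%E.
Proof.
move=> a0 sigma0 c0 _ _ M0 model _ rho1.
have s20 : 0 < sigma ^+ 2 by rewrite exprn_gt0.
pose nu0 := sigma ^+ 2 / 2 - a.
have nu00 : 0 < nu0.
  by move: rho1; rewrite ltr_pdivrMr// mul1r /nu0; lra.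
(* [nu0] is positive exactly because rho < 1. The last summand gives c / ustar <= nu0 / 2, so the
   premium uses up at most half of the negative drift; M + 1 puts the level above M. The level does
   not depend on [u]. *)
pose ustar := M + 1 + 2 * c / nu0.
have q0 : 0 < 2 * c / nu0 by rewrite divr_gt0// mulr_gt0.
have ustar0 : 0 < ustar by rewrite /ustar; lra.
exists ustar; split; first by rewrite /ustar; lra.
move=> u uu X rX.
pose nu := sigma ^+ 2 / 2 - (a + c / ustar).
have nu_gt0 : 0 < nu.
  have : c / ustar <= nu0 / 2.
    have qu : 2 * c / nu0 <= ustar by rewrite /ustar; lra.
    move: qu; rewrite !ler_pdivrMr// => qu; lra.
  by move: nu00; rewrite /nu /nu0; lra.
have fF := model_filtration model.
have mX t : 0 <= t -> measurable_fun setT (X t).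
  move=> t0; apply: sigma_rv_measurable (risk_adapted rX t0).
  exact: filtration_sub fF _ t0.
apply: (ruin_probability1 (risk_cadlag rX) mX) => eta eta0.
pose K := 1 + ln u - ln ustar.
have K1 : 1 <= K.
  have : ln ustar <= ln u by rewrite ler_ln ?posrE// (lt_le_trans ustar0).
  by rewrite /K; lra.
(* Survival forces 0 <= K - nu tau + sigma W. The first summand gives K <= nu tau / 4, a
   contradiction as soon as sigma W <= nu tau / 2; the second makes the Chebyshev bound 4 sigma^2 /
   (nu^2 tau) for the failure of the latter at most eta/2. *)
pose tau := 4 * K / nu + 8 * sigma ^+ 2 / (nu ^+ 2 * eta).
have nu2 : 0 < nu ^+ 2 * eta by rewrite mulr_gt0// exprn_gt0.
have t1 : 0 < 4 * K / nu by rewrite divr_gt0//; lra.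
have t2 : 0 < 8 * sigma ^+ 2 / (nu ^+ 2 * eta) by rewrite divr_gt0// mulr_gt0.
have tau0 : 0 < tau by rewrite addr_gt0.
have tauK : 4 * K <= nu * tau.
  by rewrite [leRHS]mulrC -ler_pdivrMr// /tau; lra.
have taueta : 8 * sigma ^+ 2 <= tau * (nu ^+ 2 * eta).
  by rewrite -ler_pdivrMr// /tau; lra.
have eta2 : 0 < eta / 2 by rewrite divr_gt0.
pose e := nu * tau / (2 * sigma).
have e0 : 0 < e by rewrite divr_gt0 ?mulr_gt0.
have H1 := log_growth a0 sigma0 c0 model ustar0 uu rX tau0 eta2.
have H2 := brownian_small fF (model_brownian model) (model_brownian_adapted model)
  (model_brownian_increments model) tau0 e0.
apply: holds_but_le (holds_but_and H1 H2).
  rewrite [leRHS]splitr lerD2l ler_pdivrMr ?exprn_gt0// /e.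
  rewrite (_ : eta / 2 * _ = tau * (tau * (nu ^+ 2 * eta)) / (8 * sigma ^+ 2)).
    by rewrite ler_pdivlMr ?mulr_gt0// ler_pM2l.
  by field; rewrite gt_eqF.
move=> w [L /ler_normlP[_ We]] survive.
have := L survive.
have : sigma * W tau w <= nu * tau / 2.
  rewrite (_ : nu * tau / 2 = sigma * e); first by rewrite ler_pM2l.
  by rewrite /e; field; rewrite gt_eqF.
move: K1 tauK; rewrite /K /nu; nra.
Qed.
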